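(* Let $\mathbf E,\mathbf X,\mathbf F$ be Banach spaces with continuous embeddings $\imath:\mathbf E\hookrightarrow\mathbf X$, $\jmath:\mathbf X\hookrightarrow\mathbf F$, and let $A\in\mathscr C(\mathbf X)$ satisfy the Extension Assumption (see context). Let $\Omega\subset\mathbb C\setminus\sigma(A)$ and let $z_0\in\sigma_{\mathrm{ess}}(A)\cap\partial\Omega$. (1) Assume that there is a sequence of $\hat A$-bounded perturbations $\mathcal B_j:\mathbf F\to\mathbf E$, $j\in\mathbb N$, with $$\lim_{j\to\infty}\|\mathcal B_j\|_{\mathfrak D(\hat A)\to\mathbf E}=0,$$ and a corresponding sequence $z_j\in\sigma(A+\imath\circ\mathcal B_j\circ\jmath)\cap\Omega$, $j\in\mathbb N$, $z_j\to z_0$. If either all $\mathcal B_j$, $j\in\mathbb N$, are $\hat A$-compact, or $z_j\in\sigma_{\mathrm p}(A+\imath\circ\mathcal B_j\circ\jmath)\cap\Omega$ for all $j\in\mathbb N$, then $$\limsup_{j\to\infty}\|\jmath\circ(A-z_jI_{\mathbf X})^{-1}\circ\imath\|_{\mathbf E\to\mathbf F}=\infty.$$ (2) Assume that $\Omega$ is contained in one connected component of $\mathbb C\setminus\sigma_{\mathrm{ess},1}(A)$, and that $z_0$ is a virtual level of $A$ relative to $(\mathbf E,\mathbf F,\Omega)$ (see context). Then there is $\delta>0$ such that for any sequence $z_j\in\Omega\cap\mathbb D_\delta(z_0)$, $j\in\mathbb N$, $z_j\to z_0$, there are $\mathcal B\in\mathscr B_{00}(\mathbf F,\mathbf E)$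 and a sequence $\zeta_j\in\mathbb C$, $\zeta_j\to0$, such that $$z_j\in\sigma_{\mathrm d}(A+\zeta_jB),\quad j\in\mathbb N,\qquad\text{where }B=\imath\circ\mathcal B\circ\jmath\in\mathscr B_{00}(\mathbf X).$$
   Context: All Banach spaces are complex; $\mathbf X$ is infinite-dimensional. $\mathscr C(\mathbf X)$ is the set of closed linear operators in $\mathbf X$; $\mathscr B(\mathbf E,\mathbf F)$ and $\mathscr B_{00}(\mathbf E,\mathbf F)$ are the spaces of bounded and of bounded finite rank operators; $\mathfrak D(\cdot)$, $\mathfrak R(\cdot)$ denote domain and range. Continuous embeddings are injective bounded linear maps, not necessarily with dense range. $\mathbb D_\delta(z_0)\subset\mathbb C$ is the open disk. $\sigma_{\mathrm p}$ is the set of eigenvalues; $\sigma_{\mathrm d}(A)$ is the set of isolated points $z$ of $\sigma(A)$ for which $A-zI$ is Fredholm (equivalently, with finite-rank Riesz projection); $\sigma_{\mathrm{ess}}(A)=\sigma(A)\setminus\sigma_{\mathrm d}(A)$. $\sigma_{\mathrm{ess},1}(A)$ is the set of $z\in\sigma(A)$ such that either $\mathfrak R(A-zI)$ is not closed or both $\ker(A-zI)$ and $\mathbf X/\mathfrak R(A-zI)$ are infinite-dimensional. Weak$^*$ convention: if $\mathbf F$ has a pre-dual, one pre-dual is fixed; weak$^*$ operator convergence in $\mathscr B(\mathbf E,\mathbf F)$ means weak$^*$ convergence in $\mathbf F$ on each vector of $\mathbf E$. References to weak$^*$ convergence are discarded if $\mathbf F$ has no pre-dual. Extension Assumption: the operator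 $A_{\mathbf F\to\mathbf F}$ in $\mathbf F$ with domain $\jmath(\mathfrak D(A))$, $\Psi\mapsto\jmath(A\jmath^{-1}(\Psi))$, is closable in $\mathbf F$, with closure $\hat A\in\mathscr C(\mathbf F)$. If $\mathbf F$ has a pre-dual and convergence of the resolvent in the weak$^*$ operator topology is considered, then additionally the graph of $\hat A$ is assumed weak$^*$-closed. $\mathfrak D(\hat A)$ carries the graph norm $\|x\|_{\mathbf F}+\|\hat Ax\|_{\mathbf F}$. A linear operator $\mathcal B:\mathbf F\to\mathbf E$ with $\mathfrak D(\mathcal B)\supset\mathfrak D(\hat A)$ is $\hat A$-bounded (respectively $\hat A$-compact) if its restriction $\mathfrak D(\hat A)\to\mathbf E$ is bounded (respectively compact). Virtual level: the point $z_0\in\sigma_{\mathrm{ess}}(A)\cap\partial\Omega$ is of rank $r\in\{0,1,2,\dots\}$ relative to $(\mathbf E,\mathbf F,\Omega)$ if $r$ is the smallest nonnegative integer for which there is $\mathcal B\in\mathscr B_{00}(\mathbf F,\mathbf E)$ of rank $r$ such that, with $B=\imath\circ\mathcal B\circ\jmath$, for some $\delta>0$ one has $\Omega\cap\sigma(A+B)\cap\mathbb D_\delta(z_0)=\emptyset$ and $\jmath\circ(A+B-zI_{\mathbf X})^{-1}\circ\imath$ has a limit as $z\to z_0$, $z\in\Omega\cap\mathbb D_\delta(z_0)$, in the weak or weak$^*$ operator topology of $\mathscr B(\mathbf E,\mathbf F)$. It is a virtual level if it is of some rank $r\ge1$. *)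

(* Defs.v *)
From HB Require Import structures.
From mathcomp Require Import all_boot all_order all_algebra.
From mathcomp Require Import all_classical all_reals all_analysis.
From mathcomp Require Import complex.
Set Implicit Arguments.
Unset Strict Implicit.
Unset Printing Implicit Defensive.
Import Order.TTheory GRing.Theory Num.Theory.
Import numFieldNormedType.Exports.
Local Open Scope classical_set_scope.
Local Open Scope ring_scope.
Local Open Scope complex_scope.

(* numFieldNormedType.Exports only covers abstract numeric fields; this gives
   the concrete field R[i] the same instances, through the regular module. *)
#[warnings="-redundant-canonical-projection"]
HB.instance Definition _ (R : rcfType) := GRing.ComAlgebra.copy R[i] R[i]^o.
#[warnings="-redundant-canonical-projection"]
HB.instance Definition _ (R : rcfType) := Vector.copy R[i] R[i]^o.
#[warnings="-redundant-canonical-projection"]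
HB.instance Definition _ (R : rcfType) := NormedModule.copy R[i] R[i]^o.

Section definitions.
Context {R : realType}.
Local Notation C := R[i].
Implicit Types (V W E F X : normedModType C).

(* Norms in a normedModType C are elements of C lying on the real axis. *)
Definition rnorm V (v : V) : R := complex.Re `|v|.

Section dimension.
Context {V : lmodType C}.
Implicit Type S : set V.

Definition span_of n (v : 'I_n -> V) : set V :=
  [set u | exists c : 'I_n -> C, u = \sum_i c i *: v i].

Definition independent n (v : 'I_n -> V) :=
  forall c : 'I_n -> C, \sum_i c i *: v i = 0 -> forall i, c i = 0.

Definition has_dim S n :=
  exists v : 'I_n -> V, independent v /\ S = span_of v.

Definition finite_dim S := exists n, has_dim S n.

(* For a subspace S: the quotient V / S is spanned by finitely many classes. *)
Definition finite_codim S :=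
  exists n (v : 'I_n -> V), forall x, exists2 u, span_of v u & S (x - u).

End dimension.

(* Norm of f : D -> W, where D is a subspace of V normed by N. *)
Definition opnorm_on V W (D : set V) (N : V -> R) (f : V -> W) : \bar R :=
  ereal_sup [set (rnorm (f x))%:E | x in [set x | D x /\ N x <= 1]].

Definition opnorm V W (f : V -> W) : \bar R := opnorm_on setT (@rnorm V) f.

Definition bounded_op V W (f : V -> W) := (opnorm f < +oo)%E.

Definition bounded_rank V W (n : nat) (f : {linear V -> W}) :=
  bounded_op f /\ has_dim (range f) n.

Definition bounded_finite_rank V W (f : {linear V -> W}) :=
  bounded_op f /\ finite_dim (range f).

Definition continuous_embedding V W (f : {linear V -> W}) :=
  injective f /\ bounded_op f.

(* Linear operators with a domain; the values of op_fun outside of op_dom are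
   irrelevant. *)
Record operator (V W : lmodType C) := Operator {
  op_dom : set V;
  op_fun :> V -> W;
  op_dom0 : op_dom 0;
  op_domP : forall a x y, op_dom x -> op_dom y -> op_dom (a *: x + y);
  op_linear : forall a x y, op_dom x -> op_dom y ->
    op_fun (a *: x + y) = a *: op_fun x + op_fun y }.

Definition graph (V W : lmodType C) (T : operator V W) : set (V * W) :=
  [set p | op_dom T p.1 /\ p.2 = T p.1].

Definition closed_operator V W (T : operator V W) := closed (graph T).

Section operations.
Context {V W : lmodType C}.

Program Definition op_of_linear (f : {linear V -> W}) : operator V W :=
  @Operator _ _ setT f _ _ _.
Next Obligation. by []. Qed.
Next Obligation. by []. Qed.
Next Obligation. by move=> f a x y _ _; rewrite linearP. Qed.

Program Definition op_add (S T : operator V W) : operator V W :=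
  @Operator _ _ (op_dom S `&` op_dom T) (fun x => S x + T x) _ _ _.
Next Obligation. by move=> S T; split; exact: op_dom0. Qed.
Next Obligation.
by move=> S T a x y [? ?] [? ?]; split; exact: op_domP.
Qed.
Next Obligation.
move=> S T a x y [? ?] [? ?].
by rewrite !op_linear// scalerDr addrACA.
Qed.

Program Definition op_scale (c : C) (T : operator V W) : operator V W :=
  @Operator _ _ (op_dom T) (fun x => c *: T x) _ _ _.
Next Obligation. by move=> c T; exact: op_dom0. Qed.
Next Obligation. by move=> c T; exact: op_domP. Qed.
Next Obligation.
move=> c T a x y ? ?.
by rewrite /= op_linear// scalerDr !scalerA mulrC.
Qed.

End operations.

(* i \o B \o j with its natural domain. *)
Program Definition op_sandwich (V W V' W' : lmodType C) (i : {linear W -> W'})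
    (B : operator V W) (j : {linear V' -> V}) : operator V' W' :=
  @Operator _ _ (j @^-1` op_dom B) (fun x => i (B (j x))) _ _ _.
Next Obligation. by move=> *; rewrite /= linear0; exact: op_dom0. Qed.
Next Obligation. by move=> *; rewrite /= linearP; exact: op_domP. Qed.
Next Obligation. by move=> * /=; rewrite linearP op_linear// linearP. Qed.

Section spectrum.
Context {X : normedModType C}.
Implicit Type T : operator X X.

Definition resolvent_set T : set C :=
  [set z | exists S : {linear X -> X}, [/\ bounded_op S,
     forall y, op_dom T (S y) /\ T (S y) - z *: S y = y &
     forall x, op_dom T x -> S (T x - z *: x) = x]].

Definition spectrum T : set C := ~` resolvent_set T.

(* (T - z)^-1, meaningful for z in resolvent_set T. *)
Definition resolvent T (z : C) (y : X) : X :=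
  xget 0 [set x | op_dom T x /\ T x - z *: x = y].

Definition point_spectrum T : set C :=
  [set z | exists x, [/\ op_dom T x, x != 0 & T x = z *: x]].

Definition ker_shift T (z : C) : set X :=
  [set x | op_dom T x /\ T x - z *: x = 0].

Definition range_shift T (z : C) : set X :=
  [set T x - z *: x | x in op_dom T].

Definition fredholm_shift T (z : C) :=
  [/\ closed (range_shift T z), finite_dim (ker_shift T z) &
      finite_codim (range_shift T z)].

Definition discrete_spectrum T : set C :=
  [set z | isolated (spectrum T) z /\ fredholm_shift T z].

Definition essential_spectrum T : set C :=
  spectrum T `\` discrete_spectrum T.

Definition essential_spectrum1 T : set C :=
  [set z | spectrum T z /\
    (~ closed (range_shift T z) \/
     (~ finite_dim (ker_shift T z) /\ ~ finite_codim (range_shift T z)))].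

End spectrum.

Definition boundary (U : set C) : set C := closure U `\` interior U.

Record predual F := Predual {
  predual_space :> completeNormedModType C;
  predual_ev : F -> {linear predual_space -> C};
  predual_evP : forall a x y g,
    predual_ev (a *: x + y) g = a * predual_ev x g + predual_ev y g;
  predual_isometry : forall y, opnorm (predual_ev y) = (rnorm y)%:E;
  predual_onto : forall f : {linear predual_space -> C},
    bounded_op f -> exists y, predual_ev y = f :> (_ -> _) }.

Definition dual F := {f : {linear F -> C} | bounded_op f}.

(* F with its weak topology, and with the weak* topology given by a pre-dual:
   the initial topologies of the evaluations. *)
Definition weak F :=
  initial_topology ((fun y f => sval f y) : F -> {ptws dual F -> C}).

Definition weakstar F (P : predual F) :=
  initial_topology ((fun y g => predual_ev P y g) : F -> {ptws P -> C}).

#[warnings="-redundant-canonical-projection"]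
HB.instance Definition _ F := Topological.on (weak F).
#[warnings="-redundant-canonical-projection"]
HB.instance Definition _ F (P : predual F) := Topological.on (weakstar P).

Definition weak_cvg F (G : set_system C) (f : C -> weak F) (l : weak F) :=
  f @ G --> l.

Definition weakstar_cvg F (P : predual F) (G : set_system C)
    (f : C -> weakstar P) (l : weakstar P) :=
  f @ G --> l.

(* P = None stands for "F has no pre-dual, or weak* convergence is not
   considered"; a weak limit is in any case allowed. *)
Definition has_operator_limit E F (P : option (predual F))
    (G : set_system C) (S : C -> E -> F) :=
  exists L : {linear E -> F}, bounded_op L /\
    ((forall e, weak_cvg G (S^~ e) (L e)) \/
     (if P is Some p then forall e, weakstar_cvg (P := p) G (S^~ e) (L e)
      else False)).

Definition weakstar_closed_graph F (P : predual F) (T : operator F F) :=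
  closed (graph T : set (weakstar P * weakstar P)%type).

(* The graph of j A j^-1, an operator with domain j (dom A). *)
Definition extended_graph X F (j : {linear X -> F}) (A : operator X X) :
    set (F * F) :=
  [set (j x, j (A x)) | x in op_dom A].

(* j A j^-1 is closable, with closure Ahat. *)
Definition extension_assumption X F (j : {linear X -> F}) (A : operator X X)
    (P : option (predual F)) (Ahat : operator F F) :=
  graph Ahat = closure (extended_graph j A) /\
  (if P is Some p then weakstar_closed_graph p Ahat else True).

Section relative.
Context {F E : normedModType C} (Ahat : operator F F).
Implicit Type B : operator F E.

Definition graph_norm (x : F) : R := rnorm x + rnorm (Ahat x).

Definition relative_norm B : \bar R := opnorm_on (op_dom Ahat) graph_norm B.

Definition relatively_bounded B :=
  op_dom Ahat `<=` op_dom B /\ (relative_norm B < +oo)%E.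

Definition relatively_compact B :=
  op_dom Ahat `<=` op_dom B /\
  precompact [set B x | x in [set x | op_dom Ahat x /\ graph_norm x <= 1]].

End relative.

Section virtual_levels.
Context {E X F : normedModType C}.
Variables (i : {linear E -> X}) (j : {linear X -> F}).
Variables (P : option (predual F)) (A : operator X X) (Omega : set C) (z0 : C).

Definition regularizable (r : nat) :=
  exists B : {linear F -> E}, bounded_rank r B /\
    let AB := op_add A (op_sandwich i (op_of_linear B) j) in
    exists2 delta : R, 0 < delta &
      Omega `&` spectrum AB `&` ball z0 delta%:C = set0 /\
      has_operator_limit P (within (Omega `&` ball z0 delta%:C) (nbhs z0))
        (fun z e => j (resolvent AB z (i e))).

Definition virtual_rank (r : nat) :=
  [/\ essential_spectrum A z0, boundary Omega z0, regularizable r &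
      forall k, (k < r)%N -> ~ regularizable k].

Definition virtual_level := exists2 r, (1 <= r)%N & virtual_rank r.

End virtual_levels.

End definitions.

(* Main.v *)
Require Import Defs.
From HB Require Import structures.
From mathcomp Require Import all_boot all_order all_algebra.
From mathcomp Require Import all_classical all_reals all_analysis.
From mathcomp Require Import complex ring lra.
Set Implicit Arguments.
Unset Strict Implicit.
Unset Printing Implicit Defensive.
Import Order.TTheory GRing.Theory Num.Theory.
Import numFieldNormedType.Exports.
Local Open Scope classical_set_scope.
Local Open Scope ring_scope.
Local Open Scope complex_scope.

(** Write [i : E -> X], [j : X -> F], and [A + B] for [A + i B j].

    Large norms.  Suppose that [j (A - z)^-1 i] stays bounded along [z = z_n].  Then
    so does its graph norm, since [Ahat j (A - z)^-1 i = j i + z j (A - z)^-1 i],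
    and [B_n j (A - z)^-1 i] tends to 0 as an operator in [E].  Hence
    [1 + B_n j (A - z)^-1 i] is invertible in [E], and an algebraic identity
    makes [A + B_n - z] invertible in [X] ([small_sandwich], [blow_up]).

    Creation of eigenvalues.  Let [B] be the operator of rank [r >= 1] that makes
    the resolvent of [A + B] converge.  On the range of [B], [A - z] is governed by
    the [r x r] matrix [1 - N z], where [N z = B j (A + B - z)^-1 i]: it is
    invertible for [z] in Omega, and if its limit at [z0] were invertible, then the
    resolvent of [A] would converge too, contradicting the minimality of the rank.
    So the determinant of [1 - N z] tends to 0 ([det_virtual_cvg0]).  Therefore
    [N z] has an eigenvalue [mu] tending to 1, and [A + zeta B - z], governed by
    [1 + (zeta - 1) N z], is singular for [zeta = 1 - mu^-1], which tends to 0
    ([singular_scaling], [created_eigenvalues]).  The same [B] serves for all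
    sequences.

    That [N z] converges is clear for the weak topology.  For the weak-star
    topology the functionals that define [B] need not be continuous, but the
    weak-star closed graph of [Ahat] determines the limit: it meets the
    finite-dimensional space [0 * j i (range B)] only in the origin, and a
    compactness argument turns this into convergence of the components
    ([weakstar_component_cvg0]).

    Discreteness.  The point [z_n] is in the resolvent set of [A], so that
    [A + zeta B - z_n] is Fredholm.  It remains to see that [z_n] is isolated in
    the spectrum of [A + zeta B].  Call [z] of index zero when [A - z] becomes
    invertible after a finite-rank perturbation.  This is an open condition, and a
    limit of such points outside [essential_spectrum1] is again of index zero
    ([index_zero_closure]): rank-one perturbations make [A - z] injective or onto,
    and the open mapping theorem bounds the inverses of nearby shifts.  So the
    whole component [U] that contains Omega is of index zero, for [A] and then for
    [A + zeta B].  Near a point of index zero, invertibility is decided by an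
    analytic determinant, which either vanishes identically or has isolated zeros
    ([index_zero_dichotomy]); by connectedness the second case prevails on all of
    [U] as soon as [A + zeta B - w] is invertible for one [w] in [U], which is the
    case for small [zeta] ([isolated_singularities], [perturbed_discrete]). *)

(** * Real-valued norms and convergence *)

Section Norms.
Context {R : realType}.
Local Notation C := R[i].
Implicit Types (V W : normedModType C).

Lemma rnormE V (v : V) : `|v| = (rnorm v)%:C.
Proof.
rewrite /rnorm; have := normr_ge0 v; case: (`|v|) => a b /=.
by rewrite lecE /= => /andP[/eqP -> _].
Qed.

Lemma rnorm_ge0 V (v : V) : 0 <= rnorm v.
Proof. by have := normr_ge0 v; rewrite rnormE lecR. Qed.

Lemma rnorm0 V : rnorm (0 : V) = 0.
Proof. by rewrite /rnorm normr0. Qed.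

Lemma rnorm_eq0 V (v : V) : (rnorm v == 0) = (v == 0).
Proof. by rewrite -[v == 0]normr_eq0 rnormE -[0 in RHS]/(0%:C) (inj_eq (@complexI R)). Qed.

Lemma rnorm_gt0 V (v : V) : (0 < rnorm v) = (v != 0).
Proof. by rewrite lt_def rnorm_ge0 andbT rnorm_eq0. Qed.

Lemma rnormN V (v : V) : rnorm (- v) = rnorm v.
Proof. by rewrite /rnorm normrN. Qed.

Lemma rnormBC V (v w : V) : rnorm (v - w) = rnorm (w - v).
Proof. by rewrite -rnormN opprB. Qed.

Lemma ler_rnormD V (v w : V) : rnorm (v + w) <= rnorm v + rnorm w.
Proof. by have := ler_normD v w; rewrite !rnormE -rmorphD lecR. Qed.

Lemma ler_rnormB V (v w : V) : rnorm (v - w) <= rnorm v + rnorm w.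
Proof. by rewrite -(rnormN w) ler_rnormD. Qed.

Lemma ler_rnorm_sum V n (f : 'I_n -> V) :
  rnorm (\sum_l f l) <= \sum_l rnorm (f l).
Proof.
elim/big_ind2: _ => //; first by rewrite rnorm0.
by move=> v a w b va wb; apply: (le_trans (ler_rnormD _ _)); exact: lerD.
Qed.

Lemma rnormZ V (a : C) (v : V) : rnorm (a *: v) = rnorm a * rnorm v.
Proof.
have : `|a *: v| = `|a : C^o| * `|v| by rewrite normrZ.
by rewrite !rnormE -rmorphM => /complexI.
Qed.

Lemma rnormM (a b : C) : rnorm (a * b) = rnorm a * rnorm b.
Proof. exact: (rnormZ a (b : C^o)). Qed.

Lemma rnormX (a : C) n : rnorm (a ^+ n) = rnorm a ^+ n.
Proof.
elim: n => [|n IH]; last by rewrite !exprS rnormM IH.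
by rewrite !expr0 /rnorm normr1.
Qed.

Lemma rnormV (a : C) : rnorm a^-1 = (rnorm a)^-1.
Proof.
have : `|a^-1 : C^o| = `|a : C^o|^-1 by rewrite normfV.
by rewrite !rnormE -fmorphV => /complexI.
Qed.

Lemma rnorm1 : rnorm (1 : C) = 1. Proof. by rewrite /rnorm normr1. Qed.

Lemma rnormR (t : R) : rnorm (t%:C) = `|t|.
Proof. by rewrite /rnorm normc_def /= expr0n addr0 sqrtr_sqr. Qed.

Lemma rnormi : rnorm ('i : C) = 1.
Proof. by rewrite /rnorm normc_def /= expr0n expr1n add0r sqrtr1. Qed.

Lemma ltcR_ball V (x y : V) (e : R) : ball x e%:C y <-> rnorm (x - y) < e.
Proof. by rewrite -ball_normE /ball_ /= rnormE ltcR. Qed.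

Lemma posC (e : C) : 0 < e -> exists2 t : R, 0 < t & e = t%:C.
Proof.
case: e => a b; rewrite ltcE /= => /andP[/eqP b0 a0].
by exists a => //; rewrite b0.
Qed.

Lemma rcvgP V (T : Type) (G : set_system T) {FG : Filter G} (f : T -> V) l :
  f @ G --> l <-> forall e : R, 0 < e -> \forall t \near G, rnorm (l - f t) < e.
Proof.
rewrite cvgrPdist_lt; split=> cvf e e0.
  have := cvf e%:C; rewrite ltcR => /(_ e0).
  by apply: filterS => t; rewrite rnormE ltcR.
have [t t0 ->] := posC e0.
by apply: filterS (cvf t t0) => x; rewrite rnormE ltcR.
Qed.

Lemma rnbhsP V (x : V) (A : set V) :
  nbhs x A <-> exists2 e : R, 0 < e & forall y, rnorm (x - y) < e -> A y.
Proof.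
split=> [/nbhs_ballP[e /= e0 eA]|[e e0 eA]].
  have [t t0 et] := posC e0; exists t => // y xy.
  by apply: eA; rewrite et; apply/ltcR_ball.
apply/nbhs_ballP; exists e%:C => /=; first by rewrite ltcR.
by move=> y /ltcR_ball; exact: eA.
Qed.

Lemma rclosureP V (A : set V) (x : V) :
  closure A x <-> forall e : R, 0 < e -> exists2 y, A y & rnorm (x - y) < e.
Proof.
split=> [clA e e0|H U /rnbhsP[e e0 eU]].
  have [|y [Ay]] := clA (ball x e%:C); first by apply: nbhsx_ballx; rewrite ltcR.
  by move=> /ltcR_ball xy; exists y.
by have [y Ay xy] := H e e0; exists y; split => //; exact: eU.
Qed.

Lemma rclosedP V (A : set V) :
  closed A <-> forall x, (forall e : R, 0 < e -> exists2 y, A y & rnorm (x - y) < e) -> A x.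
Proof.
by split=> clA x; [move=> /rclosureP; exact: clA|move=> /rclosureP; exact: clA].
Qed.

Lemma rcvg_unique V (T : Type) (G : set_system T) {FG : ProperFilter G}
    (f : T -> V) (x y : V) : f @ G --> x -> f @ G --> y -> x = y.
Proof. exact: norm_cvg_unique. Qed.

Lemma cvg_half_pow (M : R) : (fun n => M * 2^-1 ^+ n) @ \oo --> (0 : R).
Proof.
rewrite -[X in _ --> X](mulr0 M); apply: cvgMr; apply: cvg_expr.
by rewrite ger0_norm ?invr_ge0// invf_lt1// ltr1n.
Qed.

(** Every use of the completeness of a Banach space goes through this lemma. *)
Lemma geometric_cvg (U : completeNormedModType C) (u : nat -> U) (M : R) :
  (forall n, rnorm (u n.+1 - u n) <= M * 2^-1 ^+ n) ->
  exists l, u @ \oo --> l /\ forall n, rnorm (l - u n) <= 2 * M * 2^-1 ^+ n.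
Proof.
move=> Hu.
have M0 : 0 <= M.
  by have := Hu 0%N; rewrite expr0 mulr1; apply: le_trans; exact: rnorm_ge0.
have pow_gt0 n : 0 < 2^-1 ^+ n :> R by rewrite exprn_gt0// invr_gt0.
have step m n : rnorm (u (n + m)%N - u n) <= 2 * M * 2^-1 ^+ n - 2 * M * 2^-1 ^+ (n + m).
  elim: m => [|m IH]; first by rewrite addn0 !subrr rnorm0.
  rewrite addnS -(subrKA (u (n + m)%N)).
  apply: (le_trans (ler_rnormD _ _)).
  have := Hu (n + m)%N; rewrite (exprS _ (n + m)); move: IH.
  set a := rnorm _; set b := rnorm _; set p := _ ^+ n; set q := _ ^+ _.
  by clearbody a b p q; lra.
have step' m n : (n <= m)%N -> rnorm (u m - u n) <= 2 * M * 2^-1 ^+ n.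
  move=> nm; rewrite -(subnKC nm); apply: (le_trans (step _ _)).
  by rewrite gerBl// !mulr_ge0// ltW.
have small (e : R) : 0 < e -> exists N, 2 * M * 2^-1 ^+ N < e.
  move=> e0.
  have /cvgrPdist_lt/(_ e e0)[N _ /(_ N (leqnn N))] := cvg_half_pow (2 * M).
  rewrite /= sub0r normrN ger0_norm//.
    by exists N.
  by rewrite !mulr_ge0// ltW.
have cu : cvg (u @ \oo).
  apply/cauchy_cvgP/cauchy_ballP => _ /posC[e e0 ->]; near_simpl.
  have [N HN] : exists N, 2 * M * 2^-1 ^+ N < e / 2 by apply: small; rewrite divr_gt0.
  exists ([set n | (N <= n)%N], [set n | (N <= n)%N]) => /=.
    by split; exists N.
  move=> [a b] /= [Na Nb]; apply/ltcR_ball.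
  rewrite -(subrKA (u N)); apply: (le_lt_trans (ler_rnormD _ _)).
  have := step' _ _ Na; have := step' _ _ Nb; rewrite (rnormBC (u b)).
  by move: HN; lra.
exists (lim (u @ \oo)); split => // n.
apply/ler_addgt0Pr => e e0.
have [N _ /(_ (maxn N n) (leq_maxl _ _)) /= h] := (rcvgP _ _).1 cu e e0.
rewrite -(subrKA (u (maxn N n))) addrC.
apply: (le_trans (ler_rnormD _ _)); apply: lerD (ltW h).
exact/step'/leq_maxr.
Qed.

Lemma bounded_opP V W (f : {linear V -> W}) :
  bounded_op f <-> exists2 M : R, 0 <= M & forall x, rnorm (f x) <= M * rnorm x.
Proof.
split=> [bf|[M M0 fM]]; last first.
  rewrite /bounded_op; apply: (@le_lt_trans _ _ (M%:E)); last exact: ltry.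
  apply: ge_ereal_sup => _ [x [_ x1] <-]; rewrite lee_fin.
  by apply: (le_trans (fM x)); rewrite ler_piMr.
pose M := fine (opnorm f).
have le_opnorm x : rnorm x <= 1 -> ((rnorm (f x))%:E <= opnorm f)%E.
  by move=> x1; apply: ereal_sup_ubound; exists x.
have fin : opnorm f \is a fin_num.
  rewrite fin_numE; apply/andP; split; last by rewrite -ltey.
  rewrite -ltNye; apply: (lt_le_trans _ (le_opnorm 0 _)); rewrite ?ltNyr//.
  by rewrite rnorm0.
have fM x : rnorm x <= 1 -> rnorm (f x) <= M.
  by move=> /le_opnorm; rewrite -lee_fin fineK.
exists M; first by have := fM 0; rewrite linear0 !rnorm0; apply.
move=> x; have [->|x0] := eqVneq x 0; first by rewrite linear0 !rnorm0 mulr0.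
have nx : 0 < rnorm x by rewrite rnorm_gt0.
have := fM ((rnorm x)^-1%:C *: x).
rewrite linearZ /= !rnormZ rnormR ger0_norm ?invr_ge0 ?rnorm_ge0//.
rewrite mulVf ?gt_eqF// => /(_ (lexx _)).
by rewrite mulrC ler_pdivrMr.
Qed.

Lemma bounded_cst_gt0 V W (f : {linear V -> W}) :
  bounded_op f -> exists2 M : R, 0 < M & forall x, rnorm (f x) <= M * rnorm x.
Proof.
move=> /bounded_opP[M M0 fM]; exists (M + 1); first by rewrite ltr_wpDl.
move=> x; apply: (le_trans (fM x)); rewrite ler_wpM2r ?rnorm_ge0// lerDl//.
Qed.

Lemma bounded_cvg V W (f : {linear V -> W}) (T : Type) (G : set_system T)
    {FG : Filter G} (u : T -> V) l :
  bounded_op f -> u @ G --> l -> f \o u @ G --> f l.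
Proof.
move=> /bounded_cst_gt0[M M0 fM] ul; apply/rcvgP => e e0.
have /rcvgP/(_ (e / M) (divr_gt0 e0 M0)) := ul.
apply: filterS => t; rewrite ltr_pdivlMr// => h /=.
by rewrite -linearB; apply: (le_lt_trans (fM _)); rewrite mulrC.
Qed.

Lemma bounded_comp V W (U : normedModType C) (f : {linear V -> W})
    (g : {linear W -> U}) :
  bounded_op f -> bounded_op g -> bounded_op (g \o f).
Proof.
move=> /bounded_opP[M M0 fM] /bounded_opP[N N0 gN]; apply/bounded_opP.
exists (N * M); first exact: mulr_ge0.
by move=> x /=; apply: (le_trans (gN _)); rewrite -mulrA ler_wpM2l.
Qed.

(** Meant for functions that come out of a choice, or are given by a formula
    whose linearity is not found by inference. *)
Lemma linear_of (V W : lmodType C) (f : V -> W) :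
  (forall a x y, f (a *: x + y) = a *: f x + f y) ->
  exists g : {linear V -> W}, forall x, g x = f x.
Proof.
move=> lf.
pose m := GRing.isLinear.Build C V W *:%R f lf.
pose g : {linear V -> W} := HB.pack f m.
by exists g.
Qed.

End Norms.

(** * The Hahn-Banach theorem *)

Section HahnBanach.
Context {R : realType}.
Local Notation C := R[i].

Section functional.
Context {V : lmodType C} (psi : {linear V -> C}).

Lemma functionalD x y : psi (x + y) = psi x + psi y :> C.
Proof. exact: linearD. Qed.

Lemma functionalB x y : psi (x - y) = psi x - psi y :> C.
Proof. exact: linearB. Qed.

Lemma functionalZ (a : C) x : psi (a *: x) = a * psi x :> C.
Proof. exact: linearZ. Qed.

Lemma functional_sum n (c : 'I_n -> C) (v : 'I_n -> V) :
  psi (\sum_l c l *: v l) = \sum_l c l * psi (v l) :> C.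
Proof. by rewrite linear_sum; apply: eq_bigr => l _; exact: functionalZ. Qed.

End functional.

Section sublinear.
Context {V : lmodType C}.
Implicit Types (p q : V -> R) (x y : V).

(** Only real multiples matter here; the inequality for all [t >= 0] forces
    equality, see [sublinearZ]. *)
Definition sublinear p :=
  (forall x y, p (x + y) <= p x + p y) /\
  (forall (t : R) x, 0 <= t -> p (t%:C *: x) <= t * p x).

Lemma sublinear0 p : sublinear p -> p 0 = 0.
Proof.
move=> [pD pZ]; apply/le_anti/andP; split.
  by have := pZ 0 0 (lexx _); rewrite scale0r mul0r.
by have := pD 0 0; rewrite addr0; lra.
Qed.

Lemma sublinearZ p (t : R) x : sublinear p -> 0 <= t ->
  p (t%:C *: x) = t * p x.
Proof.
move=> sp; rewrite le_eqVlt => /predU1P[<-|t0].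
  by rewrite scale0r mul0r sublinear0.
apply/le_anti/andP; split; first by apply: sp.2; exact: ltW.
have := sp.2 t^-1 (t%:C *: x); rewrite invr_ge0 ltW// scalerA -rmorphM.
rewrite mulVf ?gt_eqF// scale1r => /(_ isT) h.
by rewrite -ler_pdivlMl.
Qed.

Lemma sublinear_geN p x : sublinear p -> - p (- x) <= p x.
Proof.
by move=> sp; have := sp.1 x (- x); rewrite subrr sublinear0//; lra.
Qed.

Lemma inf_le (S : set R) (b s : R) : (forall t, S t -> b <= t) -> S s -> inf S <= s.
Proof. by move=> lb Ss; apply: ge_inf => //; exists b => t /lb. Qed.

(** The largest sublinear functional below [p] whose value at [- x0] is at most
    [- p x0]. *)
Definition steepest p x0 x :=
  inf [set p (x + t%:C *: x0) - t * p x0 | t in [set t : R | 0 <= t]].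

Section steepest_lemmas.
Variables (p : V -> R) (x0 : V).
Hypothesis sp : sublinear p.

Lemma steepest_lb x s :
  [set p (x + t%:C *: x0) - t * p x0 | t in [set t : R | 0 <= t]] s ->
  - p (- x) <= s.
Proof.
move=> [t /= t0 <-]; rewrite -(sublinearZ _ sp t0).
have := sp.1 (x + t%:C *: x0) (- x).
by rewrite addrAC subrr add0r; lra.
Qed.

Lemma steepest_le x (t : R) : 0 <= t -> steepest p x0 x <= p (x + t%:C *: x0) - t * p x0.
Proof. by move=> t0; apply: inf_le (@steepest_lb x) _; exists t. Qed.

Lemma steepest_glb x b :
  (forall t : R, 0 <= t -> b <= p (x + t%:C *: x0) - t * p x0) ->
  b <= steepest p x0 x.
Proof.
move=> h; apply: lb_le_inf; last by move=> _ [t /= t0 <-]; exact: h.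
by exists (p (x + 0%:C *: x0) - 0 * p x0), 0 => /=.
Qed.

Lemma sublinear_steepest : sublinear (steepest p x0).
Proof.
split=> [x y|t x t0].
  rewrite -lerBlDr; apply: steepest_glb => t t0.
  rewrite lerBlDr -lerBlDl; apply: steepest_glb => s s0; rewrite lerBlDl.
  apply: (le_trans (steepest_le _ (addr_ge0 t0 s0))).
  have := sp.1 (x + t%:C *: x0) (y + s%:C *: x0).
  by rewrite rmorphD scalerDl addrACA mulrDl; lra.
have [->|tn0] := eqVneq t 0.
  rewrite scale0r mul0r; apply: (le_trans (steepest_le _ (lexx 0))).
  by rewrite scale0r addr0 sublinear0// mul0r subrr.
have tp : 0 < t by rewrite lt_def tn0.
rewrite -ler_pdivrMl//; apply: steepest_glb => s s0; rewrite ler_pdivrMl//.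
apply: (le_trans (steepest_le _ (mulr_ge0 t0 s0))).
by rewrite rmorphM -scalerA -scalerDr sublinearZ// mulrBr mulrA.
Qed.

Lemma steepest_le_self x : steepest p x0 x <= p x.
Proof.
by apply: (le_trans (steepest_le _ (lexx 0))); rewrite scale0r addr0 mul0r subr0.
Qed.

Lemma steepest_le1 x : steepest p x0 x <= p (x + x0) - p x0.
Proof.
by apply: (le_trans (steepest_le _ ler01)); rewrite scale1r mul1r.
Qed.

End steepest_lemmas.

Lemma minimal_sublinear p : sublinear p ->
  exists q, [/\ sublinear q, forall x, q x <= p x &
    forall s, sublinear s -> (forall x, s x <= q x) -> s = q].
Proof.
move=> sp; pose T := {q : V -> R | sublinear q /\ forall x, q x <= p x}.
pose le (a b : T) := `[< forall x, sval b x <= sval a x >].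
have [| | |A totA|m minm] := @Zorn T le.
- by move=> a; apply/asboolP => x.
- move=> a b c /asboolP ab /asboolP bc; apply/asboolP => x.
  exact: le_trans (bc x) (ab x).
- move=> [a Pa] [b Pb] /asboolP ab /asboolP ba; apply/eq_exist/funext => x.
  by apply/le_anti; rewrite ab ba.
- have [[a0 Aa0]|A0] := pselect (exists a, A a); last first.
    exists (exist _ p (conj sp (fun x => lexx _))) => s As.
    by exfalso; apply: A0; exists s.
  pose S x := [set sval a x | a in A].
  have lbS x s : S x s -> - p (- x) <= s.
    move=> [[a [sa ap]] Aa <-] /=.
    by apply: le_trans (sublinear_geN _ sa); rewrite lerN2.
  have le_inf x a : A a -> inf (S x) <= sval a x.
    by move=> Aa; apply: inf_le (@lbS x) _; exists a.
  have glb x b : (forall a, A a -> b <= sval a x) -> b <= inf (S x).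
    move=> h; apply: lb_le_inf; last by move=> _ [a Aa <-]; exact: h.
    by exists (sval a0 x), a0.
  have sI : sublinear (fun x => inf (S x)).
    split=> [x y|t x t0].
      rewrite -lerBlDr; apply/glb => a Aa.
      rewrite lerBlDr -lerBlDl; apply/glb => b Ab; rewrite lerBlDl.
      have [/asboolP ab|/asboolP ba] := totA a b Aa Ab.
        apply: (le_trans (le_inf _ b Ab)); apply: (le_trans ((svalP b).1.1 _ _)).
        by rewrite lerD2r.
      apply: (le_trans (le_inf _ a Aa)); apply: (le_trans ((svalP a).1.1 _ _)).
      by rewrite lerD2l.
    have [->|tn0] := eqVneq t 0.
      rewrite scale0r mul0r; apply: (le_trans (le_inf _ a0 Aa0)).
      by rewrite sublinear0//; exact: (svalP a0).1.
    have tp : 0 < t by rewrite lt_def tn0.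
    rewrite -ler_pdivrMl//; apply/glb => a Aa; rewrite ler_pdivrMl//.
    by apply: (le_trans (le_inf _ a Aa)); apply: (svalP a).1.2.
  have Ip x : inf (S x) <= p x.
    by apply: (le_trans (le_inf _ a0 Aa0)); exact: (svalP a0).2.
  have PI : sublinear (fun x => inf (S x)) /\ (forall x, inf (S x) <= p x) by [].
  exists (exist (fun q : V -> R => sublinear q /\ (forall x, q x <= p x)) _ PI) => s As; apply/asboolP => x /=.
  exact: le_inf.
exists (sval m); have [sm mp] := svalP m; split=> // s ss sm'.
have sp' x : s x <= p x by apply: le_trans (mp x).
have := minm (exist (fun q : V -> R => sublinear q /\ (forall x, q x <= p x)) s (conj ss sp')); move=> /(_ _)/(congr1 sval) /=; apply.
exact/asboolP.
Qed.

(** The Hahn-Banach theorem in the form: minimal sublinear functionals are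
    linear.  If [q] is minimal then [q] coincides with [steepest q y] for each
    [y], which is the missing inequality [q x + q y <= q (x + y)]. *)
Lemma hahn_banach p x0 : sublinear p ->
  exists f : V -> R, [/\ forall x y, f (x + y) = f x + f y,
    forall (t : R) x, f (t%:C *: x) = t * f x,
    forall x, f x <= p x & p x0 <= f x0].
Proof.
move=> sp; have [f [sf fp minf]] := minimal_sublinear (sublinear_steepest x0 sp).
have fD x y : f (x + y) = f x + f y.
  apply/le_anti; rewrite sf.1 /=.
  have := minf _ (sublinear_steepest y sf) (steepest_le_self _ sf).
  by move=> /(congr1 (@^~ x)) /= fx; have := steepest_le1 y sf x; rewrite fx; lra.
have fN x : f (- x) = - f x.
  by have := fD x (- x); rewrite subrr sublinear0//; lra.
exists f; split=> //.
- move=> t x; have [t0|t0] := leP 0 t; first exact: sublinearZ.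
  rewrite -[t]opprK rmorphN scaleNr fN sublinearZ ?mulNr// oppr_ge0; exact: ltW.
- by move=> x; apply: le_trans (fp x) (steepest_le_self _ sp _).
- have := fp (- x0); have := steepest_le1 x0 sp (- x0).
  by rewrite addNr sublinear0// fN; lra.
Qed.

End sublinear.

Section separation.
Context {V : normedModType C}.

Definition is_subspace (Y : set V) :=
  Y 0 /\ forall a x y, Y x -> Y y -> Y (a *: x + y).

Lemma is_subspaceZ Y a x : is_subspace Y -> Y x -> Y (a *: x).
Proof. by move=> [Y0 YP] Yx; rewrite -[_ *: _]addr0; exact: YP. Qed.

Lemma is_subspaceD Y x y : is_subspace Y -> Y x -> Y y -> Y (x + y).
Proof. by move=> [Y0 YP] Yx Yy; rewrite -[x]scale1r; exact: YP. Qed.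

Lemma is_subspaceN Y x : is_subspace Y -> Y x -> Y (- x).
Proof. by move=> sY Yx; rewrite -scaleN1r; exact: is_subspaceZ. Qed.

Lemma is_subspaceB Y x y : is_subspace Y -> Y x -> Y y -> Y (x - y).
Proof. by move=> sY Yx Yy; apply: is_subspaceD => //; exact: is_subspaceN. Qed.

(** The real functional of the Hahn-Banach theorem, taken below the distance
    to [Y], is the real part of a complex functional. *)
Lemma separating_functional (Y : set V) (m : V) :
  is_subspace Y -> closed Y -> ~ Y m ->
  exists psi : {linear V -> C}, [/\ bounded_op psi,
    forall y, Y y -> psi y = 0 & psi m = 1].
Proof.
move=> sY clY Ym; have [Y0 YP] := sY.
pose S x := [set rnorm (x - y) | y in Y].
pose d x := inf (S x).
have lbS x s : S x s -> 0 <= s by move=> [y _ <-]; exact: rnorm_ge0.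
have d_le x y : Y y -> d x <= rnorm (x - y).
  by move=> Yy; apply: inf_le (lbS x) _; exists y.
have d_glb x b : (forall y, Y y -> b <= rnorm (x - y)) -> b <= d x.
  move=> h; apply: lb_le_inf; last by move=> _ [y Yy <-]; exact: h.
  by exists (rnorm (x - 0)), 0.
have sd : sublinear d.
  split=> [x y|t x t0].
    rewrite -lerBlDr; apply/d_glb => u Yu.
    rewrite lerBlDr -lerBlDl; apply/d_glb => v Yv; rewrite lerBlDl.
    apply: (le_trans (d_le _ (u + v) _)); first exact: is_subspaceD.
    by rewrite opprD addrACA ler_rnormD.
  have [->|tn0] := eqVneq t 0.
    by rewrite scale0r mul0r (le_trans (d_le _ 0 Y0))// subrr rnorm0.
  have tp : 0 < t by rewrite lt_def tn0.
  rewrite -ler_pdivrMl//; apply/d_glb => y Yy; rewrite ler_pdivrMl//.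
  apply: (le_trans (d_le _ (t%:C *: y) _)); first exact: is_subspaceZ.
  by rewrite -scalerBr rnormZ rnormR ger0_norm.
have [f [fD fZ fd fm]] := hahn_banach m sd.
have f0 : f 0 = 0 by have := fD 0 0; rewrite addr0; lra.
have fN x : f (- x) = - f x by have := fD x (- x); rewrite subrr f0; lra.
have fle x : `|f x| <= rnorm x.
  rewrite ler_norml lerNl -fN !(le_trans (fd _))//.
    by rewrite (le_trans (d_le _ 0 Y0))// subr0.
  by rewrite (le_trans (d_le _ 0 Y0))// subr0 rnormN.
have fY y : Y y -> f y = 0.
  move=> Yy; apply/le_anti/andP; split.
    by rewrite (le_trans (fd _))// (le_trans (d_le _ y _))// subrr rnorm0.
  rewrite -lerN2 oppr0 -fN (le_trans (fd _))// (le_trans (d_le _ (- y) _))//.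
    exact: is_subspaceN.
  by rewrite subrr rnorm0.
have dm0 : 0 < d m.
  rewrite lt_def (d_glb _ 0) ?andbT => [|y _]; last exact: rnorm_ge0.
  apply/eqP => dm; apply: Ym; apply/(rclosedP _).1 => // e e0.
  have [|_ [y Yy <-]] := @inf_adherent R (S m) e e0.
    by split; [exists (rnorm (m - 0)), 0|exists 0 => s; exact: lbS].
  by rewrite -/(d m) dm add0r => h; exists y.
pose phi x : C := (f x +i* - f ('i *: x)).
have phi_lin a x y : phi (a *: x + y) = a *: phi x + phi y.
  case: a => a b; have -> : (a +i* b) = a%:C + b%:C * 'i.
    by apply/eqP; rewrite eq_complex /=; apply/andP; split; apply/eqP; ring.
  have ii : 'i * 'i = - 1 :> C by rewrite -expr2 sqr_i.
  have fE u : f ((a%:C + b%:C * 'i) *: u) = a * f u + b * f ('i *: u).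
    by rewrite scalerDl fD fZ -scalerA fZ.
  have -> : phi ((a%:C + b%:C * 'i) *: x + y) =
    (a * f x + b * f ('i *: x) + f y) +i*
    - (a * f ('i *: x) - b * f x + f ('i *: y)).
    rewrite /phi scalerDr !fD fE.
    have -> z : 'i *: (z *: x) = z *: ('i *: x) by rewrite !scalerA mulrC.
    by rewrite fE scalerA ii scaleN1r fN mulrN.
  apply/eqP; rewrite eq_complex /=; apply/andP; split; apply/eqP; ring.
have [g gphi] := linear_of phi_lin.
have gm : g m != 0.
  rewrite gphi; apply/eqP => /(congr1 (@complex.Re R)) /= fm0.
  by move: fm dm0; rewrite fm0; lra.
have phi'_lin a x y : (g m)^-1 * g (a *: x + y) = a *: ((g m)^-1 * g x) + (g m)^-1 * g y.
  by rewrite linearP mulrDr; congr (_ + _); exact: mulrCA.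
have [h hg] := linear_of phi'_lin.
exists h; split; last by rewrite hg mulVf.
  apply/bounded_opP; exists (rnorm (g m)^-1 * 2).
    by rewrite mulr_ge0// rnorm_ge0.
  move=> x; rewrite hg rnormM -mulrA ler_wpM2l ?rnorm_ge0// gphi /phi.
  have -> : f x +i* - f ('i *: x) = (f x)%:C - 'i * (f ('i *: x))%:C.
    by apply/eqP; rewrite eq_complex /=; apply/andP; split; apply/eqP; ring.
  rewrite (le_trans (ler_rnormB _ _))// rnormM rnormi mul1r !rnormR.
  rewrite mulr_natl mulr2n; apply: lerD; first exact: fle.
  by apply: (le_trans (fle _)); rewrite rnormZ rnormi mul1r.
move=> y Yy; have Yiy : Y ('i *: y) by exact: is_subspaceZ.
by rewrite hg (gphi y) /phi (fY y)// (fY _ Yiy) oppr0 -[_ +i* _]/(0 : C) mulr0.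
Qed.

Lemma norming_functional (u : V) : u != 0 ->
  exists2 psi : {linear V -> C}, bounded_op psi & psi u = 1.
Proof.
move=> /eqP u0.
have s0 : is_subspace [set (0 : V)] by split => // a x y -> ->; rewrite /= scaler0 addr0.
have c0 : closed [set (0 : V)].
  exact: accessible_closed_set1 (hausdorff_accessible (@norm_hausdorff _ V)) 0.
by have [psi [bpsi _ psiu]] := separating_functional s0 c0 u0; exists psi.
Qed.

(** Unless [m] is in [Y], there is a functional [psi] vanishing on [Y] and equal to
    [1] at [m]; the sum of [Y] and the line is then the preimage of [Y] under
    [x |-> x - psi x *: m]. *)
Lemma closed_add_line (Y : set V) (m : V) : is_subspace Y -> closed Y ->
  closed [set x | exists c : C, Y (x - c *: m)].
Proof.
move=> sY clY; have [Ym|Ym] := pselect (Y m).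
  suff -> : [set x | exists c : C, Y (x - c *: m)] = Y by [].
  apply/seteqP; split=> x /=; last by exists 0; rewrite scale0r subr0.
  by move=> [c Yc]; rewrite -[x](subrK (c *: m)); apply: is_subspaceD => //;
    exact: is_subspaceZ.
have [psi [/bounded_opP[M M0 psiM] psiY psim]] := separating_functional sY clY Ym.
apply/rclosedP => x clx; exists (psi x); apply/(rclosedP _).1 => // e e0.
have K0 : 0 < 1 + M * rnorm m by rewrite ltr_pwDl// mulr_ge0// rnorm_ge0.
have [y [c Yc] xy] := clx _ (divr_gt0 e0 K0).
have cE : psi y = c.
  by have /eqP := psiY _ Yc; rewrite functionalB functionalZ psim mulr1 subr_eq0 => /eqP.
exists (y - c *: m) => //.
have -> : x - psi x *: m - (y - c *: m) = (x - y) - psi (x - y) *: m.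
  by rewrite -cE functionalB scalerBl !opprD !opprK addrACA.
move: xy; rewrite ltr_pdivlMr// => xy.
apply: le_lt_trans xy; rewrite (le_trans (ler_rnormB _ _))// rnormZ mulrDr mulr1.
by rewrite lerD2l mulrA ler_wpM2r ?rnorm_ge0// mulrC.
Qed.

End separation.
End HahnBanach.

(** * Solving equations with closed operators *)

Section Solving.
Context {R : realType}.
Local Notation C := R[i].

Definition linear_on (V W : normedModType C) (D : set V) (f : V -> W) :=
  is_subspace D /\
  forall a x y, D x -> D y -> f (a *: x + y) = a *: f x + f y.

(** Closedness of the graph of [f] on [D], in the sequential form that limits of
    series and sums with bounded operators call for. *)
Definition closed_on (V W : normedModType C) (D : set V) (f : V -> W) :=
  forall (u : nat -> V) x y, (forall n, D (u n)) ->
    u @ \oo --> x -> f \o u @ \oo --> y -> D x /\ f x = y.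

Definition is_inverse (V W : normedModType C) (D : set V) (f : V -> W)
    (S : {linear W -> V}) :=
  (forall y, D (S y) /\ f (S y) = y) /\ (forall x, D x -> S (f x) = x).

Definition invertible_on (V W : normedModType C) (D : set V) (f : V -> W) :=
  exists2 S : {linear W -> V}, bounded_op S & is_inverse D f S.

Section linear_on_lemmas.
Context {V W : normedModType C} (D : set V) (f : V -> W).
Hypothesis lf : linear_on D f.

Lemma linear_on0 : f 0 = 0.
Proof.
by have := lf.2 (- 1) 0 0 lf.1.1 lf.1.1; rewrite scaler0 addr0 scaleN1r addNr.
Qed.

Lemma linear_onZ a x : D x -> f (a *: x) = a *: f x.
Proof.
by move=> Dx; rewrite -[a *: x]addr0 lf.2 ?linear_on0 ?addr0//; exact: lf.1.1.
Qed.

Lemma linear_onD x y : D x -> D y -> f (x + y) = f x + f y.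
Proof. by move=> Dx Dy; rewrite -[x]scale1r lf.2// !scale1r. Qed.

Lemma linear_onN x : D x -> f (- x) = - f x.
Proof. by move=> Dx; rewrite -scaleN1r linear_onZ// scaleN1r. Qed.

Lemma linear_onB x y : D x -> D y -> f (x - y) = f x - f y.
Proof.
by move=> Dx Dy; rewrite linear_onD ?linear_onN//; exact: is_subspaceN lf.1 Dy.
Qed.

Lemma is_subspace_image : is_subspace (f @` D).
Proof.
split; first by exists 0; [exact: lf.1.1|exact: linear_on0].
move=> a _ _ [x Dx <-] [y Dy <-]; exists (a *: x + y); last exact: lf.2.
exact: lf.1.2.
Qed.

Lemma is_inverse_inj S x : is_inverse D f S -> D x -> f x = 0 -> x = 0.
Proof. by move=> [_ SK] Dx fx0; rewrite -(SK x Dx) fx0 linear0. Qed.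

Lemma linear_on_add (K : {linear V -> W}) : linear_on D (fun x => f x + K x).
Proof.
split; first exact: lf.1.
by move=> a x y Dx Dy; rewrite lf.2// linearP scalerDr addrACA.
Qed.

Lemma invertible_of_bijective (M : R) :
  (forall y, exists x, [/\ D x, f x = y & rnorm x <= M * rnorm y]) ->
  (forall x, D x -> f x = 0 -> x = 0) ->
  exists2 S : {linear W -> V}, (forall y, rnorm (S y) <= M * rnorm y) &
    is_inverse D f S.
Proof.
move=> /choice[g gP] inj.
have uniq x y : D x -> f x = y -> g y = x.
  move=> Dx fx; have [Dg fg _] := gP y; apply/eqP; rewrite -subr_eq0; apply/eqP.
  by apply: inj; [exact: is_subspaceB lf.1 Dg Dx|rewrite linear_onB// fg fx subrr].
have g_lin a x y : g (a *: x + y) = a *: g x + g y.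
  have [Dx fx _] := gP x; have [Dy fy _] := gP y.
  by apply: uniq; [exact: lf.1.2|rewrite lf.2// fx fy].
have [S Sg] := linear_of g_lin; exists S.
  by move=> y; rewrite Sg; have [] := gP y.
split=> [y|x Dx]; first by rewrite Sg; have [] := gP y.
by rewrite Sg; exact: uniq.
Qed.

End linear_on_lemmas.

Lemma closed_on_add (V W : normedModType C) (D : set V) (f : V -> W)
    (K : {linear V -> W}) :
  closed_on D f -> bounded_op K -> closed_on D (fun x => f x + K x).
Proof.
move=> cf bK u x y Du ux fy; 
have Kux : K \o u @ \oo --> K x by exact: bounded_cvg bK ux.
have : f \o u @ \oo --> y - K x.
  have -> : f \o u = ((fun x => f x + K x) \o u) - (K \o u).
    by apply/funext => n /=; rewrite !fctE /= addrK.
  exact: cvgB fy Kux.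
by move=> /(cf _ _ _ Du ux)[Dx ->]; split => //; rewrite subrK.
Qed.

Lemma closed_on_inverse (V W : normedModType C) (D : set V) (f : V -> W) :
  invertible_on D f -> closed_on D f.
Proof.
move=> [S bS [SD SK]] u x y Du ux fy.
suff -> : x = S y by exact: SD.
apply: rcvg_unique ux _.
have -> : u = S \o (f \o u) by apply/funext => n /=; rewrite SK.
exact: bounded_cvg bS fy.
Qed.

(** If each [y] in [Y] can be hit up to half of its norm, with control, then
    the errors can be corrected one after the other; the corrections form a
    geometric series. *)
Lemma approximate_solving (V : completeNormedModType C) (W : normedModType C)
    (D : set V) (f : V -> W) (Y : set W) (M : R) :
  linear_on D f -> closed_on D f ->
  (forall y, Y y -> exists x, [/\ D x, rnorm x <= M * rnorm y, Y (y - f x) &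
     rnorm (y - f x) <= rnorm y / 2]) ->
  forall y, Y y -> exists x, [/\ D x, f x = y & rnorm x <= 2 * M * rnorm y].
Proof.
move=> lf cf approx y Yy.
have [g gP] : {g : W -> V & forall y, Y y -> [/\ D (g y),
    rnorm (g y) <= M * rnorm y, Y (y - f (g y)) &
    rnorm (y - f (g y)) <= rnorm y / 2]}.
  apply: (@choice _ _ (fun y x => Y y -> [/\ D x, rnorm x <= M * rnorm y,
    Y (y - f x) & rnorm (y - f x) <= rnorm y / 2])) => {Yy}{}y.
  have [/approx[x xP]|nY] := pselect (Y y); first by exists x.
  by exists 0.
pose r n := iter n (fun v => v - f (g v)) y.
have Yr n : Y (r n) by elim: n => //= n IH; have [] := gP _ IH.
have rn n : rnorm (r n) <= rnorm y * 2^-1 ^+ n.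
  elim: n => [|n IH]; first by rewrite expr0 mulr1.
  have [_ _ _] := gP _ (Yr n); rewrite exprSr mulrA => /le_trans; apply.
  by rewrite ler_wpM2r// invr_ge0.
have M0 : rnorm y != 0 -> 0 <= M.
  move=> y0; have [_ + _ _] := gP y Yy => /(le_trans (rnorm_ge0 _)).
  by rewrite pmulr_lge0// lt_def y0 rnorm_ge0.
have My : 0 <= M * rnorm y.
  have [->|/M0 M0'] := eqVneq (rnorm y) 0; first by rewrite mulr0.
  by rewrite mulr_ge0// rnorm_ge0.
pose s n := \sum_(k < n) g (r k).
have sS n : s n.+1 = s n + g (r n) by rewrite /s big_ord_recr.
have Ds n : D (s n).
  rewrite /s; elim/big_ind: _ => [|u v|k _]; first exact: lf.1.1.
    exact: is_subspaceD lf.1.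
  by have [] := gP _ (Yr k).
have fs n : f (s n) = y - r n.
  elim: n => [|n IH]; first by rewrite /s big_ord0 (linear_on0 lf) subrr.
  have [Dg _ _ _] := gP _ (Yr n).
  by rewrite sS (linear_onD lf)// IH opprB addrCA addrC.
have [n|x [sx xle]] := @geometric_cvg R V s (M * rnorm y).
  rewrite sS addrC addKr.
  have [_ + _ _] := gP _ (Yr n) => /le_trans; apply.
  have [y0|y0] := eqVneq (rnorm y) 0; last by rewrite -mulrA ler_wpM2l// M0.
  suff -> : rnorm (r n) = 0 by rewrite y0 !mulr0 mul0r.
  by apply/le_anti; rewrite rnorm_ge0 andbT (le_trans (rn n))// y0 mul0r.
have fsy : f \o s @ \oo --> y.
  apply/rcvgP => e e0.
  have /cvgrPdist_lt/(_ e e0) := cvg_half_pow (rnorm y); apply: filterS => n.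
  rewrite /= sub0r normrN ger0_norm; last first.
    by rewrite mulr_ge0 ?rnorm_ge0// exprn_ge0// invr_ge0.
  by move=> h; rewrite fs opprB addrCA subrr addr0; exact: le_lt_trans (rn n) h.
have [Dx fx] := cf s x y Ds sx fsy; exists x; split => //.
by have := xle 0%N; rewrite /s big_ord0 subr0 expr0 mulr1 mulrA.
Qed.

Lemma invertible_add_small (V : completeNormedModType C) (W : normedModType C)
    (D : set V) (f : V -> W) (S : {linear W -> V}) (K : {linear V -> W})
    (M e : R) :
  linear_on D f -> is_inverse D f S -> (forall y, rnorm (S y) <= M * rnorm y) ->
  0 <= M -> 0 <= e -> (forall x, rnorm (K x) <= e * rnorm x) -> e * M <= 2^-1 ->
  exists2 S' : {linear W -> V}, (forall y, rnorm (S' y) <= 2 * M * rnorm y) &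
    is_inverse D (fun x => f x + K x) S'.
Proof.
move=> lf [SD SK] SM M0 e0 Ke eM.
have lfK := linear_on_add lf K.
have bK : bounded_op K by apply/bounded_opP; exists e.
have cfK : closed_on D (fun x => f x + K x).
  apply: closed_on_add bK; apply: closed_on_inverse; exists S => //.
  by apply/bounded_opP; exists M.
have small x : 0 <= x -> e * (M * x) <= x / 2.
  by move=> x0; rewrite mulrA mulrC ler_wpM2l.
apply: invertible_of_bijective => //.
  move=> y; apply: (approximate_solving (Y := setT) lfK cfK) => // {}y _.
  have [Dy fy] := SD y; exists (S y); split => //.
  rewrite fy opprD addNKr rnormN; apply: (le_trans (Ke _)).
  apply: le_trans (small _ (rnorm_ge0 y)).
  by rewrite ler_wpM2l.
move=> x Dx /eqP; rewrite addr_eq0 => /eqP fx.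
apply/eqP; rewrite -rnorm_eq0 -(SK x Dx) eq_le rnorm_ge0 andbT.
have le1 : rnorm (S (f x)) <= e * (M * rnorm x).
  apply: (le_trans (SM _)); rewrite fx rnormN mulrCA ler_wpM2l//.
have := le_trans le1 (small _ (rnorm_ge0 x)).
by rewrite SK//; have := rnorm_ge0 x; lra.
Qed.

(** Baire's theorem inside [Y].  Otherwise there are shrinking balls centred in
    [Y], each avoiding one more of the [Z n], whose centres converge to a point of
    [Y] that no [Z n] contains. *)
Lemma baire_closed (W : completeNormedModType C) (Y : set W)
    (Z : nat -> set W) :
  closed Y -> Y !=set0 -> (forall n, closed (Z n)) ->
  (forall y, Y y -> exists n, Z n y) ->
  exists n y (r : R), [/\ Y y, 0 < r &
    forall y', Y y' -> rnorm (y - y') < r -> Z n y'].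
Proof.
move=> clY [y0 Yy0] clZ cover; apply: contrapT => nZ.
pose valid (p : W * R) := Y p.1 /\ 0 < p.2.
have [next nextP] : {next : nat * (W * R) -> W * R & forall np, valid np.2 ->
    [/\ valid (next np), rnorm ((next np).1 - np.2.1) <= np.2.2 / 4,
    (next np).2 <= np.2.2 / 2 &
    forall w, rnorm ((next np).1 - w) < (next np).2 -> ~ Z np.1 w]}.
  apply: (@choice _ _ (fun np q => valid np.2 -> [/\ valid q,
    rnorm (q.1 - np.2.1) <= np.2.2 / 4, q.2 <= np.2.2 / 2 &
    forall w, rnorm (q.1 - w) < q.2 -> ~ Z np.1 w])) => -[n [y r]].
  have [[/= Yy r0]|nv] := pselect (valid (y, r)); last by exists (y, r).
  have [y' [Yy' yy' Zy']] : exists y', [/\ Y y', rnorm (y - y') < r / 4 & ~ Z n y'].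
    apply: contrapT => h; apply: nZ; exists n, y, (r / 4).
    split => //; first by rewrite divr_gt0.
    by move=> y' Yy' yy'; apply: contrapT => Zy'; apply: h; exists y'.
  have [e e0 He] : exists2 e : R, 0 < e & forall w, rnorm (y' - w) < e -> ~ Z n w.
    apply: contrapT => h; apply: Zy'; apply/(rclosedP _).1 => // e e0.
    apply: contrapT => h'; apply: h; exists e => // w yw Zw.
    by apply: h'; exists w.
  exists (y', Num.min e (r / 2)) => _; split=> //=.
  - by split => //=; rewrite lt_min e0 divr_gt0.
  - by rewrite rnormBC ltW.
  - by rewrite ge_min lexx orbT.
  - by move=> w; rewrite lt_min => /andP[/He].
pose st := fix st n := if n is m.+1 then next (m, st m) else (y0, 1).
have stS n : st n.+1 = next (n, st n) by [].
have v n : valid (st n).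
  by elim: n => [|n IH]; [split => //=|rewrite stS; have [] := nextP (n, st n) IH].
have radius k n : (st (n + k)%N).2 <= (st n).2 * 2^-1 ^+ k.
  elim: k => [|k IH]; first by rewrite addn0 expr0 mulr1.
  rewrite addnS stS; have [_ _ + _] := nextP ((n + k)%N, st (n + k)%N) (v (n + k)%N).
  by move=> /le_trans; apply; rewrite exprSr mulrA ler_wpM2r// invr_ge0.
have conv k : exists l, (fun n => (st (n + k)%N).1) @ \oo --> l /\
    rnorm (l - (st k).1) <= (st k).2 / 2.
  have [n|l [ul lle]] :=
    @geometric_cvg R W (fun n => (st (n + k)%N).1) ((st k).2 / 4).
    rewrite addSn stS; have [_ + _ _] := nextP ((n + k)%N, st (n + k)%N) (v (n + k)%N).
    move=> /le_trans; apply; rewrite mulrAC ler_wpM2r ?invr_ge0//.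
    by rewrite addnC; exact: radius.
  exists l; split => //; have := lle 0%N; rewrite add0n expr0 mulr1.
  by move=> /le_trans; apply; rewrite le_eqVlt; apply/orP; left; apply/eqP; field.
have [l [ul _]] := conv 0%N.
have {}ul : (fun n => (st n).1) @ \oo --> l.
  by have <- : (fun n => (st (n + 0)%N).1) = (fun n => (st n).1)
    by apply/funext => n; rewrite addn0.
have lle k : rnorm (l - (st k).1) < (st k).2.
  have [l' [ul' le']] := conv k.
  have <- : l' = l.
    apply: rcvg_unique ul' _.
    by rewrite (cvg_shiftn k (fun n => (st n).1)).
  apply: (le_lt_trans le'); rewrite ltr_pdivrMr// ltr_pMr ?(v k).2//.
  by rewrite ltr1n.
have Yl : Y l.
  apply/(rclosedP _).1 => // e e0; have /rcvgP/(_ e e0)[N _ /(_ N (leqnn N)) h] := ul.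
  by exists (st N).1 => //; exact: (v _).1.
have [n Znl] := cover l Yl.
have [_ _ _ /(_ l)] := nextP (n, st n) (v n); rewrite -stS; apply => //.
by rewrite rnormBC.
Qed.

(** By Baire's theorem the image of some ball of [D] is dense in a ball of the
    range, so that [approximate_solving] applies. *)
Lemma open_mapping (V W : completeNormedModType C) (D : set V) (f : V -> W) :
  linear_on D f -> closed_on D f -> closed (f @` D) ->
  exists2 M : R, 0 <= M & forall x, D x ->
    exists x', [/\ D x', f x' = f x & rnorm x' <= M * rnorm (f x)].
Proof.
move=> lf cf clY; set Y := f @` D in clY *.
have sY := is_subspace_image lf.
pose Z n := closure [set f x | x in [set x | D x /\ rnorm x <= n%:R]].
have [|n [y0 [r [Yy0 r0 ball_sub]]]] :=
    @baire_closed W Y Z clY (ex_intro _ 0 sY.1) (fun n => @closed_closure _ _).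
  move=> _ [x Dx <-]; exists (Num.truncn (rnorm x)).+1; apply: subset_closure.
  exists x => //; split => //; exact: ltW (truncnS_gt _).
have near0 y : Y y -> rnorm y < r -> forall e : R, 0 < e ->
    exists x, [/\ D x, rnorm x <= n%:R *+ 2 & rnorm (y - f x) < e].
  move=> Yy yr e e0; have e20 : 0 < e / 2 by rewrite divr_gt0.
  have /rclosureP/(_ _ e20)[_ [x [Dx xn] <-] hx] : Z n (y0 + y).
    apply: ball_sub; first exact: is_subspaceD sY _ _.
    by rewrite opprD addrA subrr sub0r rnormN.
  have /rclosureP/(_ _ e20)[_ [x' [Dx' xn'] <-] hx'] : Z n y0.
    by apply: ball_sub => //; rewrite subrr rnorm0.
  exists (x - x'); split; first exact: is_subspaceB lf.1 _ _.
    by rewrite mulr2n (le_trans (ler_rnormB _ _))// lerD.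
  rewrite (linear_onB lf)//.
  have -> : y - (f x - f x') = (y0 + y - f x) - (y0 - f x').
    by rewrite !opprB (addrC y0) -[y + y0 - f x]addrA addrACA [y0 - f x]addrC
      addrK addrA.
  by apply: (le_lt_trans (ler_rnormB _ _)); move: hx hx'; lra.
exists (2 * (4 * n%:R / r)); first by rewrite !mulr_ge0// invr_ge0 ltW.
move=> x Dx; apply: (approximate_solving (Y := Y) lf cf) => //; last by exists x.
move=> {x Dx} _ [x0 Dx0 <-]; set y := f x0.
have Yy : Y y by exists x0.
have [y0'|y_neq0] := eqVneq (rnorm y) 0.
  exists 0; rewrite (linear_on0 lf) subr0 rnorm0 y0' mulr0 mul0r.
  by split => //; exact: lf.1.1.
have ny : 0 < rnorm y by rewrite lt_def y_neq0 rnorm_ge0.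
(* the scaling by t brings y to norm r / 2, where near0 applies *)
pose t := r / (2 * rnorm y).
have t0 : 0 < t by rewrite divr_gt0// mulr_gt0.
have Yty : Y (t%:C *: y) by exact: is_subspaceZ sY _.
have tyr : rnorm (t%:C *: y) < r.
  rewrite rnormZ rnormR gtr0_norm// /t.
  suff -> : r / (2 * rnorm y) * rnorm y = r / 2 by lra.
  by field; rewrite y_neq0.
have r40 : 0 < r / 4 by rewrite divr_gt0.
have [z [Dz zn hz]] := near0 _ Yty tyr _ r40.
have Dx : D (t^-1%:C *: z) by exact: is_subspaceZ lf.1 _.
exists (t^-1%:C *: z); split => //.
- rewrite rnormZ rnormR gtr0_norm ?invr_gt0//.
  apply: (@le_trans _ _ (t^-1 * (n%:R *+ 2))); first by rewrite ler_wpM2l// invr_ge0 ltW.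
  rewrite le_eqVlt; apply/orP; left; apply/eqP; rewrite /t -mulr_natl.
  by field; rewrite y_neq0 gt_eqF.
- by apply: is_subspaceB => //; exists (t^-1%:C *: z).
- rewrite (linear_onZ lf)//.
  have -> : y - t^-1%:C *: f z = t^-1%:C *: (t%:C *: y - f z).
    by rewrite scalerBr scalerA -rmorphM mulVf ?gt_eqF// scale1r.
  rewrite rnormZ rnormR gtr0_norm ?invr_gt0//.
  rewrite ler_pdivrMl//; apply: (le_trans (ltW hz)).
  rewrite le_eqVlt; apply/orP; left; apply/eqP; rewrite /t.
  by field; rewrite y_neq0.
Qed.

End Solving.

(** * Finite-rank perturbations of an invertible operator *)

Section FiniteRank.
Context {R : realType}.
Local Notation C := R[i].
Local Notation functional V := {linear V -> C}.

Definition comb (V : lmodType C) n (v : 'I_n -> V) (c : 'rV[C]_n) : V :=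
  \sum_l c 0 l *: v l.

Definition coords (V : lmodType C) n (psi : 'I_n -> functional V) (x : V) : 'rV[C]_n :=
  \row_l psi l x.

Definition finite_rank (V W : lmodType C) n (psi : 'I_n -> functional V)
  (v : 'I_n -> W) (x : V) : W := comb v (coords psi x).

Section comb.
Context {V : lmodType C} (n : nat).
Implicit Types (v : 'I_n -> V) (psi : 'I_n -> functional V).

Lemma comb_is_linear v : linear (comb v).
Proof.
move=> a c d; rewrite /comb scaler_sumr -big_split; apply: eq_bigr => l _ /=.
by rewrite !mxE scalerDl scalerA.
Qed.

HB.instance Definition _ v :=
  GRing.isLinear.Build C 'rV[C]_n V *:%R (comb v) (comb_is_linear v).

Lemma coords_is_linear psi : linear (coords psi).
Proof. by move=> a x y; apply/rowP => l; rewrite !mxE functionalD functionalZ. Qed.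

HB.instance Definition _ psi :=
  GRing.isLinear.Build C V 'rV[C]_n *:%R (coords psi) (coords_is_linear psi).

Lemma combN v c : comb v (- c) = - comb v c. Proof. exact: linearN. Qed.
Lemma combZ v a c : comb v (a *: c) = a *: comb v c. Proof. exact: linearZ. Qed.
Lemma comb0 v : comb v 0 = 0. Proof. exact: linear0. Qed.
Lemma coords0 psi : coords psi 0 = 0. Proof. exact: linear0. Qed.
Lemma coordsD psi x y : coords psi (x + y) = coords psi x + coords psi y.
Proof. exact: linearD. Qed.
Lemma coordsB psi x y : coords psi (x - y) = coords psi x - coords psi y.
Proof. exact: linearB. Qed.

Lemma comb_span v c : span_of v (comb v c).
Proof. by exists (c 0). Qed.

Lemma span_comb v x : span_of v x -> exists c, x = comb v c.
Proof. by move=> [c ->]; exists (\row_l c l); apply: eq_bigr => l _; rewrite mxE. Qed.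

Lemma independent_comb v c : independent v -> comb v c = 0 -> c = 0.
Proof. by move=> iv /iv c0; apply/rowP => l; rewrite c0 mxE. Qed.

End comb.

Section finite_rank.
Context {V W : lmodType C} (n : nat).
Implicit Types (psi : 'I_n -> functional V) (w : 'I_n -> W).

Lemma finite_rank_is_linear psi w : linear (finite_rank psi w).
Proof.
by move=> a x y; rewrite /finite_rank coords_is_linear comb_is_linear.
Qed.

HB.instance Definition _ psi w :=
  GRing.isLinear.Build C V W *:%R (finite_rank psi w) (finite_rank_is_linear psi w).

Lemma finite_rankE psi w x : finite_rank psi w x = \sum_l psi l x *: w l.
Proof. by apply: eq_bigr => l _; rewrite mxE. Qed.

End finite_rank.

Lemma comb_mulmx (V : lmodType C) m n (v : 'I_n -> V) (c : 'rV[C]_m) (Q : 'M[C]_(m, n)) :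
  comb v (c *m Q) = comb (fun a => comb v (row a Q)) c.
Proof.
by rewrite mulmx_sum_row (linear_sum (comb v)); apply: eq_bigr => a _; rewrite /= combZ.
Qed.

Lemma linear_comb (V W : lmodType C) n (f : {linear V -> W}) (v : 'I_n -> V) c :
  f (comb v c) = comb (f \o v) c.
Proof. by rewrite linear_sum; apply: eq_bigr => l _; rewrite linearZ. Qed.

Lemma bounded_finite_rank_op (V W : normedModType C) n (psi : 'I_n -> functional V)
    (w : 'I_n -> W) :
  (forall l, bounded_op (psi l)) -> bounded_op (finite_rank psi w).
Proof.
move=> bpsi.
have /choice[M HM] l : exists M : R, 0 <= M /\ forall x, rnorm (psi l x) <= M * rnorm x.
  by have /bounded_opP[M M0 HM] := bpsi l; exists M.
apply/bounded_opP; exists (\sum_l M l * rnorm (w l)).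
  by apply: sumr_ge0 => l _; rewrite mulr_ge0 ?rnorm_ge0//; case: (HM l).
move=> x; rewrite /= finite_rankE (le_trans (ler_rnorm_sum _))// mulr_suml.
apply: ler_sum => l _; rewrite rnormZ mulrAC ler_wpM2r ?rnorm_ge0//.
by have [_] := HM l.
Qed.

Lemma closed_kernel (V W : normedModType C) (f : {linear V -> W}) :
  bounded_op f -> closed [set x | f x = 0].
Proof.
move=> /bounded_cst_gt0[M M0 fM]; apply/rclosedP => x clx.
apply/eqP; rewrite -rnorm_eq0 eq_le rnorm_ge0 andbT.
apply/ler_addgt0Pr => e e0; rewrite add0r.
have [y /= fy0 xy] := clx _ (divr_gt0 e0 M0).
rewrite -[f x]subr0 -fy0 -linearB (le_trans (fM _))//.
by move: xy; rewrite ltr_pdivlMr// mulrC => /ltW.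
Qed.

Section perturbation.
Context {V W : normedModType C} (D : set V) (f : V -> W) (S : {linear W -> V}).
Context (n : nat) (psi : 'I_n -> functional V) (w : 'I_n -> W).
Hypothesis lf : linear_on D f.
Hypothesis invS : is_inverse D f S.

(** The matrix of [1 + psi S w] on row vectors.  It carries the whole behaviour
    of [f + w psi]: kernel and cokernel of the two are isomorphic. *)
Definition rank_mx : 'M[C]_n := 1%:M + \matrix_(a, b) psi b (S (w a)).

Local Notation g := (fun x => f x + finite_rank psi w x).

Lemma coords_comb c : coords psi (S (comb w c)) = c *m rank_mx - c.
Proof.
rewrite mulmxDr mulmx1 addrAC subrr add0r; apply/rowP => b; rewrite !mxE.
rewrite linear_comb functional_sum; apply: eq_bigr => a _.
by rewrite mxE.
Qed.

Let SD y : D (S y). Proof. by have [] := invS.1 y. Qed.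
Let fS y : f (S y) = y. Proof. by have [] := invS.1 y. Qed.
Let Sf x : D x -> S (f x) = x. Proof. exact: invS.2. Qed.

Lemma rank_mx_coords x : D x -> coords psi x *m rank_mx = coords psi (S (g x)).
Proof.
move=> Dx; have -> : S (g x) = x + S (comb w (coords psi x)) by rewrite linearD Sf.
by rewrite coordsD coords_comb addrC subrK.
Qed.

Lemma rank_mx_invertible : bounded_op S -> (forall l, bounded_op (psi l)) ->
  \det rank_mx != 0 -> invertible_on D g.
Proof.
move=> bS bpsi; rewrite -unitfE -[_ \is a _]/(rank_mx \in unitmx) => uM.
pose h y := comb w (coords psi (S y) *m invmx rank_mx).
have hE y : h y = finite_rank (fun l => psi l \o S : functional W)
    (fun a => comb w (row a (invmx rank_mx))) y.
  rewrite /h comb_mulmx; apply: eq_bigr => a _.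
  by congr (_ *: _); rewrite !mxE.
have bh : bounded_op (finite_rank (fun l => psi l \o S : functional W)
    (fun a => comb w (row a (invmx rank_mx)))).
  by apply: bounded_finite_rank_op => l; exact: bounded_comp.
have /bounded_opP[N N0 hN] := bh; have /bounded_opP[M M0 SM] := bS.
have [||S' bS' invS'] := @invertible_of_bijective R V W D g
    (linear_on_add lf (finite_rank psi w)) (M * (1 + N)).
- move=> y; exists (S (y - h y)); split; first exact: SD.
    rewrite fS /finite_rank.
    suff -> : coords psi (S (y - h y)) = coords psi (S y) *m invmx rank_mx.
      by rewrite subrK.
    rewrite linearB coordsB coords_comb mulmxKV//.
    by rewrite opprB addrCA subrr addr0.
  rewrite (le_trans (SM _))// -mulrA ler_wpM2l// mulrDl mul1r.
  by rewrite (le_trans (ler_rnormB _ _))// lerD2l hE; exact: hN.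
- move=> x Dx gx0; have := rank_mx_coords Dx; rewrite gx0 linear0 coords0.
  move=> /(congr1 (mulmx^~ (invmx rank_mx))); rewrite mulmxK// mul0mx => cx0.
  by move: gx0; rewrite /finite_rank cx0 comb0 addr0; exact: is_inverse_inj invS Dx.
by exists S' => //; apply/bounded_opP; exists (M * (1 + N)) => //;
  rewrite mulr_ge0// addr_ge0.
Qed.

(** A row [c] killed by the matrix gives the kernel vector [S (comb w c)]. *)
Lemma rank_mx_not_injective : \det rank_mx = 0 ->
  exists x, [/\ D x, x != 0 & g x = 0].
Proof.
move=> /eqP/det0P[c c0 cM]; exists (S (comb w c)).
have cE : coords psi (S (comb w c)) = - c by rewrite coords_comb cM sub0r.
split=> //; last by rewrite fS /finite_rank cE combN subrr.
apply: contra_neq c0 => x0; by apply/eqP; rewrite -oppr_eq0 -cE x0 coords0.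
Qed.

(** A column [d] killed by the matrix gives a functional, [y |-> coords psi (S y)]
    times [d], that vanishes on the range without being zero. *)
Lemma rank_mx_not_surjective : \det rank_mx = 0 ->
  exists y, forall x, D x -> g x <> y.
Proof.
rewrite -det_tr => /eqP/det0P[d d0 /(congr1 trmx)]; rewrite trmx_mul trmxK trmx0 => Md.
apply: contrapT => surj.
have dS y : coords psi (S y) *m d^T = 0.
  have [x Dx <-] : exists2 x, D x & g x = y.
    by apply: contrapT => h; apply: surj; exists y => x Dx gx; apply: h; exists x.
  by rewrite -rank_mx_coords// -mulmxA Md mulmx0.
move/eqP: d0; apply; apply: trmx_inj; rewrite trmx0 -[d^T]mul1mx.
have : rank_mx *m d^T = 0 by [].
rewrite mulmxDl => /eqP; rewrite addr_eq0 => /eqP ->.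
apply/eqP; rewrite oppr_eq0; apply/eqP/row_matrixP => a.
rewrite row_mul row0 -(dS (w a)); congr (_ *m _).
by apply/rowP => b; rewrite !mxE.
Qed.

Lemma range_finite_rank : [set g x | x in D] =
  [set y | coords psi (S y) *m cokermx rank_mx = 0].
Proof.
apply/seteqP; split=> [_ [x Dx <-] /=|y /= /eqP].
  by rewrite -rank_mx_coords// -mulmxA mulmx_coker mulmx0.
rewrite -submxE => /submxP[c cE]; exists (S (y - comb w c)); first exact: SD.
rewrite fS /finite_rank linearB coordsB cE coords_comb opprB addrCA subrr addr0.
by rewrite subrK.
Qed.

(** By the previous description, the range is cut out by finitely many bounded
    functionals. *)
Lemma closed_range_finite_rank : bounded_op S ->
  (forall l, bounded_op (psi l)) -> closed [set g x | x in D].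
Proof.
move=> bS bpsi; rewrite range_finite_rank.
pose theta a := finite_rank (fun l => psi l \o S : functional W)
  (fun l => cokermx rank_mx l a : C).
have thetaE a y : theta a y = (coords psi (S y) *m cokermx rank_mx) 0 a.
  by rewrite /theta finite_rankE mxE; apply: eq_bigr => l _; rewrite [X in _ = X * _]mxE.
rewrite (_ : [set _ | _] = \bigcap_(a in [set: 'I_n]) [set y | theta a y = 0]).
  apply: closed_bigI => a _; apply: closed_kernel.
  by apply: bounded_finite_rank_op => l; exact: bounded_comp.
apply/seteqP; split=> y /= h; first by move=> a _; rewrite /= thetaE h mxE.
by apply/rowP => a; rewrite -thetaE mxE; exact: h.
Qed.

Lemma finite_codim_finite_rank : finite_codim [set g x | x in D].
Proof.
exists n, w => y; exists (- finite_rank psi w (S y)).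
  by rewrite /finite_rank -combN; exact: comb_span.
by exists (S y); rewrite ?fS ?opprK.
Qed.

Lemma finite_dim_kernel_finite_rank : finite_dim [set x | D x /\ g x = 0].
Proof.
pose B := row_base (kermx rank_mx).
have BM : B *m rank_mx = 0 by apply/eqP; rewrite -sub_kermx eq_row_base.
have SB c : S (comb w (c *m B)) = comb (fun a => S (comb w (row a B))) c.
  by rewrite comb_mulmx linear_comb.
exists (\rank (kermx rank_mx)), (fun a => S (comb w (row a B))); split.
  move=> c /= c0; pose c' : 'rV[C]_ _ := \row_a c a.
  have Sc0 : S (comb w (c' *m B)) = 0.
    by rewrite SB -[RHS]c0; apply: eq_bigr => a _; rewrite mxE.
  have := coords_comb (c' *m B); rewrite Sc0 linear0 -mulmxA BM mulmx0 sub0r.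
  move=> /eqP; rewrite eq_sym oppr_eq0 => /eqP c'B.
  have fB : row_free B by exact: row_base_free.
  have c'0 : c' = 0 by apply: (row_free_inj fB); rewrite c'B mul0mx.
  by move=> a; have := congr1 (fun u : 'rV[C]_ _ => u 0 a) c'0; rewrite !mxE.
apply/seteqP; split=> [x /= [Dx gx0]|x /span_comb[c ->] /=].
  have : (coords psi x <= B)%MS.
    by rewrite eq_row_base sub_kermx rank_mx_coords// gx0 linear0 coords0.
  move=> /submxP[c cE].
  have xE : x = S (comb w (- coords psi x)).
    by rewrite -{1}(Sf Dx); congr (S _); apply/eqP; rewrite combN -addr_eq0 gx0.
  by rewrite xE cE -mulNmx SB; exact: comb_span.
rewrite -SB; split; first exact: SD.
by rewrite fS /finite_rank coords_comb -mulmxA BM mulmx0 sub0r combN subrr.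
Qed.

End perturbation.
End FiniteRank.

(** * Fredholm operators of index zero *)

Section IndexZero.
Context {R : realType}.
Local Notation C := R[i].
Local Notation functional V := {linear V -> C}.

Definition glue m n (T : Type) (a : 'I_m -> T) (b : 'I_n -> T) (l : 'I_(m + n)) : T :=
  match fintype.split l with inl l => a l | inr l => b l end.

Definition op_shift (V : lmodType C) (f : V -> V) (z : C) (x : V) : V := f x - z *: x.

(** For closed operators this characterizes the Fredholm operators of index zero;
    stability under finite-rank perturbations is built into it. *)
Definition index_zero (V W : normedModType C) (D : set V) (f : V -> W) :=
  exists n (psi : 'I_n -> functional V) (w : 'I_n -> W),
    (forall l, bounded_op (psi l)) /\
    invertible_on D (fun x => f x + finite_rank psi w x).

Section algebra.
Context {V W : normedModType C}.
Implicit Types (D : set V) (f : V -> W).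

Lemma finite_rank_opp n (psi : 'I_n -> functional V) (w : 'I_n -> W) x :
  finite_rank psi (fun l => - w l) x = - finite_rank psi w x.
Proof. by rewrite !finite_rankE -sumrN; apply: eq_bigr => l _; rewrite scalerN. Qed.

Lemma finite_rank_cat m n (phi : 'I_m -> functional V) (u : 'I_m -> W)
    (psi : 'I_n -> functional V) (w : 'I_n -> W) x :
  finite_rank (glue phi psi) (glue u w) x = finite_rank phi u x + finite_rank psi w x.
Proof.
rewrite !finite_rankE big_split_ord /glue; congr (_ + _).
  by apply: eq_bigr => l _; rewrite (unsplitK (inl l)).
by apply: eq_bigr => l _; rewrite (unsplitK (inr l)).
Qed.

Lemma index_zero_invertible D f : invertible_on D f -> index_zero D f.
Proof.
move=> invf; exists 0%N, (fun=> \0), (fun=> 0); split; first by case.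
by under eq_fun do rewrite finite_rankE big_ord0 addr0.
Qed.

Lemma index_zero_add D f m (phi : 'I_m -> functional V) (u : 'I_m -> W) :
  (forall l, bounded_op (phi l)) -> index_zero D f ->
  index_zero D (fun x => f x + finite_rank phi u x).
Proof.
move=> bphi [n [psi [w [bpsi inv]]]].
exists (m + n)%N, (glue phi psi), (glue (fun l => - u l) w).
split=> [l|]; first by rewrite /glue; case: (fintype.split l).
rewrite (_ : (fun x => _) = fun x => f x + finite_rank psi w x)//.
apply/funext => x.
by rewrite finite_rank_cat finite_rank_opp addrA addrK.
Qed.

Lemma index_zero_sub D f m (phi : 'I_m -> functional V) (u : 'I_m -> W) :
  (forall l, bounded_op (phi l)) ->
  index_zero D (fun x => f x + finite_rank phi u x) -> index_zero D f.
Proof.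
move=> bphi /(index_zero_add (fun l => - u l) bphi).
by under eq_fun do rewrite finite_rank_opp addrK.
Qed.

(** The Fredholm alternative: write [f = g + K] with [g] invertible and [K] of
    finite rank, and distinguish whether the matrix of [1 + K g^-1] is singular. *)
Lemma fredholm_alternative D f : linear_on D f -> index_zero D f ->
  (forall x, D x -> f x = 0 -> x = 0) \/ (forall y, exists2 x, D x & f x = y) ->
  invertible_on D f.
Proof.
move=> lf [n [psi [w [bpsi [S bS invS]]]]] injsurj.
have lg := linear_on_add lf (finite_rank psi w).
have fE : (fun x => f x + finite_rank psi w x + finite_rank psi (fun l => - w l) x) = f.
  by apply/funext => x; rewrite finite_rank_opp addrK.
have [det0|det0] := eqVneq (\det (rank_mx S psi (fun l => - w l))) 0; last first.
  by rewrite -fE; exact: rank_mx_invertible lg invS bS bpsi det0.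
exfalso; case: injsurj => [inj|surj].
  have [x [Dx x0]] := rank_mx_not_injective invS det0.
  by rewrite finite_rank_opp addrK => /(inj x Dx); apply/eqP.
have [y] := rank_mx_not_surjective invS det0.
by have [x Dx fx] := surj y => /(_ x Dx); rewrite finite_rank_opp addrK.
Qed.

End algebra.

Lemma scale_linear (V : normedModType C) (z : C) : exists2 K : {linear V -> V}, (forall x, K x = z *: x) &
  forall x, rnorm (K x) <= rnorm z * rnorm x.
Proof.
have [|K KE] := @linear_of R V V (fun x => z *: x).
  by move=> a x y; rewrite scalerDr !scalerA mulrC.
by exists K => // x; rewrite KE rnormZ.
Qed.

Section op_shift_algebra.
Context {V : normedModType C} (D : set V).
Implicit Types f : V -> V.

Lemma linear_on_shift f z : linear_on D f -> linear_on D (op_shift f z).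
Proof.
move=> lf; split=> [|a x y Dx Dy]; first exact: lf.1.
by rewrite /op_shift lf.2// scalerDr opprD addrACA scalerBr !scalerA (mulrC z).
Qed.

Lemma shiftD f z w : op_shift (op_shift f z) w = op_shift f (z + w).
Proof. by apply/funext => x; rewrite /op_shift scalerDl opprD addrA. Qed.

Lemma shift_finite_rank f z n (psi : 'I_n -> functional V) (w : 'I_n -> V) :
  op_shift (fun x => f x + finite_rank psi w x) z =
  (fun x => op_shift f z x + finite_rank psi w x).
Proof. by apply/funext => x; rewrite /op_shift addrAC. Qed.

End op_shift_algebra.

Section op_shift.
Context {V : completeNormedModType C} (D : set V).
Implicit Types f : V -> V.

Lemma inverse_shift f S (M : R) (z : C) : linear_on D f -> is_inverse D f S ->
  0 <= M -> (forall y, rnorm (S y) <= M * rnorm y) -> rnorm z * M <= 2^-1 ->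
  exists2 S' : {linear V -> V}, (forall y, rnorm (S' y) <= 2 * M * rnorm y) &
    is_inverse D (op_shift f z) S'.
Proof.
move=> lf invS M0 SM zM; have [K KE Kle] := scale_linear V (- z).
have {}Kle x : rnorm (K x) <= rnorm z * rnorm x by rewrite (le_trans (Kle x))// rnormN.
have [S' S'M invS'] := invertible_add_small lf invS SM M0 (rnorm_ge0 z) Kle zM.
exists S' => //; suff <- : (fun x => f x + K x) = op_shift f z by [].
by apply/funext => x; rewrite KE scaleNr.
Qed.

Lemma invertible_unshift f S (M : R) (z : C) : linear_on D f ->
  is_inverse D (op_shift f z) S -> 0 <= M ->
  (forall y, rnorm (S y) <= M * rnorm y) -> rnorm z * M <= 2^-1 ->
  invertible_on D f.
Proof.
move=> lf invS M0 SM zM.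
have zM' : rnorm (- z) * M <= 2^-1 by rewrite rnormN.
have [S' S'M invS'] := inverse_shift (linear_on_shift z lf) invS M0 SM zM'.
exists S'; first by apply/bounded_opP; exists (2 * M) => //; rewrite mulr_ge0.
suff <- : op_shift (op_shift f z) (- z) = f by [].
by rewrite shiftD subrr; apply/funext => x; rewrite /op_shift scale0r subr0.
Qed.

Lemma invertible_near f : linear_on D f -> invertible_on D f ->
  exists2 e : R, 0 < e & forall z, rnorm z < e -> invertible_on D (op_shift f z).
Proof.
move=> lf [S /bounded_cst_gt0[M M0 SM] invS].
exists (2 * M)^-1; first by rewrite invr_gt0 mulr_gt0.
move=> z zM; have {}zM : rnorm z * M <= 2^-1.
  by move: zM; rewrite invfM -ltr_pdivrMr ?invr_gt0// invrK => /ltW.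
have [S' S'M invS'] := inverse_shift lf invS (ltW M0) SM zM.
by exists S' => //; apply/bounded_opP; exists (2 * M) => //; rewrite mulr_ge0// ltW.
Qed.

Lemma index_zero_near f : linear_on D f -> index_zero D f ->
  exists2 e : R, 0 < e & forall z, rnorm z < e -> index_zero D (op_shift f z).
Proof.
move=> lf [n [psi [w [bpsi inv]]]].
have [e e0 He] := invertible_near (linear_on_add lf (finite_rank psi w)) inv.
exists e => // z ze; exists n, psi, w; split => //.
by have := He z ze; rewrite shift_finite_rank.
Qed.

End op_shift.

Section limit.
Context {V : completeNormedModType C} (D : set V).
Implicit Types f : V -> V.

Definition limit_of_index_zero f :=
  forall e : R, 0 < e -> exists2 z, rnorm z < e & index_zero D (op_shift f z).

Lemma limit_of_index_zero_add f n (psi : 'I_n -> functional V) (w : 'I_n -> V) :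
  (forall l, bounded_op (psi l)) -> limit_of_index_zero f ->
  limit_of_index_zero (fun x => f x + finite_rank psi w x).
Proof.
move=> bpsi lim e e0; have [z ze iz] := lim e e0; exists z => //.
by rewrite shift_finite_rank; exact: index_zero_add.
Qed.

(** Being bounded below, or being onto, is stable under small shifts, and for
    the nearby operators of index zero either property means invertibility,
    with uniformly bounded inverses. *)
Lemma invertible_limit f : linear_on D f -> closed_on D f -> closed (f @` D) ->
  limit_of_index_zero f ->
  (forall x, D x -> f x = 0 -> x = 0) \/ (forall y, exists2 x, D x & f x = y) ->
  invertible_on D f.
Proof.
move=> lf cf clf lim injsurj; have [M' M'0 HM'] := open_mapping lf cf clf.
pose M := M' + 1; have M0 : 0 < M by rewrite ltr_wpDl.
have HM x : D x -> exists x', [/\ D x', f x' = f x & rnorm x' <= M * rnorm (f x)].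
  move=> /HM'[x' [Dx' fx' x'M]]; exists x'; split => //; apply: (le_trans x'M).
  by rewrite ler_wpM2r ?rnorm_ge0// lerDl.
have M40 : 0 < (4 * M)^-1 by rewrite invr_gt0 mulr_gt0.
have [z zM iz] := lim _ M40.
have {M40}zM : rnorm z * M <= 4^-1.
  by move: zM; rewrite invfM -ltr_pdivrMr ?invr_gt0// invrK => /ltW.
have lz := linear_on_shift z lf.
have smallz (a : R) : 0 <= a -> rnorm z * (M * a) <= a / 4.
  by move=> a0; rewrite mulrA mulrC ler_wpM2l.
suff [S SM invS] : exists2 S : {linear V -> V},
    forall y, rnorm (S y) <= 2 * M * rnorm y & is_inverse D (op_shift f z) S.
  apply: (invertible_unshift lf invS _ SM); first by rewrite mulr_ge0// ltW.
  by move: zM; lra.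
case: injsurj => [inj|surj].
  have below x : D x -> rnorm x <= M * rnorm (f x).
    move=> Dx; have [x' [Dx' fx' x'M]] := HM x Dx.
    suff <- : x' = x by rewrite fx'.
    apply/eqP; rewrite -subr_eq0; apply/eqP/inj; first exact: is_subspaceB lf.1 _ _.
    by rewrite (linear_onB lf)// fx' subrr.
  have [|S bS invS] := fredholm_alternative lz iz.
    left=> x Dx /eqP; rewrite subr_eq0 => /eqP fx.
    apply/eqP; rewrite -rnorm_eq0 eq_le rnorm_ge0 andbT.
    have := below x Dx; rewrite fx rnormZ mulrCA.
    by have := smallz _ (rnorm_ge0 x); have := rnorm_ge0 x; lra.
  exists S => // y; have [Dx fx] := invS.1 y; have := below _ Dx.
  have -> : f (S y) = y + z *: S y by rewrite -{2}fx subrK.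
  move=> /le_trans/(_ (ler_wpM2l (ltW M0) (ler_rnormD _ _))).
  rewrite rnormZ mulrDr [M * (_ * _)]mulrCA -mulrA.
  by have := smallz _ (rnorm_ge0 (S y)); have := rnorm_ge0 (S y); lra.
have solve y : exists x, [/\ D x, op_shift f z x = y & rnorm x <= 2 * M * rnorm y].
  apply: (approximate_solving (Y := setT) lz) => //.
    have [K KE Kle] := scale_linear V (- z).
    suff <- : (fun x => f x + K x) = op_shift f z.
      by apply: closed_on_add => //; apply/bounded_opP; exists (rnorm (- z)); first exact: rnorm_ge0.
    by apply/funext => x; rewrite KE scaleNr.
  move=> {}y _; have [x0 Dx0 fx0] := surj y.
  have [x [Dx fx xM]] := HM x0 Dx0; exists x; split=> //; first by rewrite -fx0.
  rewrite /op_shift fx fx0 opprB addrCA subrr addr0 rnormZ.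
  rewrite fx0 in xM; apply: (le_trans (ler_wpM2l (rnorm_ge0 z) xM)).
  by apply: (le_trans (smallz _ (rnorm_ge0 y))); have := rnorm_ge0 y; lra.
have [|S bS invS] := fredholm_alternative lz iz.
  by right=> y; have [x [Dx fx _]] := solve y; exists x.
by exists S => // y; have [x [Dx <- xM]] := solve y; rewrite invS.2.
Qed.

(** Perturbing by the rank-one operator [phi (x) m], where [phi] is [1] at some
    element [u] of the kernel, makes the kernel smaller and the range larger by
    one dimension. *)
Section rank_one.
Variables (f : V -> V) (phi : functional V) (u m : V).
Hypotheses (lf : linear_on D f) (Du : D u) (fu0 : f u = 0) (phiu : phi u = 1).

Definition add_rank_one (x : V) : V :=
  f x + finite_rank (fun _ : 'I_1 => phi) (fun=> m) x.

Lemma add_rank_oneE x : add_rank_one x = f x + phi x *: m.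
Proof. by rewrite /add_rank_one finite_rankE big_ord1. Qed.

Lemma range_add_rank_one :
  add_rank_one @` D = [set y | exists c : C, (f @` D) (y - c *: m)].
Proof.
apply/seteqP; split=> [_ [x Dx <-] /=|y [c [x Dx fx]]].
  by exists (phi x), x; rewrite ?add_rank_oneE ?addrK.
exists (x + (c - phi x) *: u).
  by apply: is_subspaceD lf.1 _ _ => //; exact: is_subspaceZ lf.1 _.
rewrite add_rank_oneE (linear_onD lf) ?(linear_onZ lf)//; last exact: is_subspaceZ lf.1 _.
by rewrite fu0 scaler0 addr0 functionalD functionalZ phiu mulr1 (addrC (phi x)) subrK fx subrK.
Qed.

Lemma kernel_add_rank_one x : ~ (f @` D) m -> D x -> add_rank_one x = 0 ->
  f x = 0 /\ phi x = 0.
Proof.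
move=> fm Dx; rewrite add_rank_oneE => gx0.
have [phi0|phi0] := eqVneq (phi x) 0; first by move: gx0; rewrite phi0 scale0r addr0.
exfalso; apply: fm; exists (- (phi x)^-1 *: x); first exact: is_subspaceZ lf.1 _.
move/eqP: gx0; rewrite addr_eq0 => /eqP fx.
by rewrite (linear_onZ lf)// fx scaleNr scalerN opprK scalerA mulVf// scale1r.
Qed.

End rank_one.

(** Rank-one perturbations lower the dimension of the kernel until [f] becomes
    injective or onto, where [invertible_limit] takes over. *)
Lemma index_zero_limit_kernel N (b : 'I_N -> V) f : linear_on D f -> closed_on D f ->
  closed (f @` D) -> limit_of_index_zero f ->
  (forall l, D (b l) /\ f (b l) = 0) ->
  (forall x, D x -> f x = 0 -> span_of b x) -> index_zero D f.
Proof.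
elim: N b f => [|N IH] b f lf cf clf lim kerb spanb.
  apply: index_zero_invertible; apply: invertible_limit => //; left=> x Dx fx0.
  by have [c ->] := spanb x Dx fx0; rewrite big_ord0.
have [surj|nsurj] := pselect (forall y, exists2 x, D x & f x = y).
  by apply: index_zero_invertible; apply: invertible_limit => //; right.
have [m fm] : exists m, ~ (f @` D) m by apply/existsNP.
have [b0|b0] := eqVneq (b ord0) 0.
  apply: (IH (fun l => b (lift ord0 l)) f) => // x Dx fx0.
  have [c ->] := spanb x Dx fx0; exists (fun l => c (lift ord0 l)).
  by rewrite big_ord_recl b0 scaler0 add0r.
have [Du fu0] := kerb ord0.
have [phi bphi phiu] := norming_functional b0.
pose g := add_rank_one f phi m.
apply: (index_zero_sub (u := fun=> m) (phi := fun _ : 'I_1 => phi)) => //.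
rewrite -/g; pose b' l := b (lift ord0 l) - phi (b (lift ord0 l)) *: b ord0.
have bphi' : forall l : 'I_1, bounded_op phi by [].
apply: (IH b' g).
- exact: linear_on_add.
- by apply: closed_on_add => //; exact: bounded_finite_rank_op.
- rewrite /g (range_add_rank_one m lf Du fu0 phiu).
  by apply: closed_add_line => //; exact: is_subspace_image.
- exact: limit_of_index_zero_add.
- move=> l; have [Dl fl] := kerb (lift ord0 l).
  have Dpu : D (phi (b (lift ord0 l)) *: b ord0) by exact: is_subspaceZ lf.1 _.
  split; first exact: is_subspaceB lf.1 _ _.
  rewrite /g add_rank_oneE (linear_onB lf)// fl (linear_onZ lf)// fu0 scaler0 subrr.
  by rewrite functionalB functionalZ phiu mulr1 subrr scale0r addr0.
move=> x Dx /(kernel_add_rank_one lf fm Dx)[fx0 px0].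
have [c xE] := spanb x Dx fx0; exists (fun l => c (lift ord0 l)).
have : phi x = c ord0 + \sum_(l < N) c (lift ord0 l) * phi (b (lift ord0 l)).
  by rewrite xE functional_sum big_ord_recl phiu mulr1.
rewrite px0 => /esym/eqP; rewrite addr_eq0 => /eqP c0.
rewrite xE big_ord_recl c0 scaleNr scaler_suml addrC -sumrB.
by apply: eq_bigr => l _; rewrite scalerBr scalerA.
Qed.

(** The same induction, on the codimension of the range. *)
Lemma index_zero_limit_cokernel N (b : 'I_N -> V) f : linear_on D f -> closed_on D f ->
  closed (f @` D) -> limit_of_index_zero f ->
  (forall y, exists c : 'I_N -> C, (f @` D) (y - \sum_l c l *: b l)) ->
  index_zero D f.
Proof.
elim: N b f => [|N IH] b f lf cf clf lim spanb.
  apply: index_zero_invertible; apply: invertible_limit => //; right=> y.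
  by have [c] := spanb y; rewrite big_ord0 subr0.
have [inj|ninj] := pselect (forall x, D x -> f x = 0 -> x = 0).
  by apply: index_zero_invertible; apply: invertible_limit => //; left.
have [u [Du fu0 u0]] : exists u, [/\ D u, f u = 0 & u != 0].
  apply: contrapT => h; apply: ninj => x Dx fx0; apply/eqP/negPn/negP => x0.
  by apply: h; exists x.
have [phi bphi phiu] := norming_functional u0.
pose m := b ord0; pose g := add_rank_one f phi m.
apply: (index_zero_sub (u := fun=> m) (phi := fun _ : 'I_1 => phi)) => //.
rewrite -/g; have bphi' : forall l : 'I_1, bounded_op phi by [].
have rangeg := range_add_rank_one m lf Du fu0 phiu.
apply: (IH (fun l => b (lift ord0 l)) g).
- exact: linear_on_add.
- by apply: closed_on_add => //; exact: bounded_finite_rank_op.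
- by rewrite rangeg; apply: closed_add_line => //; exact: is_subspace_image.
- exact: limit_of_index_zero_add.
move=> y; have [c Yc] := spanb y; exists (fun l => c (lift ord0 l)).
rewrite rangeg /=; exists (c ord0).
by move: Yc; rewrite big_ord_recl opprD addrCA addrC addrAC.
Qed.

End limit.
End IndexZero.

(** * Analytic determinants *)

Section Germs.
Context {R : realType}.
Local Notation C := R[i].
Local Notation functional V := {linear V -> C}.

(** Analyticity at [0], expressed by repeated division by the variable: the
    [h n] are the remainders of the power series with coefficients [a n]. *)
Definition analytic (r : R) (g : C -> C) :=
  exists (a : nat -> C) (h : nat -> C -> C) (B q : R), [/\ 0 <= B, 1 <= q,
    forall w, rnorm w < r -> h 0%N w = g w,
    forall n w, rnorm w < r -> h n w = a n + w * h n.+1 w &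
    forall n w, rnorm w < r -> rnorm (h n w) <= B * q ^+ n].

Section ring.
Variable r : R.
Hypothesis r0 : 0 < r.

Lemma geometric_weaken B q (h : nat -> C -> C) B' q' :
  0 <= B -> 1 <= q -> B <= B' -> q <= q' ->
  (forall n w, rnorm w < r -> rnorm (h n w) <= B * q ^+ n) ->
  forall n w, rnorm w < r -> rnorm (h n w) <= B' * q' ^+ n.
Proof.
move=> B0 q1 BB qq hB n w wr; rewrite (le_trans (hB n w wr))//.
have q0 : 0 <= q by rewrite (le_trans _ q1).
by apply: ler_pM => //; [rewrite exprn_ge0|apply: lerXn2r => //; rewrite nnegrE// (le_trans q0)].
Qed.

Lemma analytic_cst c : analytic r (fun=> c).
Proof.
exists (fun n => if n is 0%N then c else 0), (fun n _ => if n is 0%N then c else 0),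
  (rnorm c), 1; split => //; first exact: rnorm_ge0.
  by move=> [|n] w _; rewrite mulr0 addr0.
by move=> [|n] w _; rewrite expr1n mulr1// rnorm0 rnorm_ge0.
Qed.

Lemma analyticD g1 g2 : analytic r g1 -> analytic r g2 ->
  analytic r (fun w => g1 w + g2 w).
Proof.
move=> [a1 [h1 [B1 [q1 [B10 q11 h1g h1S h1B]]]]].
move=> [a2 [h2 [B2 [q2 [B20 q21 h2g h2S h2B]]]]].
exists (fun n => a1 n + a2 n), (fun n w => h1 n w + h2 n w), (B1 + B2), (Num.max q1 q2).
split; first exact: addr_ge0.
- by rewrite le_max q11.
- by move=> w wr; rewrite h1g// h2g.
- by move=> n w wr; rewrite h1S// h2S// mulrDr addrACA.
move=> n w wr; rewrite (le_trans (ler_rnormD _ _))// mulrDl; apply: lerD.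
  by apply: (geometric_weaken (q := q1) B10 _ _ _ h1B); rewrite // le_max lexx.
by apply: (geometric_weaken (q := q2) B20 _ _ _ h2B); rewrite // le_max lexx orbT.
Qed.

Lemma analyticM g1 g2 : analytic r g1 -> analytic r g2 ->
  analytic r (fun w => g1 w * g2 w).
Proof.
move=> [a1 [h1 [B1 [q1 [B10 q11 h1g h1S h1B']]]]].
move=> [a2 [h2 [B2 [q2 [B20 q21 h2g h2S h2B']]]]].
pose q := Num.max q1 q2.
have q1q : q1 <= q by rewrite le_max lexx.
have q2q : q2 <= q by rewrite le_max lexx orbT.
have q_ge1 : 1 <= q by rewrite (le_trans q11).
have h1B := geometric_weaken B10 q11 (lexx _) q1q h1B'.
have h2B := geometric_weaken B20 q21 (lexx _) q2q h2B'.
have a1B n : rnorm (a1 n) <= B1 * q ^+ n.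
  by have := h1B n 0; rewrite h1S ?rnorm0// mul0r addr0; apply.
(* the remainders of the Cauchy product *)
pose h n w := \sum_(k < n) a1 k * h2 (n - k)%N w + h1 n w * h2 0%N w.
pose a n := \sum_(k < n) a1 k * a2 (n - k)%N + a1 n * a2 0%N.
exists a, h, (B1 * B2), (2 * q); split; first exact: mulr_ge0.
- by rewrite (le_trans q_ge1)// ler_pMl ?ler1n// (lt_le_trans ltr01).
- by move=> w wr; rewrite /h big_ord0 add0r h1g// h2g.
- move=> n w wr; rewrite /h /a big_ord_recr /= subSnn.
  under eq_bigr => k _ do rewrite (h2S _ w wr) mulrDr.
  rewrite big_split /= -!addrA; congr (_ + _).
  rewrite (h1S n w wr) {1}(h2S 0%N w wr) !mulrDr !mulrDl mulr_sumr.
  under [in RHS]eq_bigr => k _.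
    rewrite subSn ?(ltnW (ltn_ord k))// mulrCA.
    over.
  by rewrite (h2S 0%N w wr); ring.
move=> n w wr; rewrite /h.
apply: (@le_trans _ _ (\sum_(k < n) B1 * B2 * q ^+ n + B1 * B2 * q ^+ n)).
  apply: (le_trans (ler_rnormD _ _)); apply: lerD.
    apply: (le_trans (ler_rnorm_sum _)); apply: ler_sum => k _.
    have -> : q ^+ n = q ^+ k * q ^+ (n - k) by rewrite -exprD subnKC// ltnW.
    rewrite rnormM mulrACA.
    by apply: ler_pM; rewrite ?rnorm_ge0// h2B.
  rewrite rnormM mulrAC; apply: ler_pM; rewrite ?rnorm_ge0//; first exact: h1B.
  by have := h2B 0%N w wr; rewrite expr0 mulr1.
rewrite sumr_const card_ord -mulrSr exprMn mulrCA -[leLHS]mulr_natl.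
rewrite ler_wpM2r//; last by rewrite -natrX ler_nat ltn_expl.
by rewrite !mulr_ge0// exprn_ge0// (le_trans _ q_ge1).
Qed.

Lemma analytic_sum (I : Type) (s : seq I) (F : I -> C -> C) :
  (forall i, analytic r (F i)) -> analytic r (fun w => \sum_(i <- s) F i w).
Proof.
move=> aF; elim: s => [|i s IH].
  by under eq_fun do rewrite big_nil; exact: analytic_cst.
by under eq_fun do rewrite big_cons; exact: analyticD.
Qed.

Lemma analytic_prod (I : Type) (s : seq I) (F : I -> C -> C) :
  (forall i, analytic r (F i)) -> analytic r (fun w => \prod_(i <- s) F i w).
Proof.
move=> aF; elim: s => [|i s IH].
  by under eq_fun do rewrite big_nil; exact: analytic_cst.
by under eq_fun do rewrite big_cons; exact: analyticM.
Qed.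

Lemma analytic_det n (M : C -> 'M[C]_n) :
  (forall i j, analytic r (fun w => M w i j)) -> analytic r (fun w => \det (M w)).
Proof.
move=> aM; apply: analytic_sum => s; apply: analyticM; first exact: analytic_cst.
exact: analytic_prod.
Qed.

Lemma analytic_zeros g : analytic r g ->
  (exists2 e : R, 0 < e & forall w, rnorm w < e -> g w = 0) \/
  (exists2 e : R, 0 < e & forall w, 0 < rnorm w < e -> g w != 0).
Proof.
move=> [a [h [B [q [B0 q1 hg hS hB]]]]].
have q0 : 0 < q by rewrite (lt_le_trans _ q1).
have gE n w : rnorm w < r -> (forall k, (k < n)%N -> a k = 0) -> g w = w ^+ n * h n w.
  move=> wr; elim: n => [|n IH] ak0; first by rewrite mul1r hg.
  rewrite IH ?(hS n w wr) ?ak0// ?add0r ?exprSr ?mulrA// => k kn.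
  by apply: ak0; rewrite (ltn_trans kn).
have [a0|/existsNP/cid[k0 ak0]] := pselect (forall n, a n = 0).
  left; exists (Num.min r (2 * q)^-1) => [|w]; first by rewrite lt_min r0 invr_gt0 mulr_gt0.
  rewrite lt_min => /andP[wr wq]; apply/eqP; rewrite -rnorm_eq0 eq_le rnorm_ge0 andbT.
  have gB n : rnorm (g w) <= B * 2^-1 ^+ n.
    rewrite (gE n w wr (fun k _ => a0 k)) rnormM rnormX.
    rewrite (le_trans (ler_wpM2l _ (hB n w wr))) ?exprn_ge0 ?rnorm_ge0//.
    rewrite mulrCA -exprMn ler_wpM2l//; apply: lerXn2r.
    - by rewrite nnegrE mulr_ge0 ?rnorm_ge0// ltW.
    - by rewrite nnegrE invr_ge0.
    by move: wq; rewrite invfM -ltr_pdivrMr ?invr_gt0// invrK => /ltW.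
  apply/ler_addgt0Pr => e e0; rewrite add0r.
  have /cvgrPdist_lt/(_ e e0)[N _ /(_ N (leqnn N))] := cvg_half_pow B.
  rewrite /= sub0r normrN ger0_norm; last by rewrite mulr_ge0// exprn_ge0// invr_ge0.
  by move=> /ltW; exact: le_trans (gB N).
right; have ex : exists n, a n != 0 by exists k0; apply/eqP.
have [k ak kmin] := ex_minnP ex.
have gk w : rnorm w < r -> g w = w ^+ k * h k w.
  move=> wr; apply: gE => // l lk; apply/eqP/negPn/negP => /kmin.
  by rewrite leqNgt lk.
have D0 : 0 < B * q ^+ k.+1 + 1 by rewrite ltr_wpDl// mulr_ge0// exprn_ge0// ltW.
exists (Num.min r (rnorm (a k) / (B * q ^+ k.+1 + 1))) => [|w].
  by rewrite lt_min r0 divr_gt0// rnorm_gt0.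
move=> /andP[w0]; rewrite lt_min => /andP[wr]; rewrite ltr_pdivlMr// => wk.
rewrite gk// mulf_neq0//; first by rewrite expf_neq0// -rnorm_gt0.
apply/eqP => hk0; have := hS k w wr; rewrite hk0 => /esym/eqP.
rewrite addr_eq0 => /eqP akE; move: wk; rewrite akE rnormN rnormM.
apply/negP; rewrite -leNgt ler_pM2l//.
by rewrite (le_trans (hB k.+1 w wr))// lerDl.
Qed.

End ring.

(** The resolvent [S_w] of a shift satisfies [S_w = S + w S S_w], which is the
    division property required of the remainders. *)
Lemma analytic_resolvent (V : normedModType C) (D : set V) (g : V -> V)
    (S : {linear V -> V}) (Sw : C -> {linear V -> V}) (r M : R)
    (psi : functional V) (v : V) :
  is_inverse D g S -> 0 <= M -> (forall y, rnorm (S y) <= M * rnorm y) ->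
  (forall w : C, rnorm w < r -> is_inverse D (op_shift g w) (Sw w)) ->
  (forall w : C, rnorm w < r -> forall y, rnorm (Sw w y) <= 2 * M * rnorm y) ->
  bounded_op psi -> analytic r (fun w => psi (Sw w v)).
Proof.
move=> [_ SK] M0 SM invSw SwM /bounded_opP[P P0 psiP].
have resolventE w y : rnorm w < r -> Sw w y = S y + w *: S (Sw w y).
  move=> wr; have [Dy gy] := (invSw w wr).1 y.
  by rewrite -linearZ -linearD -{2}gy /op_shift subrK SK.
pose q := Num.max 1 M.
have iterM n y : rnorm (iter n S y) <= q ^+ n * rnorm y.
  elim: n => [|n IH]; first by rewrite mul1r.
  rewrite iterS (le_trans (SM _))// exprS -mulrA; apply: ler_pM => //.
    exact: rnorm_ge0.
  by rewrite le_max lexx orbT.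
have iterD n x y : iter n S (x + y) = iter n S x + iter n S y.
  by elim: n => // n IH; rewrite !iterS IH linearD.
have iterZ n a x : iter n S (a *: x) = a *: iter n S x.
  by elim: n => // n IH; rewrite !iterS IH linearZ.
exists (fun n => psi (iter n S (S v))), (fun n w => psi (iter n S (Sw w v))),
  (P * (2 * M * rnorm v)), q; split => //.
- by rewrite !mulr_ge0// rnorm_ge0.
- by rewrite le_max lexx.
- move=> n w wr; rewrite {1}(resolventE w v wr) iterD iterZ functionalD functionalZ.
  by rewrite iterSr.
move=> n w wr; rewrite (le_trans (psiP _))// -mulrA ler_wpM2l//.
rewrite (le_trans (iterM n _))// mulrC ler_wpM2r ?SwM// exprn_ge0//.
by rewrite le_max ler01.
Qed.

(** Near a point where the index is zero, the shifts of [f] are invertible where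
    an analytic determinant does not vanish. *)
Lemma index_zero_dichotomy (V : completeNormedModType C) (D : set V) (f : V -> V) :
  linear_on D f -> index_zero D f ->
  (exists2 e : R, 0 < e & forall w : C, rnorm w < e -> ~ invertible_on D (op_shift f w)) \/
  (exists2 e : R, 0 < e & forall w : C, 0 < rnorm w < e -> invertible_on D (op_shift f w)).
Proof.
move=> lf [n [psi [u [bpsi [S bS invS]]]]].
pose g x := f x + finite_rank psi u x.
have lg : linear_on D g by exact: linear_on_add.
have [M M0 SM] := bounded_cst_gt0 bS.
pose r := (2 * M)^-1; have r0 : 0 < r by rewrite invr_gt0 mulr_gt0.
have [Sw SwP] : {Sw : C -> {linear V -> V} & forall w : C, rnorm w < r ->
    (forall y, rnorm (Sw w y) <= 2 * M * rnorm y) /\ is_inverse D (op_shift g w) (Sw w)}.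
  apply: (@choice _ _ (fun (w : C) (T : {linear V -> V}) => rnorm w < r -> (forall y, rnorm (T y) <=
    2 * M * rnorm y) /\ is_inverse D (op_shift g w) T)) => w.
  have [wr|nwr] := pselect (rnorm w < r); last by exists S.
  have wM : rnorm w * M <= 2^-1.
    by move: wr; rewrite /r invfM -ltr_pdivrMr ?invr_gt0// invrK => /ltW.
  by have [T TM invT] := inverse_shift lg invS (ltW M0) SM wM; exists T.
pose d w := \det (rank_mx (Sw w) psi (fun l => - u l)).
have shiftE w : (fun x => op_shift g w x + finite_rank psi (fun l => - u l) x) = op_shift f w.
  by apply/funext => x; rewrite finite_rank_opp /op_shift /g addrAC addrK.
have ad : analytic r d.
  apply: analytic_det => // a b.
  rewrite (_ : (fun w => _) = fun w => (1%:M a b : C) + psi b (Sw w (- u a))).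
    apply: analyticD => //; first exact: analytic_cst.
    apply: (@analytic_resolvent V D g S Sw r M (psi b) (- u a) invS) => //.
      exact: ltW.
      by move=> w /SwP[].
    by move=> w /SwP[].
  by apply/funext => w; rewrite !mxE.
have [[e e0 de]|[e e0 de]] := analytic_zeros r0 ad; [left|right];
  exists (Num.min e r) => [|w]; rewrite ?lt_min ?e0 ?r0//.
  move=> /andP[we wr] [T _ invT].
  have [TM invSw] := SwP w wr.
  have [x [Dx x0]] := rank_mx_not_injective invSw (de w we).
  rewrite (congr1 (@^~ x) (shiftE w)) => fx0.
  by move/eqP: x0; apply; exact: is_inverse_inj invT Dx fx0.
move=> /and3P[w0 we wr]; have [TM invSw] := SwP w wr.
rewrite -shiftE; apply: (rank_mx_invertible (linear_on_shift w lg) invSw) => //.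
  by apply/bounded_opP; exists (2 * M) => //; rewrite mulr_ge0// ltW.
by apply: de; rewrite w0.
Qed.

End Germs.

(** * Isolation of spectral points *)

Section Spectrum.
Context {R : realType}.
Local Notation C := R[i].
Local Notation functional V := {linear V -> C}.

Lemma resolvent_setP (X : normedModType C) (T : operator X X) z :
  resolvent_set T z <-> invertible_on (op_dom T) (op_shift T z).
Proof. by split=> [[S [bS SD SK]]|[S bS [SD SK]]]; exists S. Qed.

Lemma not_spectrumP (X : normedModType C) (T : operator X X) z :
  ~ spectrum T z <-> invertible_on (op_dom T) (op_shift T z).
Proof.
rewrite -resolvent_setP; split; first exact: contrapT.
by move=> rz; apply.
Qed.

Lemma linear_on_operator (V W : normedModType C) (T : operator V W) :
  linear_on (op_dom T) T.
Proof.
split; last exact: op_linear.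
by split; [exact: op_dom0|exact: op_domP].
Qed.

Lemma closed_on_operator (V W : normedModType C) (T : operator V W) :
  closed_operator T -> closed_on (op_dom T) T.
Proof.
move=> cT u x y Du ux Tuy.
suff : graph T (x, y) by case=> /= Dx ->.
apply: cT => B [[P Q] /= [Px Qy] PQB].
have [n [Pn Qn]] : exists n, P (u n) /\ Q (T (u n)).
  have : \forall n \near \oo, P (u n) /\ Q (T (u n)).
    by apply: filterI; [exact: ux|exact: Tuy].
  by move=> [N _ /(_ N (leqnn N))]; exists N.
by exists (u n, T (u n)); split; [split => //; exact: Du|exact: PQB].
Qed.

Lemma closed_on_shift (V : normedModType C) (D : set V) (f : V -> V) z :
  closed_on D f -> closed_on D (op_shift f z).
Proof.
move=> cf; have [K KE Kle] := scale_linear V (- z).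
suff <- : (fun x => f x + K x) = op_shift f z.
  apply: closed_on_add => //; apply/bounded_opP.
  by exists (rnorm (- z)); first exact: rnorm_ge0.
by apply/funext => x; rewrite KE scaleNr.
Qed.

Lemma span_of_gen (V : lmodType C) n (v : 'I_n -> V) l : span_of v (v l).
Proof.
exists (fun k => (k == l)%:R); rewrite (bigD1 l)//= eqxx scale1r big1 ?addr0// => k kl.
by rewrite (negbTE kl) scale0r.
Qed.

(** Off [essential_spectrum1] the range is closed, and the kernel or the cokernel
    has finite dimension; these are the two preceding inductions. *)
Lemma index_zero_closure (X : completeNormedModType C) (A : operator X X) z :
  closed_operator A -> ~ essential_spectrum1 A z ->
  closure [set z' | index_zero (op_dom A) (op_shift A z')] z ->
  index_zero (op_dom A) (op_shift A z).
Proof.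
move=> cA nz clz; have [sz|/not_spectrumP inv] := pselect (spectrum A z); last first.
  exact: index_zero_invertible.
have lA := linear_on_shift z (linear_on_operator A).
have cfA := closed_on_shift (z := z) (closed_on_operator cA).
have clA : closed (range_shift A z).
  by apply: contrapT => h; apply: nz; split => //; left.
have lim : limit_of_index_zero (op_dom A) (op_shift A z).
  move=> e e0; have [z' iz' zz'] := (rclosureP _ _).1 clz e e0.
  by exists (z' - z); rewrite ?shiftD ?(addrC z) ?subrK// rnormBC.
have [[n [v [_ kerE]]]|nker] := pselect (finite_dim (ker_shift A z)).
  apply: (index_zero_limit_kernel (b := v)) => // [l|x Dx fx0].
    have : ker_shift A z (v l) by rewrite kerE; exact: span_of_gen.
    by [].
  by rewrite -kerE.
have [[n [v codim]]|ncoker] := pselect (finite_codim (range_shift A z)); last first.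
  by exfalso; apply: nz; split => //; right.
apply: (index_zero_limit_cokernel (b := v)) => // y.
by have [u [c ->] Yu] := codim y; exists c.
Qed.

(** The way in which the component enters: once for the index and once for the
    isolation of spectral points. *)
Lemma connected_spread (T : topologicalType) (U P : set T) :
  connected U -> open P -> (forall z, U z -> closure P z -> P z) ->
  (exists2 z, U z & P z) -> U `<=` P.
Proof.
move=> cU oP clP [z0 Uz0 Pz0] z Uz.
suff /(congr1 (@^~ z)) : U `&` P = U by rewrite /setI /= => H; move: Uz; rewrite -{1}H; case.
apply: cU; first by exists z0.
  by exists P.
exists (closure P); first exact: closed_closure.
apply/seteqP; split=> x [Ux Px]; split => //; first exact: subset_closure.
exact: clP.
Qed.

Lemma is_subspace_span (V : normedModType C) n (v : 'I_n -> V) :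
  is_subspace (span_of v).
Proof.
split; first by rewrite -(comb0 v); exact: comb_span.
by move=> a x y /span_comb[c ->] /span_comb[d ->]; rewrite -combZ -linearD; exact: comb_span.
Qed.

(** Points around which the shifts of [f] become invertible: [index_zero] makes
    their set closed in [U], so connectedness propagates invertibility at one
    point to isolation of all spectral points. *)
Lemma isolated_singularities (X : completeNormedModType C) (D : set X)
    (f : X -> X) (U : set C) :
  linear_on D f -> connected U ->
  (forall z, U z -> index_zero D (op_shift f z)) ->
  (exists2 z, U z & invertible_on D (op_shift f z)) ->
  forall z, U z -> exists2 e : R, 0 < e &
    forall w, 0 < rnorm w < e -> invertible_on D (op_shift f (z + w)).
Proof.
move=> lf cU iz [z0 Uz0 inv0].
pose P z := exists2 e : R, 0 < e &
    forall w : C, 0 < rnorm w < e -> invertible_on D (op_shift f (z + w)).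
have P_of_inv z : invertible_on D (op_shift f z) -> P z.
  move=> inv; have [e e0 He] := invertible_near (linear_on_shift z lf) inv.
  by exists e => // w /andP[_ we]; rewrite -shiftD; exact: He.
apply: (@connected_spread _ U P) => //; last by exists z0 => //; exact: P_of_inv.
  rewrite openE => z [e e0 He]; apply/rnbhsP; exists e => // z' zz'.
  have [->|z'z] := eqVneq z' z; first by exists e.
  apply: P_of_inv; have := He (z' - z).
  by rewrite addrCA subrr addr0; apply; rewrite rnorm_gt0 subr_eq0 z'z rnormBC.
move=> z Uz clPz.
have [[e e0 ninv]|[e e0 inv]] := index_zero_dichotomy (linear_on_shift z lf) (iz z Uz).
  exfalso; have [y [d d0 Hd] zy] := (rclosureP _ _).1 clPz e e0.
  pose t := Num.min (d / 2) ((e - rnorm (z - y)) / 2).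
  have t0 : 0 < t by rewrite lt_min !divr_gt0// subr_gt0.
  have td : t < d by rewrite gt_min ltr_pdivrMr// ltr_pMr// ltr1n.
  have te : t < e - rnorm (z - y).
    by rewrite gt_min; apply/orP; right; rewrite ltr_pdivrMr// ltr_pMr ?ltr1n// subr_gt0.
  apply: (ninv (y - z + t%:C)).
    rewrite (le_lt_trans (ler_rnormD _ _))// rnormR gtr0_norm// rnormBC.
    by move: te; lra.
  rewrite shiftD addrA (addrC z) subrK; apply: Hd.
  by rewrite rnormR gtr0_norm// t0.
by exists e => // w we; rewrite -shiftD; exact: inv.
Qed.

(** The Fredholm property of [T - z] is read off the matrix of its finite-rank
    difference with the invertible [g - z]. *)
Lemma discrete_spectrum_finite_rank (X : completeNormedModType C)
    (T : operator X X) (g : X -> X) (z : C) n (psi : 'I_n -> functional X)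
    (w : 'I_n -> X) :
  invertible_on (op_dom T) (op_shift g z) ->
  (forall l, bounded_op (psi l)) -> (forall x, T x = g x + finite_rank psi w x) ->
  spectrum T z ->
  (exists2 e : R, 0 < e & forall w, 0 < rnorm w < e ->
     invertible_on (op_dom T) (op_shift T (z + w))) ->
  discrete_spectrum T z.
Proof.
move=> [S bS invS] bpsi TE sz [e e0 He].
have TzE x : T x - z *: x = op_shift g z x + finite_rank psi w x.
  by rewrite TE /op_shift addrAC.
split.
  split; first exact/mem_set.
  exists (ball z e%:C); first by apply: nbhsx_ballx; rewrite ltcR.
  apply/seteqP; split=> [z' [/ltcR_ball zz' sz']|_ ->]; last first.
    by split => //; apply: ballxx; rewrite ltcR.
  apply/eqP; apply: contrapT => /negP z'z.
  suff : ~ spectrum T z' by [].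
  apply/not_spectrumP; have := He (z' - z).
  by rewrite addrCA subrr addr0; apply; rewrite rnorm_gt0 subr_eq0 z'z rnormBC.
have kerE : ker_shift T z = [set x | op_dom T x /\ op_shift g z x + finite_rank psi w x = 0].
  apply/seteqP; split=> x /= [Dx h]; split => //; first by rewrite -TzE.
  by rewrite TzE.
have ranE : range_shift T z = [set op_shift g z x + finite_rank psi w x | x in op_dom T].
  by apply/seteqP; split=> _ [x Dx <-]; exists x.
split; rewrite ?kerE ?ranE.
- exact: closed_range_finite_rank invS bS bpsi.
- exact: finite_dim_kernel_finite_rank invS.
- exact: finite_codim_finite_rank invS.
Qed.

End Spectrum.

(** * Small relatively bounded perturbations *)

Section SmallPerturbations.
Context {R : realType}.
Local Notation C := R[i].

(** The domain [D] and the norm [N] are arbitrary because the lemma serves both for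
    operator norms and for norms relative to a graph norm. *)
Lemma opnorm_on_le (V W : normedModType C) (D : set V) (N : V -> R) (f : V -> W)
    (M : R) :
  (forall (t : R) x, 0 <= t -> D x ->
     [/\ D (t%:C *: x), N (t%:C *: x) = t * N x & f (t%:C *: x) = t%:C *: f x]) ->
  (forall x, 0 <= N x) -> (forall x, D x -> N x = 0 -> f x = 0) ->
  (opnorm_on D N f <= M%:E)%E -> forall x, D x -> rnorm (f x) <= M * N x.
Proof.
move=> hom N0 Nsep fM x Dx.
have [Nx0|Nx0] := eqVneq (N x) 0; first by rewrite (Nsep x Dx Nx0) rnorm0 Nx0 mulr0.
have Nx : 0 < N x by rewrite lt_def Nx0 N0.
have Nxi : 0 <= (N x)^-1 by rewrite invr_ge0.
have [Dtx Ntx ftx] := hom (N x)^-1 x Nxi Dx.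
rewrite -ler_pdivrMr// mulrC -lee_fin; apply: le_trans fM; apply: ereal_sup_ubound.
exists ((N x)^-1%:C *: x); first by split => //=; rewrite Ntx mulVf.
by rewrite ftx rnormZ rnormR ger0_norm.
Qed.

Lemma limn_esup_bounded (u : (\bar R)^nat) : limn_esup u != +oo%E ->
  exists (M : R) N, forall n, (N <= n)%N -> (u n <= M%:E)%E.
Proof.
rewrite -ltey limn_esup_lim (cvg_lim _ (@cvg_esups_inf _ u))//.
move=> /ereal_inf_lt[_ [N _ <-]] uN.
have uN' n : (N <= n)%N -> (u n <= esups u N)%E.
  by move=> Nn; apply: ereal_sup_ubound; exists n.
move: uN uN'; case: (esups u N) => [M|//|] _ uN; first by exists M, N.
by exists 0, N => n Nn; rewrite (le_trans (uN n Nn))// leNye.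
Qed.

Lemma resolventE (X : normedModType C) (T : operator X X) z S y :
  is_inverse (op_dom T) (op_shift T z) S -> resolvent T z y = S y.
Proof.
move=> invS; have [Dy Sy] := invS.1 y.
rewrite /resolvent; case: xgetP => [x _ [Dx fx]|/(_ (S y))]; last by case.
by rewrite -(invS.2 x Dx) -[in RHS]fx.
Qed.

Lemma extended_graphP (X F : normedModType C) (j : {linear X -> F})
    (A : operator X X) (P : option (predual F)) (Ahat : operator F F) x :
  extension_assumption j A P Ahat -> op_dom A x ->
  op_dom Ahat (j x) /\ Ahat (j x) = j (A x).
Proof.
move=> [gE _] Dx; have : graph Ahat (j x, j (A x)).
  by rewrite gE; apply: subset_closure; exists x.
by case=> /= D ->.
Qed.

(** Only the product [B j (A - z)^-1 i], an operator in [E], has to be small: with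
    [T := B j (A - z)^-1], the operator [1 + i T] in [X] is invertible as soon as
    [1 + T i] is, the inverse being [1 - i (1 + T i)^-1 T]. *)
Lemma small_sandwich (E : completeNormedModType C) (X F : normedModType C)
    (i : {linear E -> X}) (j : {linear X -> F}) (A : operator X X)
    (B : operator F E) (z : C) (S : {linear X -> X}) (M : R) :
  bounded_op i -> bounded_op S ->
  is_inverse (op_dom A) (op_shift A z) S ->
  (forall x, op_dom A x -> op_dom B (j x)) ->
  0 <= M -> (forall y, rnorm (B (j (S y))) <= M * rnorm y) ->
  (forall e, rnorm (B (j (S (i e)))) <= 2^-1 * rnorm e) ->
  ~ spectrum (op_add A (op_sandwich i B j)) z.
Proof.
move=> /bounded_opP[Mi Mi0 iM] /bounded_opP[MS MS0 SM] invS domB M0 TM Tsmall.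
have SD y : op_dom A (S y) by have [] := invS.1 y.
have fS y : A (S y) - z *: S y = y by have [] := invS.1 y.
have [|T TE] := @linear_of R X E (fun y => B (j (S y))).
  by move=> a x y; rewrite !linearP op_linear//; exact: domB.
have [|K KE] := @linear_of R E E (fun e => T (i e)); first by move=> a x y; rewrite !linearP.
have [|Id IdE] := @linear_of R E E id; first by [].
have lid : linear_on [set: E] id by [].
have invI : is_inverse [set: E] id Id by split=> [y|x _]; rewrite IdE.
have half0 : 0 <= 2^-1 :> R by rewrite invr_ge0.
have IdM y : rnorm (Id y) <= 1 * rnorm y by rewrite IdE mul1r.
have KM e : rnorm (K e) <= 2^-1 * rnorm e by rewrite KE TE.
have half1 : 2^-1 * 1 <= 2^-1 :> R by rewrite mulr1.
have [L LM [LD LK]] := invertible_add_small lid invI IdM ler01 half0 KM half1.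
apply/not_spectrumP.
have domE : op_dom (op_add A (op_sandwich i B j)) = op_dom A.
  by apply/seteqP; split=> x /=; [case|move=> Dx; split => //=; exact: domB].
have lf := linear_on_shift z (linear_on_operator (op_add A (op_sandwich i B j))).
have [||G GM invG] := @invertible_of_bijective _ _ _ _ _ lf
  (MS * (1 + Mi * (2 * 1 * M))).
- move=> y; have [_ LTy] := LD (T y).
  have LTy' : B (j (S (y - i (L (T y))))) = L (T y).
    by rewrite -TE linearB -KE; apply/eqP; rewrite subr_eq LTy.
  exists (S (y - i (L (T y)))); split; first by rewrite domE.
    rewrite /op_shift /= LTy' addrAC fS subrK//.
  rewrite (le_trans (SM _))// -mulrA ler_wpM2l// mulrDl mul1r.
  rewrite (le_trans (ler_rnormB _ _))// lerD2l (le_trans (iM _))// -!mulrA ler_wpM2l//.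
  by rewrite (le_trans (LM _))// mulr1 mul1r ler_pM2l// TE TM.
- rewrite domE => x Dx /= fx.
  have fx' : A x - z *: x = - i (B (j x)).
    by move/eqP: fx; rewrite /op_shift /= addrAC addr_eq0 => /eqP.
  have xE : x = - S (i (B (j x))) by rewrite -linearN -fx' -/(op_shift A z x) invS.2.
  suff B0 : B (j x) = 0 by rewrite xE B0 linear0 linear0 oppr0.
  have : B (j x) + K (B (j x)) = 0.
    rewrite {1}xE linearN -scaleN1r (linear_onZ (linear_on_operator B)); last exact: domB.
    by rewrite scaleN1r KE TE addNr.
  by move=> h; rewrite -(LK (B (j x)) I) h linear0.
exists G => //; apply/bounded_opP.
exists (MS * (1 + Mi * (2 * 1 * M))) => //.
by rewrite mulr_ge0// addr_ge0// !mulr_ge0.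
Qed.

(** Otherwise [j (A - z)^-1 i] is bounded for all large [n], and so is its
    composition with [Ahat], which is [j i + z j (A - z)^-1 i]; the perturbations,
    small relative to [Ahat], then satisfy the hypothesis of [small_sandwich]. *)
Lemma blow_up (E X F : completeNormedModType C)
    (i : {linear E -> X}) (j : {linear X -> F})
    (i_embedding : continuous_embedding i)
    (j_embedding : continuous_embedding j)
    (P : option (predual F)) (A : operator X X)
    (Ahat : operator F F) (A_ext : extension_assumption j A P Ahat)
    (Omega : set C) (Omega_resolvent : Omega `<=` ~` spectrum A) (z0 : C)
    (B : nat -> operator F E) (z : nat -> C) :
  (forall n, relatively_bounded Ahat (B n)) ->
  relative_norm Ahat (B n) @[n --> \oo] --> 0%E ->
  (forall n, spectrum (op_add A (op_sandwich i (B n) j)) (z n) /\ Omega (z n)) ->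
  z n @[n --> \oo] --> z0 ->
  limn_esup (fun n => opnorm (fun e => j (resolvent A (z n) (i e)))) = +oo%E.
Proof.
move=> bB B0 zB zz0; have [_ bi] := i_embedding; have [_ bj] := j_embedding.
have /bounded_opP[Mi Mi0 iM] := bi; have /bounded_opP[Mj Mj0 jM] := bj.
apply/eqP/negPn/negP => /limn_esup_bounded[M' [N HM]].
pose M := Num.max M' 0; have M0 : 0 <= M by rewrite le_max lexx orbT.
(* c bounds the graph norm of j (A - z n)^-1 i for all large n *)
pose c := M + (Mj * Mi + (rnorm z0 + 1) * M).
have c0 : 0 <= c by rewrite !addr_ge0// mulr_ge0// addr_ge0// rnorm_ge0.
have [n [nN zn bn]] : exists n, [/\ (N <= n)%N, rnorm (z n) <= rnorm z0 + 1 &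
    (relative_norm Ahat (B n) <= ((2 * (c + 1))^-1)%:E)%E].
  have e0 : 0 < (2 * (c + 1))^-1 by rewrite invr_gt0 mulr_gt0// ltr_wpDl.
  have [N1 _ H1] := (rcvgP _ _).1 zz0 1 ltr01.
  have [N2 _ H2] : \forall n \near \oo, (relative_norm Ahat (B n) < ((2 * (c + 1))^-1)%:E)%E.
    by apply: (B0 [set x : \bar R | (x < ((2 * (c + 1))^-1)%:E)%E]);
      apply: open_nbhs_nbhs; split; [exact: open_ereal_lt_ereal|rewrite /= lte_fin].
  exists (maxn N (maxn N1 N2)); split; first exact: leq_maxl.
    have := H1 (maxn N (maxn N1 N2)); rewrite /= !leq_max leqnn !orbT => /(_ isT) h.
    rewrite -[z _](subrK z0) (le_trans (ler_rnormD _ _))// addrC lerD2l.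
    by rewrite rnormBC ltW.
  by apply/ltW/H2; rewrite /= !leq_max leqnn !orbT.
have [sz Oz] := zB n.
have [S bS invS] := (not_spectrumP _ _).1 (Omega_resolvent _ Oz).
have SD y : op_dom A (S y) by have [] := invS.1 y.
have fS y : A (S y) = y + z n *: S y.
  by have [_] := invS.1 y; rewrite /op_shift => /eqP; rewrite subr_eq => /eqP.
have [domB _] := bB n.
have Bg : forall x, op_dom Ahat x -> rnorm (B n x) <= (2 * (c + 1))^-1 * graph_norm Ahat x.
  have lA := linear_on_operator Ahat; have lB := linear_on_operator (B n).
  apply: opnorm_on_le bn.
  - move=> t x t0 Dx; split; first exact: is_subspaceZ lA.1 Dx.
      by rewrite /graph_norm (linear_onZ lA)// !rnormZ rnormR ger0_norm// mulrDr.
    by rewrite (linear_onZ lB)//; exact: domB.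
  - by move=> x; rewrite addr_ge0 ?rnorm_ge0.
  - move=> x Dx /eqP; rewrite paddr_eq0 ?rnorm_ge0// rnorm_eq0 => /andP[/eqP-> _].
    exact: linear_on0 lB.
have Ahat_jS y : op_dom Ahat (j (S y)) /\ Ahat (j (S y)) = j y + z n *: j (S y).
  by have [D ->] := extended_graphP A_ext (SD y); rewrite fS linearD linearZ.
have RM e : rnorm (j (S (i e))) <= M * rnorm e.
  have [R' RE] : exists R' : {linear E -> F}, forall e, R' e = j (S (i e)).
    by apply: linear_of => a x y; rewrite !linearP.
  rewrite -RE; apply: (@opnorm_on_le E F setT (@rnorm R E) R') => //.
  - by move=> t x t0 _; rewrite rnormZ rnormR ger0_norm// linearZ.
  - by move=> x; exact: rnorm_ge0.
  - by move=> x _ /eqP; rewrite rnorm_eq0 => /eqP ->; rewrite linear0.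
  apply: le_trans (le_trans (HM n nN) _); last by rewrite lee_fin le_max lexx.
  rewrite le_eqVlt; apply/orP; left; apply/eqP.
  rewrite /opnorm; congr (opnorm_on _ _ _); apply/funext => x.
  by rewrite RE (resolventE _ invS).
move: sz; have /bounded_opP[MS MS0 SM] := bS.
pose b := (2 * (c + 1))^-1; have b0 : 0 <= b by rewrite invr_ge0 mulr_ge0// addr_ge0.
apply: (small_sandwich (S := S) (M := b * (Mj * MS + (Mj + rnorm (z n) * (Mj * MS)))))
  => //.
- by move=> x Dx; apply/domB; have [] := extended_graphP A_ext Dx.
- by rewrite mulr_ge0// !addr_ge0// !mulr_ge0// rnorm_ge0.
- move=> y; have [Dy Ay] := Ahat_jS y; rewrite (le_trans (Bg _ Dy))// -mulrA ler_wpM2l//.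
  have jS : rnorm (j (S y)) <= Mj * MS * rnorm y.
    by rewrite (le_trans (jM _))// -mulrA ler_wpM2l.
  rewrite /graph_norm Ay !mulrDl; apply: lerD => //.
  rewrite (le_trans (ler_rnormD _ _))// lerD// rnormZ -[_ * _ * rnorm y]mulrA.
  by rewrite ler_wpM2l ?rnorm_ge0.
- move=> e; have [De Ae] := Ahat_jS (i e); rewrite (le_trans (Bg _ De))//.
  apply: (@le_trans _ _ (b * (c * rnorm e))); last first.
    rewrite mulrA ler_wpM2r ?rnorm_ge0// /b invfM -mulrA ger_pMr ?invr_gt0//.
    by rewrite mulrC ler_pdivrMr ?mul1r ?lerDl// ltr_wpDl.
  rewrite ler_wpM2l// /graph_norm Ae /c mulrDl; apply: lerD => //.
  rewrite (le_trans (ler_rnormD _ _))// mulrDl; apply: lerD.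
    by rewrite (le_trans (jM _))// -mulrA ler_wpM2l.
  by rewrite rnormZ -mulrA; apply: ler_pM => //; exact: rnorm_ge0.
Qed.

End SmallPerturbations.

(** * Convergence of matrices and weak-star limits *)

Section Convergence.
Context {R : realType}.
Local Notation C := R[i].

Section scalars.
Context (T : Type) (G : set_system T) {FG : Filter G}.

Lemma scalar_cvgM (f g : T -> C) (a b : C) :
  f @ G --> a -> g @ G --> b -> (fun t => f t * g t) @ G --> a * b.
Proof. exact: cvgM. Qed.

Lemma scalar_cvgD (f g : T -> C) (a b : C) :
  f @ G --> a -> g @ G --> b -> (fun t => f t + g t) @ G --> a + b.
Proof. exact: cvgD. Qed.

Lemma scalar_cvgN (f : T -> C) (a : C) : f @ G --> a -> (fun t => - f t) @ G --> - a.
Proof. exact: cvgN. Qed.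

Lemma scalar_cvg_sum (I : Type) (s : seq I) (f : I -> T -> C) (a : I -> C) :
  (forall k, f k @ G --> a k) ->
  (fun t => \sum_(k <- s) f k t) @ G --> \sum_(k <- s) a k.
Proof.
move=> fa; elim: s => [|k s IH].
  by rewrite big_nil; under eq_fun do rewrite big_nil; exact: cvg_cst.
rewrite big_cons (_ : (fun t => _) = fun t => f k t + \sum_(j <- s) f j t).
  exact: scalar_cvgD (fa k) IH.
by apply/funext => t; rewrite big_cons.
Qed.

Lemma scalar_cvg_prod (I : Type) (s : seq I) (f : I -> T -> C) (a : I -> C) :
  (forall k, f k @ G --> a k) ->
  (fun t => \prod_(k <- s) f k t) @ G --> \prod_(k <- s) a k.
Proof.
move=> fa; elim: s => [|k s IH].
  by rewrite big_nil; under eq_fun do rewrite big_nil; exact: cvg_cst.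
rewrite big_cons (_ : (fun t => _) = fun t => f k t * \prod_(j <- s) f j t).
  exact: scalar_cvgM (fa k) IH.
by apply/funext => t; rewrite big_cons.
Qed.

Lemma cvg_det n (M : T -> 'M[C]_n) (N : 'M[C]_n) :
  (forall a b, (fun t => M t a b) @ G --> N a b) -> (fun t => \det (M t)) @ G --> \det N.
Proof.
move=> MN; apply: scalar_cvg_sum => s; apply: scalar_cvgM; first exact: cvg_cst.
exact: scalar_cvg_prod.
Qed.

Lemma scalar_cvgV (f : T -> C) (a : C) : a != 0 -> f @ G --> a ->
  (fun t => (f t)^-1) @ G --> a^-1.
Proof. by move=> a0; exact: cvgV. Qed.

Lemma cvg_invmx n (M : T -> 'M[C]_n) (N : 'M[C]_n) :
  \det N != 0 -> (\forall t \near G, \det (M t) != 0) ->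
  (forall a b, (fun t => M t a b) @ G --> N a b) ->
  forall a b, (fun t => invmx (M t) a b) @ G --> invmx N a b.
Proof.
move=> N0 M0 MN a b.
have uE (Q : 'M[C]_n) : \det Q != 0 -> invmx Q a b = (\det Q)^-1 * cofactor Q b a.
  by move=> Q0; rewrite /invmx unitmxE unitfE Q0 !mxE.
rewrite uE//; have : (fun t => (\det (M t))^-1 * cofactor (M t) b a) @ G -->
    (\det N)^-1 * cofactor N b a.
  apply: scalar_cvgM; first by apply: scalar_cvgV => //; exact: cvg_det.
  apply: scalar_cvgM; first exact: cvg_cst.
  apply: cvg_det => c d; rewrite !mxE; under eq_fun do rewrite !mxE.
  exact: MN.
apply: cvg_trans; apply: near_eq_cvg.
by apply: filterS M0 => t Mt0; rewrite uE.
Qed.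

End scalars.

Lemma initial_topology_cvg (S : choiceType) (T : topologicalType) (f : S -> T)
    (G : set_system S) {FG : Filter G} (l : S) :
  (G --> (l : initial_topology f)) <-> f @ G --> f l.
Proof.
split=> [Gl|fl A].
  by apply: cvg_trans (@initial_continuous _ _ f l) => A; exact: Gl.
rewrite nbhsE => -[B [[U oU <-] Ul] BA].
by apply: filterS BA _; apply: fl; exact: open_nbhs_nbhs.
Qed.

(** Both the weak and the weak-star topology are of this kind. *)
Lemma initial_cvgP (S : choiceType) (I : Type) (ev : S -> I -> C) (G : set_system S)
    {FG : Filter G} (l : S) :
  (G --> (l : initial_topology (ev : S -> {ptws I -> C}))) <->
  (forall t, (ev^~ t) @ G --> ev l t).
Proof.
rewrite initial_topology_cvg; rewrite cvg_sup; split=> H t.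
  by have /initial_topology_cvg := H t.
exact/initial_topology_cvg/H.
Qed.

Lemma compact_unit_box :
  compact [set c : C | `|complex.Re c| <= 1 /\ `|complex.Im c| <= 1].
Proof.
have -> : [set c : C | `|complex.Re c| <= 1 /\ `|complex.Im c| <= 1] =
  [set (ab.1 +i* ab.2 : C) | ab in `[-1, 1]%classic `*` `[-1, 1]%classic].
  apply/seteqP; split=> [[a b] /= [a1 b1]|_ [[a b] /= [a1 b1] <-] /=].
    by exists (a, b) => //=; rewrite !in_itv /= -!ler_norml.
  by move: a1 b1; rewrite !in_itv /= -!ler_norml.
apply: continuous_compact; last by apply: compact_setX; exact: segment_compact.
apply: continuous_subspaceT => -[a b]; apply/rcvgP => e e0.
have e20 : 0 < e / 2 by rewrite divr_gt0.
exists (ball a (e / 2), ball b (e / 2)) => /=.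
  by split; exact: nbhsx_ballx.
move=> [a' b'] [/= aa' bb'].
rewrite (_ : _ - _ = (a - a')%:C + 'i * (b - b')%:C); last first.
  by apply/eqP; rewrite eq_complex /=; apply/andP; split; apply/eqP; ring.
rewrite (le_lt_trans (ler_rnormD _ _))// rnormM.
rewrite rnormi mul1r !rnormR [ltRHS](splitr e); apply: ltrD.
  by move: aa'; rewrite -ball_normE.
by move: bb'; rewrite -ball_normE.
Qed.

Lemma le_Re_rnorm (c : C) : `|complex.Re c| <= rnorm c.
Proof. by rewrite -lecR -rnormE; exact: normc_ge_Re. Qed.

Lemma le_Im_rnorm (c : C) : `|complex.Im c| <= rnorm c.
Proof.
suff -> : rnorm c = rnorm ('i * c).
  by have := le_Re_rnorm ('i * c); case: c => a b /=; rewrite mul0r mul1r sub0r normrN.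
by rewrite rnormM rnormi mul1r.
Qed.

Lemma complex_cauchy (T : Type) (G : set_system T) {FG : ProperFilter G} (f : T -> C) :
  (forall e : R, 0 < e -> \forall p \near filter_prod G G, rnorm (f p.1 - f p.2) < e) ->
  exists l : C, f @ G --> l.
Proof.
move=> cf.
have part (h : C -> R) : (forall c, `|h c| <= rnorm c) ->
    (forall c d, h (c - d) = h c - h d) -> exists l : R, (h \o f) @ G --> l.
  move=> hle hB; apply/cvg_ex/cauchy_cvgP/cauchy_ballP => e e0; near_simpl.
  apply: filterS (cf e e0) => -[s t] /= st.
  by rewrite -ball_normE /ball_ /= -hB; exact: le_lt_trans (hle _) st.
have [a fa] := part (@complex.Re R) le_Re_rnorm (fun c d => raddfB _ c d).
have [b fb] := part (@complex.Im R) le_Im_rnorm (fun c d => raddfB _ c d).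
exists (a +i* b); apply/rcvgP => e e0.
have e20 : 0 < e / 2 by rewrite divr_gt0.
have /cvgrPdist_lt/(_ _ e20) := fa; have /cvgrPdist_lt/(_ _ e20) := fb.
apply: filterS2 => t /=; case: (f t) => a' b' /= bb' aa'.
rewrite (_ : _ - _ = (a - a')%:C + 'i * (b - b')%:C); last first.
  by apply/eqP; rewrite eq_complex /=; apply/andP; split; apply/eqP; ring.
rewrite (le_lt_trans (ler_rnormD _ _))// rnormM.
by rewrite rnormi mul1r !rnormR [ltRHS](splitr e); apply: ltrD.
Qed.

Section weakstar.
Context {F : normedModType C} (P : predual F) (Ahat : operator F F).
Hypothesis cA : weakstar_closed_graph P Ahat.

Lemma weakstar_cvgP (T : Type) (G : set_system T) {FG : Filter G} (f : T -> F) (l : F) :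
  ((f : T -> weakstar P) @ G --> (l : weakstar P)) <->
  forall g, (fun t => predual_ev P (f t) g : C) @ G --> (predual_ev P l g : C).
Proof. exact: (@initial_cvgP F P (fun y g => predual_ev P y g) (f @ G)). Qed.

Lemma weakstar_closed_limit (T : Type) (G : set_system T) {FG : ProperFilter G}
    (x y : T -> F) (lx ly : F) :
  (\forall t \near G, op_dom Ahat (x t) /\ Ahat (x t) = y t) ->
  (forall g, (fun t => predual_ev P (x t) g : C) @ G --> (predual_ev P lx g : C)) ->
  (forall g, (fun t => predual_ev P (y t) g : C) @ G --> (predual_ev P ly g : C)) ->
  op_dom Ahat lx /\ Ahat lx = ly.
Proof.
move=> Gxy xl yl.
have cx : (x : T -> weakstar P) @ G --> (lx : weakstar P).
  exact: ((weakstar_cvgP x lx).2 xl).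
have cy : (y : T -> weakstar P) @ G --> (ly : weakstar P).
  exact: ((weakstar_cvgP y ly).2 yl).
suff : graph Ahat (lx, ly) by case=> /= Dx ->.
apply: cA => B [[U V] /= [Ux Vy] UVB].
have GU : \forall t \near G, U (x t) by exact: (cx _ Ux).
have GV : \forall t \near G, V (y t) by exact: (cy _ Vy).
have [t [[Dx Axy] [Uxt Vyt]]] := filter_ex (filterI Gxy (filterI GU GV)).
by exists (x t, y t); split; [split|exact: UVB].
Qed.

Lemma predual_functional g : exists2 th : {linear F -> C}, bounded_op th &
  forall y, th y = predual_ev P y g :> C.
Proof.
have [|th thE] := @linear_of R F C (fun y => predual_ev P y g).
  by move=> a x y; exact: predual_evP.
exists th => //; apply/bounded_opP; exists (rnorm g) => [|y]; first exact: rnorm_ge0.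
rewrite thE mulrC; apply: (@opnorm_on_le R P C setT (@rnorm R P) (predual_ev P y)) => //.
- by move=> t x t0 _; rewrite rnormZ rnormR ger0_norm// linearZ.
- by move=> x; exact: rnorm_ge0.
- by move=> x _ /eqP; rewrite rnorm_eq0 => /eqP ->; rewrite linear0.
by rewrite -(predual_isometry P) lexx.
Qed.

(** In the weak-star topology the graph is closed and meets [0 * span v] only in
    the origin; the finite-dimensional component of a pair that tends to 0 then
    tends to 0.  Otherwise, after normalization, a limit point of the components
    would give an element [(0, - comb v b)] of the graph with [b <> 0]. *)
Lemma weakstar_component_cvg0 r (v : 'I_r -> F) (T : Type) (G : set_system T)
    {FG : Filter G} (x y : T -> F) (h : T -> 'rV[C]_r) :
  independent v ->
  (\forall t \near G, op_dom Ahat (x t) /\ Ahat (x t) = y t - comb v (h t)) ->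
  (forall g, (fun t => predual_ev P (x t) g : C) @ G --> (0 : C)) ->
  (forall g, (fun t => predual_ev P (y t) g : C) @ G --> (0 : C)) ->
  forall l, (fun t => h t 0 l) @ G --> (0 : C).
Proof.
move=> iv Gxy x0 y0 l0.
pose H t := \sum_l rnorm (h t 0 l).
have hH t l : rnorm (h t 0 l) <= H t.
  by rewrite /H (bigD1 l)//= lerDl sumr_ge0// => k _; exact: rnorm_ge0.
apply/rcvgP => e e0; apply: contrapT => nH.
pose G' := within [set t | e <= H t] G.
have FG' : Filter G' by exact: within_filter.
have PG' : ProperFilter G'.
  apply: Build_ProperFilter_ex => Q G'Q; apply: contrapT => nQ; apply: nH.
  have GQ : \forall t \near G, e <= H t -> Q t by exact: G'Q.
  apply: filterS GQ => t Qt; rewrite sub0r rnormN; apply: (le_lt_trans (hH t l0)).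
  by rewrite ltNge; apply/negP => /Qt Q'; apply: nQ; exists t.
have sub (f : T -> C) (c : C) : f @ G --> c -> f @ G' --> c.
  by move=> fc; apply: cvg_trans fc; apply: cvg_app; exact: cvg_within.
have G'H : \forall t \near G', e <= H t by exact: withinT.
pose u t := (H t)^-1%:C *: h t.
have u1 t : e <= H t -> \sum_l rnorm (u t 0 l) = 1.
  move=> eH; have Ht : 0 < H t by exact: lt_le_trans eH.
  under eq_bigr do rewrite mxE rnormM rnormR gtr0_norm ?invr_gt0//.
  by rewrite -mulr_sumr mulVf// gt_eqF.
pose K := [set w : 'rV[C]_r | forall l, [set c : C | `|complex.Re c| <= 1 /\
  `|complex.Im c| <= 1] (w ord0 l)].
have cK : compact K.
  exact: (@rV_compact C r (fun=> [set c : C | `|complex.Re c| <= 1 /\ `|complex.Im c| <= 1])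
    (fun=> compact_unit_box)).
have [|b [Kb clb]] := cK (u @ G') _.
  apply: filterS G'H => t eH l; have := u1 t eH; rewrite (bigD1 l)//= => ul.
  have {}ul : rnorm (u t 0 l) <= 1.
    by rewrite -ul lerDl sumr_ge0// => k _; exact: rnorm_ge0.
  by split; [exact: le_trans (le_Re_rnorm _) ul|exact: le_trans (le_Im_rnorm _) ul].
(* a finer filter along which u converges to the limit point b *)
pose G'' := filter_from [set AB : set T * set 'rV[C]_r | G' AB.1 /\ nbhs b AB.2]
  (fun AB => AB.1 `&` u @^-1` AB.2).
have FG'' : Filter G''.
  apply: filter_from_filter; first by exists (setT, setT); split; exact: filterT.
  move=> [A B] [A' B'] /= [GA bB] [GA' bB'].
  exists (A `&` A', B `&` B') => /=; first by split; exact: filterI.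
  by move=> t [[At A't] [Bt B't]].
have PG'' : ProperFilter G''.
  apply: filter_from_proper => -[A B] /= [GA bB].
  have [w [[t At uw] Bw]] := clb (u @` A) B (filterS (fun t At => ex_intro2 _ _ t At erefl) GA) bB.
  by exists t; split => //=; rewrite uw.
have sub' (f : T -> C) (c : C) : f @ G' --> c -> f @ G'' --> c.
  move=> fc A /fc GA; exists (f @^-1` A, setT); first by split => //; exact: filterT.
  by move=> t [].
have ub l : (fun t => u t 0 l) @ G'' --> b 0 l.
  have cu : u @ G'' --> b.
    by move=> A bA; exists (setT, A); [split => //; exact: filterT|move=> t []].
  by move=> A bA; exact: (cu _ (@coord_continuous C 1 r 0 l b A bA)).
have G''H : \forall t \near G'', e <= H t.
  by exists ([set t | e <= H t], setT); [split => //; exact: filterT|move=> t []].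
have scaled (f : T -> C) : f @ G --> (0 : C) ->
    (fun t => (H t)^-1%:C * f t) @ G'' --> (0 : C).
  move=> f0; apply/rcvgP => d d0.
  have /rcvgP/(_ (d * e) (mulr_gt0 d0 e0)) := sub' _ _ (sub _ _ f0).
  apply: filterS2 G''H => t eH; have Ht : 0 < H t by exact: lt_le_trans eH.
  rewrite !sub0r !rnormN rnormM rnormR gtr0_norm ?invr_gt0// => fd.
  by rewrite ltr_pdivrMl// mulrC (lt_le_trans fd)// ler_wpM2l// ltW.
have [|||_] := @weakstar_closed_limit T G'' PG'' (fun t => (H t)^-1%:C *: x t)
  (fun t => (H t)^-1%:C *: y t - comb v (u t)) 0 (- comb v b).
- have : \forall t \near G'', op_dom Ahat (x t) /\ Ahat (x t) = y t - comb v (h t).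
    exists ([set t | op_dom Ahat (x t) /\ Ahat (x t) = y t - comb v (h t)], setT).
      split; last exact: filterT.
      exact: cvg_within Gxy.
    by move=> t [].
  have lA := linear_on_operator Ahat.
  apply: filterS => t [Dx Axy]; split; first exact: is_subspaceZ lA.1 Dx.
  by rewrite (linear_onZ lA)// Axy scalerBr /u combZ.
- move=> g; have [th _ thE] := predual_functional g.
  under eq_fun do rewrite -thE functionalZ.
  rewrite -thE linear0; apply: scaled; under eq_fun do rewrite thE.
  exact: x0.
- move=> g; have [th _ thE] := predual_functional g.
  rewrite -thE (_ : (fun t => _) = fun t => (H t)^-1%:C * th (y t) +
      \sum_(l <- index_enum 'I_r) - u t 0 l * th (v l)); last first.
    apply/funext => t; rewrite -thE functionalB functionalZ functional_sum -sumrN.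
    by congr (_ + _); apply: eq_bigr => l _; rewrite mulNr.
  rewrite (_ : th (- comb v b) =
      0 + \sum_(l <- index_enum 'I_r) - b 0 l * th (v l)); last first.
    rewrite -[- comb v b]add0r functionalB linear0 functional_sum -sumrN.
    by congr (_ + _); apply: eq_bigr => l _; rewrite mulNr.
  apply: scalar_cvgD.
    by apply: scaled; under eq_fun do rewrite thE; exact: y0.
  apply: scalar_cvg_sum => l; apply: scalar_cvgM; last exact: cvg_cst.
  exact: cvgN (ub l).
rewrite (linear_on0 (linear_on_operator Ahat)) => /eqP; rewrite eq_sym oppr_eq0 => /eqP.
move=> /(independent_comb iv) b0.
have r10 : 0 < (r.+1%:R)^-1 :> R by rewrite invr_gt0 ltr0n.
have near_small : \forall t \near G'', forall l, rnorm (u t 0 l) < (r.+1%:R)^-1.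
  apply: filter_forall => l; have /rcvgP/(_ _ r10) := ub l.
  by apply: filterS => t; rewrite b0 mxE sub0r rnormN.
have [t [eH ut]] := filter_ex (filterI G''H near_small).
have := u1 t eH; apply/eqP; rewrite lt_eqF//.
apply: (@le_lt_trans _ _ (\sum_(l < r) (r.+1%:R)^-1)).
  by apply: ler_sum => l _; exact: ltW.
by rewrite sumr_const card_ord -[_ *+ r]mulr_natl ltr_pdivrMr ?ltr0n// mul1r ltr_nat.
Qed.

End weakstar.

End Convergence.

(** * Dual bases and nearly singular matrices *)

Section Bases.
Context {R : realType}.
Local Notation C := R[i].
Local Notation functional V := {linear V -> C}.

Lemma closed_span (V : normedModType C) n (v : 'I_n -> V) : closed (span_of v).
Proof.
elim: n v => [|n IH] v.
  rewrite (_ : span_of v = [set 0]); last first.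
    apply/seteqP; split=> [x [c ->]|x ->]; first by rewrite big_ord0.
    by exists (fun=> 0); rewrite big_ord0.
  exact: accessible_closed_set1 (hausdorff_accessible (@norm_hausdorff _ V)) 0.
rewrite (_ : span_of v = [set x | exists c : C,
    span_of (fun l => v (lift ord0 l)) (x - c *: v ord0)]).
  by apply: closed_add_line; [exact: is_subspace_span|exact: IH].
apply/seteqP; split=> [x [c ->]|x [c0 [c xE]]].
  exists (c ord0), (fun l => c (lift ord0 l)).
  by rewrite big_ord_recl addrC addKr.
exists (fun l => if unlift ord0 l is Some k then c k else c0).
rewrite big_ord_recl unlift_none -[LHS](subrK (c0 *: v ord0)) xE addrC.
by congr (_ + _); apply: eq_bigr => l _; rewrite liftK.
Qed.

Lemma dual_basis (V : normedModType C) n (e : 'I_n -> V) : independent e ->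
  exists phi : 'I_n -> functional V, (forall l, bounded_op (phi l)) /\
    forall k l, phi l (e k) = (k == l)%:R.
Proof.
move=> ie.
suff /choice[phi phiP] l : exists phi : functional V,
    bounded_op phi /\ forall k, phi (e k) = (k == l)%:R.
  by exists phi; split=> l; [case: (phiP l)|move=> k; case: (phiP k)].
pose v (k : 'I_n) : V := if k == l then 0 else e k.
have [|phi [bphi phiY phil]] :=
    separating_functional (is_subspace_span v) (@closed_span V n v) (m := e l).
  move=> [c elE]; pose d k := if k == l then - 1 else c k.
  suff /ie/(_ l) : \sum_k d k *: e k = 0.
    by rewrite /d eqxx => /eqP; rewrite oppr_eq0 oner_eq0.
  rewrite (bigD1 l)//= {1}/d eqxx scaleN1r elE (bigD1 l)//= /v eqxx scaler0 add0r.
  rewrite addrC -sumrB big1// => k kl.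
  by rewrite /d (negbTE kl) subrr.
exists phi; split => // k; case: eqVneq => [->//|kl].
have <- : v k = e k by rewrite /v (negbTE kl).
by apply: phiY; exact: span_of_gen.
Qed.

Lemma bounded_finite_rankP (V W : normedModType C) n (f : {linear V -> W}) :
  bounded_rank n f -> exists (psi : 'I_n -> functional V) (e : 'I_n -> W),
    [/\ independent e, forall l, bounded_op (psi l) &
        forall x, f x = finite_rank psi e x].
Proof.
move=> [bf [e [ie rangef]]]; have [phi [bphi phie]] := dual_basis ie.
exists (fun l => phi l \o f : functional V), e; split => // [l|x].
  exact: bounded_comp.
have [c fx] : span_of e (f x) by rewrite -rangef; exists x.
rewrite finite_rankE fx; apply: eq_bigr => l _ /=; rewrite fx functional_sum.
congr (_ *: _); rewrite (bigD1 l)//= phie eqxx mulr1 big1 ?addr0// => k kl.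
by rewrite phie (negbTE kl) mulr0.
Qed.

Lemma le_prod_exists (s : seq R) : (0 < size s)%N -> (forall x, x \in s -> 0 <= x) ->
  exists2 x, x \in s & x ^+ size s <= \prod_(y <- s) y.
Proof.
elim: s => // a s IH _ s0; have a0 : 0 <= a by apply: s0; rewrite mem_head.
case: s IH s0 => [|b s] IH s0.
  by exists a; rewrite ?mem_head// big_cons big_nil mulr1.
have [//||x xs xle] := IH; first by move=> y ys; apply: s0; rewrite inE ys orbT.
have x0 : 0 <= x by apply: s0; rewrite inE xs orbT.
rewrite big_cons; have [ax|xa] := leP a x.
  exists a; rewrite ?mem_head//= exprS ler_wpM2l// (le_trans _ xle)//.
  by apply: lerXn2r; rewrite ?nnegrE.
exists x; first by rewrite in_cons xs orbT.
rewrite /= exprS.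
apply: (@le_trans _ _ (a * x ^+ size (b :: s))); last by rewrite ler_wpM2l.
by rewrite ler_wpM2r ?exprn_ge0// ltW.
Qed.

Lemma char_poly_at1 n (N : 'M[C]_n) : (char_poly N).[1] = \det (1%:M - N).
Proof.
rewrite -horner_evalE /char_poly -det_map_mx; congr (\det _).
apply/matrixP => a b; rewrite !mxE /= ?/horner_eval !hornerE.
by case: (a == b); rewrite /= ?mulr1n ?mulr0n ?hornerE.
Qed.

(** If [1 - N] is nearly singular, one of the eigenvalues [mu] of [N] is near 1,
    and scaling [N] by [mu^-1 = 1 - zeta] makes [1 - N] exactly singular. *)
Lemma singular_scaling n (N : 'M[C]_n) : (0 < n)%N ->
  rnorm (\det (1%:M - N)) <= 2^-1 ^+ n ->
  exists zeta : C, \det (1%:M + (zeta - 1) *: N) = 0 /\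
    rnorm zeta ^+ n <= 2 ^+ n * rnorm (\det (1%:M - N)).
Proof.
move=> n0 small; have [s pE] := closed_field_poly_normal (char_poly N).
have monN := char_poly_monic N.
rewrite (monicP monN) scale1r in pE.
have ss : size s = n.
  by have := size_char_poly N; rewrite pE size_prod_XsubC => -[].
have detE : rnorm (\det (1%:M - N)) = \prod_(x <- [seq rnorm (1 - z : C) | z : C <- s]) x.
  rewrite -char_poly_at1 pE horner_prod big_map.
  elim: (s) => [|z t IH]; first by rewrite !big_nil rnorm1.
  by rewrite !big_cons rnormM IH !hornerE.
have [||x /mapP[mu mus ->]] := @le_prod_exists [seq rnorm (1 - z : C) | z : C <- s].
- by rewrite size_map ss.
- by move=> x /mapP[z _ ->]; exact: rnorm_ge0.
rewrite size_map ss -detE => mule.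
have half : rnorm (1 - mu) <= 2^-1.
  rewrite -(@ler_pXn2r R n)// ?nnegrE ?rnorm_ge0 ?invr_ge0//.
  exact: le_trans mule small.
have mu2 : 2^-1 <= rnorm mu.
  have := ler_rnormD (1 - mu) mu; rewrite subrK rnorm1.
  by move: half; lra.
have mu0 : mu != 0 by rewrite -rnorm_gt0 (lt_le_trans _ mu2)// invr_gt0.
exists (1 - mu^-1); split.
  have -> : 1%:M + (1 - mu^-1 - 1) *: N = mu^-1 *: (mu%:M - N).
    rewrite addrAC subrr add0r scaleNr scalerBr.
    by rewrite scale_scalar_mx mulVf.
  rewrite detZ; apply/eqP; rewrite mulf_eq0; apply/orP; right.
  have : root (char_poly N) mu by rewrite pE root_prod_XsubC.
  rewrite -eigenvalue_root_char => /eigenvalueP[v vN v0].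
  by apply/det0P; exists v => //; rewrite mulmxBr vN mul_mx_scalar subrr.
have -> : 1 - mu^-1 = - ((1 - mu) / mu) by rewrite mulrBl divff// mul1r opprB.
rewrite rnormN rnormM rnormV exprMn mulrC ler_pM// ?exprn_ge0 ?invr_ge0 ?rnorm_ge0//.
apply: lerXn2r; rewrite ?nnegrE ?invr_ge0 ?rnorm_ge0//.
by rewrite -[leRHS]invrK lef_pV2// posrE ?invr_gt0// (lt_le_trans _ mu2)// invr_gt0.
Qed.

Lemma bounded_of_cvg0 (V : normedModType C) (f : functional V) :
  f @ nbhs (0 : V) --> (0 : C) -> bounded_op f.
Proof.
move=> /rcvgP/(_ 1 ltr01)/rnbhsP[e e0 He]; apply/bounded_opP.
exists (2 / e); first by rewrite divr_ge0// ltW.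
move=> x; have [->|x0] := eqVneq x 0; first by rewrite linear0 !rnorm0 mulr0.
have nx : 0 < rnorm x by rewrite rnorm_gt0.
pose t := e / (2 * rnorm x); have t0 : 0 < t by rewrite divr_gt0// mulr_gt0.
have := He (t%:C *: x); rewrite !sub0r !rnormN functionalZ rnormZ rnormM rnormR gtr0_norm//.
have -> : t * rnorm x = e / 2 by rewrite /t; field; rewrite gt_eqF.
rewrite ltr_pdivrMr// ltr_pMr// ltr1n => /(_ isT).
rewrite -ltr_pdivlMl// mulr1 => /ltW/le_trans; apply.
by rewrite /t invf_div mulrAC.
Qed.

End Bases.

(** * Virtual levels *)

Section VirtualLevel.
Context {R : realType}.
Local Notation C := R[i].
Local Notation functional V := {linear V -> C}.

Lemma weak_cvgP (F : normedModType C) (G : set_system C) {FG : Filter G}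
    (f : C -> F) (l : F) :
  weak_cvg G f l <->
  forall th : functional F, bounded_op th -> (fun z => th (f z) : C) @ G --> (th l : C).
Proof.
have H := @initial_cvgP R F (dual F) (fun y th => sval th y) (f @ G) _ l.
split=> [/H fl th bth|fl]; first exact: (fl (exist _ th bth)).
by apply/H => -[th bth]; exact: fl.
Qed.

Lemma has_operator_limitP (E F : normedModType C) (P : option (predual F))
    (G : set_system C) {FG : Filter G} (S : C -> E -> F) :
  has_operator_limit P G S <-> exists L : {linear E -> F}, bounded_op L /\
    ((forall th : functional F, bounded_op th ->
        forall u, (fun z => th (S z u) : C) @ G --> (th (L u) : C)) \/
     (exists p, P = Some p /\ forall g u,
        (fun z => predual_ev p (S z u) g : C) @ G --> (predual_ev p (L u) g : C))).
Proof.
split=> -[L [bL H]]; exists L; split => //; case: H.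
- by move=> SL; left=> th bth u; have /weak_cvgP := SL u; apply.
- case: P => // p SL; right; exists p; split => // g u.
  exact: ((weakstar_cvgP p (fun z => S z u) (L u)).1 (SL u)).
- by move=> SL; left=> u; apply/weak_cvgP => th bth; exact: SL.
- move=> [p [-> SL]]; right=> u.
  exact: ((weakstar_cvgP p (fun z => S z u) (L u)).2 (SL^~ u)).
Qed.

Lemma within_proper (A : set C) (z : C) : closure A z ->
  ProperFilter (within A (nbhs z)).
Proof.
move=> clA; apply: Build_ProperFilter_ex => Q /= AQ.
have [y [Ay Qy]] := clA _ AQ; exists y; exact: Qy.
Qed.

Section setting.
Variables (E X F : completeNormedModType C) (i : {linear E -> X}) (j : {linear X -> F}).
Variables (P : option (predual F)) (A : operator X X) (Ahat : operator F F).
Variables (Omega : set C) (z0 : C) (B0 : {linear F -> E}).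
Variables (r : nat) (psi : 'I_r -> functional F) (e : 'I_r -> E) (delta : R).
Hypotheses (bi : bounded_op i) (bj : bounded_op j).
Hypotheses (injij : injective (j \o i)).
Hypotheses (A_ext : extension_assumption j A P Ahat).
Hypotheses (Omega_resolvent : Omega `<=` ~` spectrum A) (clOmega : closure Omega z0).
Hypotheses (ie : independent e) (bpsi : forall l, bounded_op (psi l)).
Hypotheses (B0E : forall x, B0 x = finite_rank psi e x).
Hypotheses (delta0 : 0 < delta).

Let AB := op_add A (op_sandwich i (op_of_linear B0) j).
Let near_z0 := Omega `&` ball z0 delta%:C.
Context (G : set_system C) {FG : ProperFilter G}.
Hypothesis Gnear : \forall z \near G, near_z0 z.

Hypotheses (AB_regular : Omega `&` spectrum AB `&` ball z0 delta%:C = set0).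

Let psij l : functional X := psi l \o j.
Let ie_ l : X := i (e l).
Let Rz z u : F := j (resolvent AB z (i u)).

(** [1 - N z] is the matrix that decides about the invertibility of [A - z]. *)
Definition virtual_mx z : 'M[C]_r := \matrix_(a, b) psi b (Rz z (e a)).

Let bpsij l : bounded_op (psij l). Proof. exact: bounded_comp. Qed.

Let GP (Q : C -> Prop) : (forall z, near_z0 z -> Q z) -> \forall z \near G, Q z.
Proof. by move=> H; apply: filterS Gnear => z; exact: H. Qed.

Lemma sandwich_rank x : i (B0 (j x)) = finite_rank psij ie_ x.
Proof. by rewrite B0E linear_comb. Qed.

Lemma sandwich_dom : op_dom AB = op_dom A.
Proof. by apply/seteqP; split=> x /=; [case|]. Qed.

Lemma sandwich_fun : (AB : X -> X) = (fun x => A x + finite_rank psij ie_ x).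
Proof. by apply/funext => x /=; rewrite sandwich_rank. Qed.

Lemma sandwich_inverse z : near_z0 z -> exists S : {linear X -> X},
  [/\ bounded_op S,
    is_inverse (op_dom A) (op_shift (fun x => A x + finite_rank psij ie_ x) z) S &
    forall y, resolvent AB z y = S y].
Proof.
move=> [Oz Bz].
have /not_spectrumP[S bS invS] : ~ spectrum AB z.
  by move=> sz; suff : set0 z by []; rewrite -AB_regular; split.
exists S; split => // [|y]; last exact: resolventE.
by rewrite -sandwich_dom -sandwich_fun.
Qed.

(** The case [c = - 1] describes [A], and [c = zeta - 1] describes the operator
    perturbed with coefficient [zeta]; see [rank_split]. *)
Lemma virtual_mxE z (S : {linear X -> X}) c :
  (forall y, resolvent AB z y = S y) ->
  rank_mx S psij (fun l => c *: ie_ l) = 1%:M + c *: virtual_mx z.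
Proof.
move=> SE; congr (_ + _); apply/matrixP => a b; rewrite !mxE linearZ.
by rewrite functionalZ /psij /= /Rz SE.
Qed.

Lemma rank_split z zeta x :
  op_shift A z x + zeta *: i (B0 (j x)) =
  op_shift (fun x => A x + finite_rank psij ie_ x) z x +
  finite_rank psij (fun l => (zeta - 1) *: ie_ l) x.
Proof.
have -> : finite_rank psij (fun l => (zeta - 1) *: ie_ l) x =
    (zeta - 1) *: finite_rank psij ie_ x.
  rewrite !finite_rankE scaler_sumr; apply: eq_bigr => l _.
  by rewrite !scalerA mulrC.
rewrite sandwich_rank /op_shift scalerBl scale1r [X in _ = X + _]addrAC -[RHS]addrA.
by rewrite [X in _ = _ + X]addrCA subrr addr0.
Qed.

Lemma det_virtual_neq0 z : near_z0 z -> \det (1%:M - virtual_mx z) != 0.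
Proof.
move=> nz; have [S [bS invS SE]] := sandwich_inverse nz.
apply/eqP => det0.
have := virtual_mxE (0 - 1) SE; rewrite {2}sub0r scaleN1r => mxE'.
have [x [Dx x0]] := rank_mx_not_injective (psi := psij)
  (w := fun l => (0 - 1) *: ie_ l) invS (etrans (congr1 _ mxE') det0).
rewrite -rank_split scale0r addr0 => Ax0.
have [T _ invT] := (not_spectrumP _ _).1 (Omega_resolvent nz.1).
by move/eqP: x0; apply; exact: is_inverse_inj invT Dx Ax0.
Qed.

Lemma resolvent_split z u : near_z0 z -> let x := j (resolvent A z (i u)) in
  coords psi x *m (1%:M - virtual_mx z) = coords psi (Rz z u) /\
  x = Rz z u + comb (fun l => Rz z (e l)) (coords psi x).
Proof.
move=> nz; have [S [bS invS SE]] := sandwich_inverse nz.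
have [T bT invT] := (not_spectrumP _ _).1 (Omega_resolvent nz.1).
have [Dx Ax] := invT.1 (i u); rewrite -(resolventE (i u) invT) in Dx Ax.
move: Dx Ax; set x := resolvent A z (i u) => Dx Ax xj.
have cE : coords psij x = coords psi xj by apply/rowP => l; rewrite !mxE.
have := virtual_mxE (0 - 1) SE; rewrite {2}sub0r scaleN1r => mxE'.
split.
  rewrite -mxE' -cE (rank_mx_coords psij _ invS Dx) -rank_split scale0r addr0 Ax -SE.
  by apply/rowP => l; rewrite !mxE.
rewrite {1}/xj; have -> : x = S (i u) + S (finite_rank psij ie_ x).
  rewrite -linearD -{1}(invS.2 x Dx); congr (S _).
  by rewrite -Ax /op_shift addrAC.
rewrite linearD /Rz SE; congr (_ + _).
rewrite /finite_rank cE (linear_comb S) (linear_comb j); apply: eq_bigr => l _.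
by rewrite /= SE.
Qed.

Lemma cvg_one_sub (N0 : 'M[C]_r) :
  (forall a b, (fun z => virtual_mx z a b) @ G --> N0 a b) ->
  forall a b, (fun z => (1%:M - virtual_mx z) a b) @ G --> (1%:M - N0) a b.
Proof.
move=> NN0 a b.
have subE (Q : 'M[C]_r) : (1%:M - Q) a b = (1%:M a b : C) + - Q a b by rewrite !mxE.
rewrite subE (_ : (fun z => _) = fun z => (1%:M a b : C) + - virtual_mx z a b).
  have NN : (fun z => - virtual_mx z a b : C) @ G --> (- N0 a b : C).
    exact (scalar_cvgN (NN0 a b)).
  exact (scalar_cvgD (cvg_cst (1%:M a b : C)) NN).
by apply/funext => z; exact: subE.
Qed.

(** As long as [1 - N z] stays away from singular matrices, the limits for the
    resolvent of [A + i B0 j] carry over to the resolvent of [A]. *)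
Lemma resolvent_limit (th : functional F) (L : {linear E -> F}) (N0 : 'M[C]_r)
    (n : E -> 'rV[C]_r) :
  (forall u, (fun z => th (Rz z u) : C) @ G --> (th (L u) : C)) ->
  (forall u l, (fun z => psi l (Rz z u) : C) @ G --> n u 0 l) ->
  (forall a b, (fun z => virtual_mx z a b) @ G --> N0 a b) ->
  \det (1%:M - N0) != 0 ->
  forall u, (fun z => th (j (resolvent A z (i u))) : C) @ G -->
    (th (L u + comb (fun l => L (e l)) (n u *m invmx (1%:M - N0))) : C).
Proof.
move=> thL nL NN0 det0 u.
have cvgI := cvg_invmx det0 (GP det_virtual_neq0) (cvg_one_sub NN0).
pose c z := coords psi (Rz z u) *m invmx (1%:M - virtual_mx z).
have cvgc l : (fun z => c z 0 l) @ G --> (n u *m invmx (1%:M - N0)) 0 l.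
  rewrite mxE; under eq_fun do rewrite mxE.
  apply: scalar_cvg_sum => k; apply: scalar_cvgM; last exact: cvgI.
  by under eq_fun do rewrite mxE; exact: nL.
apply: (@cvg_trans _ ((fun z => th (Rz z u) +
    \sum_(l <- index_enum 'I_r) c z 0 l * th (Rz z (e l)) : C) @ G)).
  apply: near_eq_cvg; apply: GP => z nz.
  have [cE ->] := resolvent_split u nz; rewrite functionalD functional_sum.
  have uM : 1%:M - virtual_mx z \in unitmx.
    by rewrite unitmxE unitfE; exact: det_virtual_neq0.
  by rewrite /c -cE mulmxK.
have cs : (fun z => \sum_(l <- index_enum 'I_r) c z 0 l * th (Rz z (e l)) : C) @ G -->
    (\sum_(l <- index_enum 'I_r) (n u *m invmx (1%:M - N0)) 0 l * th (L (e l)) : C).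
  exact (scalar_cvg_sum (s := index_enum 'I_r)
    (fun l => scalar_cvgM (cvgc l) (thL (e l)))).
rewrite functionalD functional_sum.
exact (scalar_cvgD (thL u) cs).
Qed.

Lemma Rz_linear z a u v : near_z0 z -> Rz z (a *: u + v) = a *: Rz z u + Rz z v.
Proof.
by move=> nz; have [S [_ _ SE]] := sandwich_inverse nz; rewrite /Rz !SE !linearP.
Qed.

Let jie l : F := j (i (e l)).

Lemma Rz_Ahat z u : near_z0 z -> op_dom Ahat (Rz z u) /\
  Ahat (Rz z u) = j (i u) + z *: Rz z u - comb jie (coords psi (Rz z u)).
Proof.
move=> nz; have [S [_ invS SE]] := sandwich_inverse nz.
have [] := invS.1 (i u); rewrite -SE.
rewrite /op_shift -sandwich_rank B0E -/(Rz z u) => Dx Ax.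
have [DR AR] := extended_graphP A_ext Dx; split => //.
have -> : comb jie (coords psi (Rz z u)) = j (i (comb e (coords psi (Rz z u)))).
  by rewrite (linear_comb i) (linear_comb j).
rewrite [LHS]AR; move: Ax; rewrite {2}/Rz; set x := resolvent AB z (i u) => Ax.
rewrite (_ : A x = i u + z *: x - i (comb e (coords psi (Rz z u)))).
  by rewrite linearB linearD linearZ.
by rewrite -Ax subrK addrK.
Qed.

Lemma independent_jie : independent jie.
Proof.
move=> c c0; apply: ie; apply: injij; rewrite /= !linear0 -[RHS]c0.
by rewrite !linear_sum; apply: eq_bigr => l _; rewrite !linearZ.
Qed.

Hypothesis Gz0 : id @ G --> z0.

Section weakstar_limit.
Variables (p : predual F) (L : {linear E -> F}).
Hypotheses (cAhat : weakstar_closed_graph p Ahat) (bL : bounded_op L).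
Hypothesis RzL : forall u g,
  (fun z => predual_ev p (Rz z u) g : C) @ G --> (predual_ev p (L u) g : C).

(** The functionals [psi l] need not be weak-star continuous.  The convergence is
    forced by the closed graph instead: the difference of the values at two
    points of [G] tends to 0, and [weakstar_component_cvg0] shows that the
    coefficients form a Cauchy filter. *)
Lemma weakstar_coefficient u l : exists c : C, (fun z => psi l (Rz z u) : C) @ G --> c.
Proof.
apply: complex_cauchy => d d0.
have ev1 (f : C -> C) (c : C) : f @ G --> c -> (fun q : C * C => f q.1) @ filter_prod G G --> c.
  by move=> fc Q /fc GQ; exists (f @^-1` Q, setT) => [|[q1 q2] []//]; split => //; exact: filterT.
have ev2 (f : C -> C) (c : C) : f @ G --> c -> (fun q : C * C => f q.2) @ filter_prod G G --> c.
  by move=> fc Q /fc GQ; exists (setT, f @^-1` Q) => [|[q1 q2] []//]; split => //; exact: filterT.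
have FGG : Filter (filter_prod G G) by exact _.
have := @weakstar_component_cvg0 R F p Ahat cAhat r jie (C * C)%type (filter_prod G G) FGG
  (fun q => Rz q.1 u - Rz q.2 u) (fun q => q.1 *: Rz q.1 u - q.2 *: Rz q.2 u)
  (fun q => coords psi (Rz q.1 u) - coords psi (Rz q.2 u)) independent_jie.
have nearG : \forall q \near filter_prod G G, near_z0 q.1 /\ near_z0 q.2.
  by exists (near_z0, near_z0) => // -[q1 q2] [].
have lA := linear_on_operator Ahat.
have diff_ev g : (fun q : C * C => predual_ev p (Rz q.1 u - Rz q.2 u) g : C) =
    fun q => (predual_ev p (Rz q.1 u) g : C) + - (predual_ev p (Rz q.2 u) g : C).
  have [th _ thE] := @predual_functional R F p g.
  by apply/funext => q; rewrite -!thE functionalB.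
have diff_ev' g : (fun q : C * C => predual_ev p (q.1 *: Rz q.1 u - q.2 *: Rz q.2 u) g : C) =
    fun q => q.1 * (predual_ev p (Rz q.1 u) g : C) + - (q.2 * (predual_ev p (Rz q.2 u) g : C)).
  have [th _ thE] := @predual_functional R F p g.
  by apply/funext => q; rewrite -!thE functionalB !functionalZ.
move=> /(_ _ _ _ l) h; have /rcvgP/(_ d d0) : (fun q : C * C =>
    (coords psi (Rz q.1 u) - coords psi (Rz q.2 u)) 0 l) @ filter_prod G G --> (0 : C).
  apply: h.
  - apply: filterS nearG => -[z z'] /= [nz nz'].
    have [D1 A1] := Rz_Ahat u nz; have [D2 A2] := Rz_Ahat u nz'.
    split; first exact: is_subspaceB lA.1 D1 D2.
    rewrite (linear_onB lA)// A1 A2 (linearB (comb jie)).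
    by rewrite !opprD addrACA [X in X + _]addrACA subrr add0r.
  - move=> g; rewrite (diff_ev g) -(subrr (predual_ev p (L u) g : C)).
    exact (scalar_cvgD (ev1 _ _ (@RzL u g)) (scalar_cvgN (ev2 _ _ (@RzL u g)))).
  - move=> g; rewrite (diff_ev' g) -(subrr (z0 * (predual_ev p (L u) g : C))).
    have lim : (fun t => t * (predual_ev p (Rz t u) g : C)) @ G -->
        z0 * (predual_ev p (L u) g : C).
      exact (scalar_cvgM Gz0 (@RzL u g)).
    exact (scalar_cvgD (ev1 _ _ lim) (scalar_cvgN (ev2 _ _ lim))).
apply: filterS => -[z z'] /=; rewrite sub0r rnormN.
by rewrite -coordsB mxE functionalB.
Qed.

(** The limits of the coefficients are continuous by a second application of
    [weakstar_component_cvg0], now to [L u] for [u] tending to 0. *)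
Lemma weakstar_coefficients : exists n : 'I_r -> functional E,
  (forall l, bounded_op (n l)) /\
  forall u l, (fun z => psi l (Rz z u) : C) @ G --> (n l u : C).
Proof.
have /choice[m mP] (ul : E * 'I_r) :
    exists c : C, (fun z => psi ul.2 (Rz z ul.1) : C) @ G --> c.
  exact: weakstar_coefficient.
have /choice[n nE] l : exists n : functional E, forall u, n u = m (u, l) :> C.
  apply: linear_of => a u v; apply: rcvg_unique (mP (_, l)) _.
  have lim : (fun z => a * (psi l (Rz z u) : C) + (psi l (Rz z v) : C)) @ G -->
      a * m (u, l) + m (v, l).
    exact (scalar_cvgD (scalar_cvgM (cvg_cst a) (mP (u, l))) (mP (v, l))).
  apply: cvg_trans lim; apply: near_eq_cvg; apply: GP => z nz /=.
  by rewrite (Rz_linear _ _ _ nz) functionalD functionalZ.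
have nL u l : (fun z => psi l (Rz z u) : C) @ G --> (n l u : C).
  by rewrite nE; exact: mP (u, l).
exists n; split => // l.
have lim_Ahat u : op_dom Ahat (L u) /\
    Ahat (L u) = j (i u) + z0 *: L u - comb jie (\row_l n l u).
  have RA : \forall z \near G, op_dom Ahat (Rz z u) /\ Ahat (Rz z u) =
      j (i u) + z *: Rz z u - comb jie (coords psi (Rz z u)).
    by apply: GP => z nz; exact: Rz_Ahat.
  refine (weakstar_closed_limit cAhat RA (@RzL u) _) => g.
  have [th _ thE] := @predual_functional R F p g.
  rewrite -thE functionalB functionalD functionalZ functional_sum.
  rewrite (_ : (fun t => _) = fun z => (th (j (i u)) : C) + z * th (Rz z u) +
      - \sum_(l <- index_enum 'I_r) psi l (Rz z u) * th (jie l)); last first.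
    apply/funext => z; rewrite -thE functionalB functionalD functionalZ functional_sum.
    by congr (_ - _); apply: eq_bigr => k _; rewrite mxE.
  have lim1 : (fun z => th (Rz z u) : C) @ G --> (th (L u) : C).
    by under eq_fun do rewrite thE; rewrite thE; exact: RzL.
  have lim2 : (fun z => \sum_(l <- index_enum 'I_r) psi l (Rz z u) * th (jie l) : C) @ G -->
      (\sum_(l <- index_enum 'I_r) (\row_l n l u) 0 l * th (jie l) : C).
    refine (scalar_cvg_sum (s := index_enum 'I_r) _) => k; rewrite mxE.
    exact (scalar_cvgM (nL u k) (cvg_cst _)).
  exact (scalar_cvgD (scalar_cvgD (cvg_cst _) (scalar_cvgM Gz0 lim1)) (scalar_cvgN lim2)).
apply: bounded_of_cvg0.
have cont (th : functional F) (M : {linear E -> F}) : bounded_op th -> bounded_op M ->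
    (fun u => th (M u) : C) @ nbhs (0 : E) --> (0 : C).
  move=> bth bM; rewrite -(linear0 (th \o M : functional E)).
  by apply: (@bounded_cvg R E C (th \o M) E (nbhs 0) _ id 0); [exact: bounded_comp|].
have h := @weakstar_component_cvg0 R F p Ahat cAhat r jie E (nbhs 0) (nbhs_filter (0 : E))
  (fun u => L u) (fun u => j (i u) + z0 *: L u) (fun u => \row_l n l u) independent_jie.
have {h} := h _ _ _ l; rewrite (_ : (fun t => _) = n l); last first.
  by apply/funext => u; rewrite mxE.
apply.
- by apply: nearW => u; exact: lim_Ahat.
- move=> g; have [th bth thE] := @predual_functional R F p g.
  by under eq_fun do rewrite -thE; exact: cont.
- move=> g; have [th bth thE] := @predual_functional R F p g.
  under eq_fun do rewrite -thE functionalD functionalZ.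
  have bji : bounded_op (j \o i) by exact: bounded_comp.
  have c1 := cont th (j \o i) bth bji; have c2 := cont th L bth bL.
  have lim : (fun u => (th (j (i u)) : C) + z0 * th (L u)) @ nbhs (0 : E) --> 0 + z0 * (0 : C).
    exact (scalar_cvgD c1 (scalar_cvgM (cvg_cst z0) c2)).
  by move: lim; rewrite mulr0 addr0.
Qed.

End weakstar_limit.
Lemma coefficient_limits : has_operator_limit P G Rz ->
  exists (L : {linear E -> F}) (n : 'I_r -> functional E), [/\ bounded_op L,
    forall l, bounded_op (n l),
    forall u l, (fun z => psi l (Rz z u) : C) @ G --> (n l u : C) &
    (forall th : functional F, bounded_op th ->
        forall u, (fun z => th (Rz z u) : C) @ G --> (th (L u) : C)) \/
    (exists p, P = Some p /\ forall g u,
        (fun z => predual_ev p (Rz z u) g : C) @ G --> (predual_ev p (L u) g : C))].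
Proof.
move=> /has_operator_limitP[L [bL [RL|[p [EP RL]]]]].
  exists L, (fun l => psi l \o L : functional E); split; [by []| | |by left].
    by move=> l; exact: bounded_comp.
  by move=> u l; exact: RL.
have cAhat : weakstar_closed_graph p Ahat by have := A_ext.2; rewrite EP.
have [n [bn nL]] := weakstar_coefficients cAhat bL (fun u g => RL g u).
by exists L, n; split => //; right; exists p.
Qed.

(** If [1 - N z] had an invertible limit, then the resolvent of [A] would have a
    limit by [resolvent_limit]. *)
Lemma det_virtual_cvg0 : has_operator_limit P G Rz ->
  ~ has_operator_limit P G (fun z u => j (resolvent A z (i u))) ->
  (fun z => \det (1%:M - virtual_mx z)) @ G --> (0 : C).
Proof.
move=> /coefficient_limits[L [n [bL bn nL RL]]] noA.
pose N0 : 'M[C]_r := \matrix_(a, b) n b (e a).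
have NN0 a b : (fun z => virtual_mx z a b) @ G --> N0 a b.
  by rewrite mxE; under eq_fun do rewrite mxE; exact: nL.
have detN : (fun z => \det (1%:M - virtual_mx z)) @ G --> \det (1%:M - N0).
  exact (cvg_det (cvg_one_sub NN0)).
have [det0|det0] := eqVneq (\det (1%:M - N0)) 0; first by rewrite -det0.
exfalso; apply: noA; apply/has_operator_limitP.
pose I0 := invmx (1%:M - N0); pose w a := comb e (row a I0).
have [|L' L'E] := @linear_of R E F (fun u => L u + L (finite_rank n w u)).
  by move=> a u v; rewrite !linearP scalerDr addrACA.
have nL' u l : (fun z => psi l (Rz z u) : C) @ G --> (coords n u) 0 l.
  by rewrite mxE; exact: nL.
have lim (th : functional F) :
    (forall u, (fun z => th (Rz z u) : C) @ G --> (th (L u) : C)) ->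
    forall u, (fun z => th (j (resolvent A z (i u))) : C) @ G --> (th (L' u) : C).
  move=> thL u; rewrite L'E.
  have -> : L (finite_rank n w u) = comb (fun l => L (e l)) (coords n u *m I0).
    have -> : finite_rank n w u = comb e (coords n u *m I0) by rewrite comb_mulmx.
    by rewrite linear_comb.
  exact (@resolvent_limit th L N0 (coords n) thL nL' NN0 det0 u).
exists L'; split.
  have bw : bounded_op (finite_rank n w) by exact: bounded_finite_rank_op.
  have /bounded_opP[M M0 LM] := bL; have /bounded_opP[M' M'0 wM] := bw.
  apply/bounded_opP; exists (M + M * M') => [|u]; first by rewrite addr_ge0// mulr_ge0.
  rewrite L'E (le_trans (ler_rnormD _ _))// mulrDl lerD// -mulrA.
  by rewrite (le_trans (LM _))// ler_wpM2l//; exact: wM.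
case: RL => [RL|[p [EP RL]]].
  by left=> th bth; apply: lim; exact: RL.
right; exists p; split; first by [].
move=> g u; have [th _ thE] := @predual_functional R F p g.
have thR v : (fun z => th (Rz z v) : C) @ G --> (th (L v) : C).
  by rewrite thE; under eq_fun do rewrite thE; exact (RL g v).
rewrite -thE; under eq_fun do rewrite -thE.
exact (lim th thR u).
Qed.

Let T zeta := op_add A (op_scale zeta (op_sandwich i (op_of_linear B0) j)).

Lemma perturbed_dom zeta : op_dom (T zeta) = op_dom A.
Proof. by apply/seteqP; split=> x /=; [case|]. Qed.

Lemma perturbed_fun zeta x :
  T zeta x = A x + finite_rank psij (fun l => zeta *: ie_ l) x.
Proof.
rewrite /= sandwich_rank !finite_rankE scaler_sumr; congr (_ + _).
by apply: eq_bigr => l _; rewrite !scalerA mulrC.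
Qed.

Lemma perturbed_spectrum z zeta : near_z0 z ->
  \det (1%:M + (zeta - 1) *: virtual_mx z) = 0 -> spectrum (T zeta) z.
Proof.
move=> nz det0; have [S [bS invS SE]] := sandwich_inverse nz.
rewrite -(virtual_mxE _ SE) in det0.
have [x [Dx x0]] := rank_mx_not_injective invS det0.
rewrite -rank_split => Tx0 /resolvent_setP[T' _ invT'].
move/eqP: x0; apply; apply: (is_inverse_inj invT'); first by rewrite perturbed_dom.
by rewrite -[RHS]Tx0 /op_shift /= addrAC.
Qed.

(** For a small coefficient [zeta] the perturbed operator is still invertible at
    one point of [U], so its spectral points in [U] are isolated. *)
Lemma perturbed_discrete (U : set C) (w1 : C) :
  closed_operator A -> connected U -> U `<=` ~` essential_spectrum1 A ->
  Omega `<=` U -> Omega w1 ->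
  exists2 eps : R, 0 < eps & forall zeta z, rnorm zeta <= eps -> Omega z ->
    spectrum (T zeta) z -> discrete_spectrum (T zeta) z.
Proof.
move=> cA cU Uess OU Ow1; have lA := linear_on_operator A.
have [S1 bS1 invS1] := (not_spectrumP _ _).1 (Omega_resolvent Ow1).
have /bounded_opP[M M0 S1M] := bS1.
have /bounded_opP[Mb Mb0 KM] : bounded_op (finite_rank psij ie_).
  by apply: bounded_finite_rank_op.
have eps0 : 0 < (2 * (Mb * M + 1))^-1.
  by rewrite invr_gt0 mulr_gt0// ltr_wpDl// mulr_ge0.
exists (2 * (Mb * M + 1))^-1 => // zeta z small Oz sz.
have indexA z' : U z' -> index_zero (op_dom A) (op_shift A z').
  apply: (@connected_spread _ U [set z' | index_zero (op_dom A) (op_shift A z')]) => //.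
  - rewrite openE => y iy; apply/rnbhsP.
    have [d d0 Hd] := index_zero_near (linear_on_shift y lA) iy.
    exists d => // y' yy'; have := Hd (y' - y).
    by rewrite shiftD addrCA subrr addr0; apply; rewrite rnormBC.
  - by move=> y Uy; apply: index_zero_closure => //; exact: Uess.
  - exists w1; first exact: OU.
    by apply: index_zero_invertible; exists S1.
pose f x := A x + finite_rank psij (fun l => zeta *: ie_ l) x.
have lf : linear_on (op_dom A) f by exact: linear_on_add.
have Tf : (T zeta : X -> X) = f by apply/funext => x; exact: perturbed_fun.
have inv1 : invertible_on (op_dom A) (op_shift f w1).
  have KM' x : rnorm (finite_rank psij (fun l => zeta *: ie_ l) x) <=
      (rnorm zeta * Mb) * rnorm x.
    have -> : finite_rank psij (fun l => zeta *: ie_ l) x =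
        zeta *: finite_rank psij ie_ x.
      by rewrite !finite_rankE scaler_sumr; apply: eq_bigr => l _; rewrite !scalerA mulrC.
    by rewrite rnormZ -mulrA ler_wpM2l ?rnorm_ge0//; exact: KM.
  have half : rnorm zeta * Mb * M <= 2^-1.
    rewrite -mulrA (le_trans (ler_wpM2r _ small)) ?mulr_ge0//.
    rewrite invfM -mulrA ger_pMr ?invr_gt0// mulrC ler_pdivrMr ?mul1r ?lerDl//.
    by rewrite ltr_wpDl// mulr_ge0.
  have [S' S'M invS'] := invertible_add_small (linear_on_shift w1 lA) invS1 S1M M0
    (mulr_ge0 (rnorm_ge0 zeta) Mb0) KM' half.
  exists S'; first by apply/bounded_opP; exists (2 * M) => //; rewrite mulr_ge0.
  by rewrite shift_finite_rank.
apply: (@discrete_spectrum_finite_rank R X (T zeta) A z r psij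
    (fun l => zeta *: ie_ l)) => //.
- by rewrite perturbed_dom; apply/not_spectrumP; exact: Omega_resolvent.
- exact: perturbed_fun.
have [||d d0 Hd] := @isolated_singularities R X (op_dom A) f U lf cU _ _ z (OU _ Oz).
- by move=> y Uy; rewrite shift_finite_rank; apply: index_zero_add => //; exact: indexA.
- by exists w1 => //; exact: OU.
by exists d => // w wd; rewrite perturbed_dom Tf; exact: Hd.
Qed.

(** The coefficients [zeta] come from [singular_scaling], applied to the matrices
    [virtual_mx z], for which the determinant of [1 - N z] tends to 0. *)
Lemma created_eigenvalues (eps : R) : (0 < r)%N -> 0 < eps ->
  (fun z => \det (1%:M - virtual_mx z)) @ within near_z0 (nbhs z0) --> (0 : C) ->
  exists2 d : R, 0 < d & forall z : nat -> C,
    (forall n, (Omega `&` ball z0 d%:C) (z n)) -> z n @[n --> \oo] --> z0 ->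
    exists zeta : nat -> C, [/\ zeta n @[n --> \oo] --> (0 : C),
      forall n, rnorm (zeta n) <= eps & forall n, spectrum (T (zeta n)) (z n)].
Proof.
move=> r0 eps0 det0.
have pow0 (t : R) : 0 < t -> 0 < t ^+ r by exact: exprn_gt0.
have near_det (t : R) : 0 < t -> exists2 d : R, 0 < d & forall z, rnorm (z0 - z) < d ->
    near_z0 z -> 2 ^+ r * rnorm (\det (1%:M - virtual_mx z)) < t ^+ r.
  move=> t0; have t0' : 0 < t ^+ r / 2 ^+ r by rewrite divr_gt0// pow0.
  have /rcvgP/(_ _ t0')/rnbhsP[d d0 Hd] := det0; exists d => // z zd nz.
  by have := Hd z zd nz; rewrite sub0r rnormN ltr_pdivlMr ?pow0// mulrC.
have root (s t : R) : 0 <= s -> 0 < t -> s ^+ r <= t ^+ r -> s <= t.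
  by move=> s0 t0; rewrite ler_pXn2r// nnegrE// ltW.
have [d1 d10 H1] := near_det 1 ltr01; have [d2 d20 H2] := near_det eps eps0.
exists (Num.min delta (Num.min d1 d2)) => [|z Oz zz0].
  by rewrite !lt_min delta0 d10.
have nz n : near_z0 (z n).
  have [On /ltcR_ball] := Oz n; rewrite !lt_min => /andP[zd _].
  by split => //; apply/ltcR_ball.
have small n : rnorm (\det (1%:M - virtual_mx (z n))) <= 2^-1 ^+ r.
  have [On /ltcR_ball] := Oz n; rewrite !lt_min => /and3P[_ zd _].
  have := H1 (z n) zd (nz n); rewrite expr1n exprVn -ltr_pdivlMl ?pow0// mulr1.
  exact: ltW.
have /choice[zeta zetaP] n := singular_scaling r0 (small n).
exists zeta; split=> [|n|n]; last 2 first.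
- have [On /ltcR_ball] := Oz n; rewrite !lt_min => /and3P[_ _ zd].
  apply: root => //; first exact: rnorm_ge0.
  by apply: (le_trans (zetaP n).2); apply/ltW/H2.
- by apply: perturbed_spectrum; [exact: nz|exact: (zetaP n).1].
apply/rcvgP => t t0; have t20 : 0 < t / 2 by rewrite divr_gt0.
have [d d0 Hd] := near_det (t / 2) t20.
have /rcvgP/(_ d d0) := zz0; apply: filterS => n zd.
rewrite sub0r rnormN; apply: (@le_lt_trans _ _ (t / 2)).
  apply: root => //; first exact: rnorm_ge0.
  by apply: (le_trans (zetaP n).2); apply/ltW/Hd.
by rewrite ltr_pdivrMr// ltr_pMr// ltr1n.
Qed.

End setting.
End VirtualLevel.

(** Hence at a virtual level the resolvent of [A] itself has no limit. *)
Lemma regularizable0 (R : realType) (E X F : normedModType R[i])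
    (i : {linear E -> X}) (j : {linear X -> F}) (P : option (predual F))
    (A : operator X X) (Omega : set R[i]) (z0 : R[i]) (delta : R) :
  Omega `<=` ~` spectrum A -> 0 < delta ->
  has_operator_limit P (within (Omega `&` ball z0 delta%:C) (nbhs z0))
    (fun z u => j (resolvent A z (i u))) ->
  regularizable i j P A Omega z0 0.
Proof.
move=> Omega_resolvent d0 lim.
have [|Z Z0] := @linear_of R F E (fun=> 0); first by move=> a x y; rewrite scaler0 addr0.
exists Z; split.
  split; first by apply/bounded_opP; exists 0 => // x; rewrite Z0 rnorm0 mul0r.
  exists (fun=> 0); split; first by move=> c _ [].
  apply/seteqP; split=> [_ [x _ <-]|_ [c ->]]; first by exists (fun=> 0); rewrite Z0 big_ord0.
  by exists 0 => //; rewrite Z0 big_ord0.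
set AZ := op_add A _ => /=.
have domZ : op_dom AZ = op_dom A by apply/seteqP; split=> x /=; [case|].
have funZ : (AZ : X -> X) = A by apply/funext => x /=; rewrite Z0 linear0 addr0.
exists delta => //; split.
  rewrite -subset0 => z [[Oz sz] _]; apply: sz; apply/resolvent_setP.
  by rewrite domZ funZ; apply/not_spectrumP; exact: Omega_resolvent.
have -> // : (fun z u => j (resolvent AZ z (i u))) = fun z u => j (resolvent A z (i u)).
by apply/funext => z; apply/funext => u; rewrite /resolvent domZ funZ.
Qed.

Theorem theorem2p16 (R : realType) (E X F : completeNormedModType R[i])
    (X_infinite_dim : ~ finite_dim [set: X])
    (i : {linear E -> X}) (j : {linear X -> F})
    (i_embedding : continuous_embedding i)
    (j_embedding : continuous_embedding j)
    (P : option (predual F))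
    (A : operator X X) (A_closed : closed_operator A)
    (Ahat : operator F F) (A_ext : extension_assumption j A P Ahat)
    (Omega : set R[i]) (Omega_resolvent : Omega `<=` ~` spectrum A)
    (z0 : R[i]) (z0_ess : essential_spectrum A z0)
    (z0_boundary : boundary Omega z0) :
  (forall (B : nat -> operator F E) (z : nat -> R[i]),
    (forall n, relatively_bounded Ahat (B n)) ->
    relative_norm Ahat (B n) @[n --> \oo] --> 0%E ->
    (forall n, spectrum (op_add A (op_sandwich i (B n) j)) (z n) /\
               Omega (z n)) ->
    z n @[n --> \oo] --> z0 ->
    (forall n, relatively_compact Ahat (B n)) \/
    (forall n, point_spectrum (op_add A (op_sandwich i (B n) j)) (z n) /\
               Omega (z n)) ->
    limn_esup (fun n => opnorm (fun e => j (resolvent A (z n) (i e)))) = +oo%E)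
  /\
  ((exists2 w, (~` essential_spectrum1 A) w &
      Omega `<=` connected_component (~` essential_spectrum1 A) w) ->
   virtual_level i j P A Omega z0 ->
   exists2 delta : R, 0 < delta &
     forall z : nat -> R[i],
       (forall n, (Omega `&` ball z0 delta%:C) (z n)) ->
       z n @[n --> \oo] --> z0 ->
       exists (B : {linear F -> E}) (zeta : nat -> R[i]),
         [/\ bounded_finite_rank B, zeta n @[n --> \oo] --> (0 : R[i]) &
             forall n, discrete_spectrum
               (op_add A (op_scale (zeta n)
                  (op_sandwich i (op_of_linear B) j))) (z n)]).
Proof.
split=> [B z bB B0 zB zz0 _|[w _ OU] [r r0 [_ _ reg minimal]]].
  exact: (blow_up i_embedding j_embedding A_ext Omega_resolvent bB B0 zB zz0).
have [inji bi] := i_embedding; have [injj bj] := j_embedding.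
have injij : injective (j \o i) by exact: inj_comp.
have [B [rankB [delta delta0 [AB_regular lim]]]] := reg.
have [psi [e [ie bpsi BE]]] := bounded_finite_rankP rankB.
set near := Omega `&` ball z0 delta%:C in lim *.
have clOmega : closure Omega z0 by case: z0_boundary.
have near_proper : ProperFilter (within near (nbhs z0)).
  apply: within_proper => Q zQ; have zB : nbhs z0 (ball z0 delta%:C).
    by apply: nbhsx_ballx; rewrite ltcR.
  by have [y [Oy [Qy By]]] := clOmega _ (filterI zQ zB); exists y.
have [w1 Ow1 _] : exists2 w1, Omega w1 & True.
  by have [y [Oy _]] := clOmega _ (@filterT _ (nbhs z0) _); exists y.
have nolim : ~ has_operator_limit P (within near (nbhs z0))
    (fun z u => j (resolvent A z (i u))).
  by move=> /(regularizable0 Omega_resolvent delta0); exact: minimal.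
have nearG : \forall z \near within near (nbhs z0), near z by exact: withinT.
have G_z0 : id @ within near (nbhs z0) --> z0 by exact: cvg_within.
have det0 := det_virtual_cvg0 bi bj injij A_ext Omega_resolvent ie bpsi BE
  nearG AB_regular G_z0 lim nolim.
have [eps eps0 Heps] := perturbed_discrete i bj Omega_resolvent bpsi BE A_closed
  (@component_connected _ _ w) (@connected_component_sub _ _ w) OU Ow1.
have [d d0 Hd] := created_eigenvalues BE delta0 AB_regular r0 eps0 (det0 near_proper).
exists d => // z zd zz0; have [zeta [zeta0 zeta_eps zeta_sp]] := Hd z zd zz0.
exists B, zeta; split => //; first by case: rankB => bB dimB; split => //; exists r.
by move=> n; apply: Heps => //; case: (zd n).
Qed.
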